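(* Let $L$ be a semisimple Lie algebra of vector fields on $\mathbb{R}^N$ which has a split Cartan subalgebra $C$, and let $n=\dim C$. Then: (a) $\dim C$ equals the geometric rank of $C$. (b) Moreover, let a system of simple roots $\alpha_1,\dots,\alpha_n$ of $L$ with respect to $C$ be given. Then in suitable (local) coordinates $x_1,\dots,x_N$, the root spaces corresponding to the simple roots and their negatives are of the form $\exp(x_i)V_i$ (for $\alpha_i$) and $\exp(-x_i)W_i$ (for $-\alpha_i$), $i=1,\dots,n$, meaning that they are spanned by these vector fields, where $V_i$ and $W_i$ are vector fields whose coefficients with respect to the basis $\partial_{x_1},\dots,\partial_{x_N}$ are independent of $x_1,\dots,x_n$, and the linear span of the system of vector fields $$H_i=[\exp(x_i)V_i,\ \exp(-x_i)W_i],\qquad i=1,\dots,n,$$ is that of $\{\partial_{x_1},\dots,\partial_{x_n}\}$. (c) For any $1\le i\le n$, the Lie algebra generated by $\exp(x_i)V_i$ and $\exp(-x_i)W_i$ is a copy of $\mathrm{sl}(2,\mathbb{R})$.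
   Context: The geometric rank of a Lie algebra of vector fields on $\mathbb{R}^N$ is the maximum of the dimensions of the leaves of the corresponding foliation; it is the same as the dimension of the generic leaf, i.e. the generic rank of the matrix of coefficients of a basis of the algebra with respect to the standard basis $\partial_{x_1},\dots,\partial_{x_N}$ of vector fields on $\mathbb{R}^N$. A Cartan subalgebra $C$ of $L$ is split if $\mathrm{ad}(h)$ is diagonalizable over $\mathbb{R}$ for every $h\in C$, so that $L$ is the direct sum of $C$ and one-dimensional real root spaces. ''Linear span'' means span over $\mathbb{R}$. *)

(* Defs.v *)
From HB Require Import structures.
From mathcomp Require Import all_boot all_order all_algebra.
From mathcomp Require Import all_classical all_reals all_analysis.

Set Implicit Arguments.
Unset Strict Implicit.
Unset Printing Implicit Defensive.

Import Order.TTheory GRing.Theory Num.Theory.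
Import numFieldNormedType.Exports.

Local Open Scope classical_set_scope.
Local Open Scope ring_scope.

Definition is_subspace (R : realType) (V : lmodType R) (A : set V) : Prop :=
  A 0 /\ forall (a : R) (x y : V), A x -> A y -> A (a *: x + y).

Definition lspan (R : realType) (V : lmodType R) (S : set V) : set V :=
  smallest (@is_subspace R V) S.

Definition lin_indep (R : realType) (V : lmodType R) (m : nat)
    (b : 'I_m -> V) : Prop :=
  forall c : 'I_m -> R, \sum_(i < m) c i *: b i = 0 -> forall i, c i = 0.

Definition is_basis (R : realType) (V : lmodType R) (A : set V) (m : nat)
    (b : 'I_m -> V) : Prop :=
  lin_indep b /\ A = lspan (range b).

Definition has_dim (R : realType) (V : lmodType R) (A : set V) (m : nat) :
    Prop :=
  exists b : 'I_m -> V, is_basis A b.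

(* A Lie algebra is given by its underlying set [A] in an ambient real vector
   space [V] with an operation [br]; in the instances below [br] satisfies
   the Lie algebra axioms on the smooth vector fields of an open set, resp.
   on the square matrices. *)

Definition lie_subalgebra (R : realType) (V : lmodType R) (br : V -> V -> V)
    (A : set V) : Prop :=
  is_subspace A /\ forall x y, A x -> A y -> A (br x y).

Definition lie_gen (R : realType) (V : lmodType R) (br : V -> V -> V)
    (S : set V) : set V :=
  smallest (lie_subalgebra br) S.

Definition lie_ideal (R : realType) (V : lmodType R) (br : V -> V -> V)
    (L I : set V) : Prop :=
  [/\ is_subspace I, I `<=` L & forall x y, L x -> I y -> I (br x y)].

Definition commutator (R : realType) (V : lmodType R) (br : V -> V -> V)
    (A B : set V) : set V :=
  lspan [set br x y | x in A & y in B].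

Definition solvable_lie (R : realType) (V : lmodType R) (br : V -> V -> V)
    (A : set V) : Prop :=
  exists k, iter k (fun D => commutator br D D) A `<=` [set 0].

Definition nilpotent_lie (R : realType) (V : lmodType R) (br : V -> V -> V)
    (A : set V) : Prop :=
  exists k, iter k (commutator br A) A `<=` [set 0].

Definition semisimple_lie (R : realType) (V : lmodType R) (br : V -> V -> V)
    (L : set V) : Prop :=
  [/\ lie_subalgebra br L, exists d, has_dim L d &
      forall I, lie_ideal br L I -> solvable_lie br I -> I `<=` [set 0]].

Definition cartan_subalgebra (R : realType) (V : lmodType R)
    (br : V -> V -> V) (L C : set V) : Prop :=
  [/\ C `<=` L, lie_subalgebra br C, nilpotent_lie br C &
      forall x, L x -> (forall y, C y -> C (br x y)) -> C x].

Definition ad_diagonalizable (R : realType) (V : lmodType R)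
    (br : V -> V -> V) (L : set V) (h : V) : Prop :=
  exists m (b : 'I_m -> V) (l : 'I_m -> R),
    is_basis L b /\ forall i, br h (b i) = l i *: b i.

Definition split_cartan_subalgebra (R : realType) (V : lmodType R)
    (br : V -> V -> V) (L C : set V) : Prop :=
  cartan_subalgebra br L C /\ forall h, C h -> ad_diagonalizable br L h.

(* An element of the dual of [C] is represented by any function on the ambient
   space that is linear on [C]; only its values on [C] are ever used. *)
Definition root_space (R : realType) (V : lmodType R) (br : V -> V -> V)
    (L C : set V) (a : V -> R) : set V :=
  [set x | L x /\ forall h, C h -> br h x = a h *: x].

Definition is_root (R : realType) (V : lmodType R) (br : V -> V -> V)
    (L C : set V) (a : V -> R) : Prop :=
  [/\ forall (t : R) g h, C g -> C h -> a (t *: g + h) = t * a g + a h,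
      exists2 h, C h & a h != 0 &
      exists2 x, root_space br L C a x & x != 0].

(* For [n] the dimension of [C], the second clause says that the [a i] form a
   basis of the dual of [C]. *)
Definition simple_roots (R : realType) (V : lmodType R) (br : V -> V -> V)
    (L C : set V) (n : nat) (a : 'I_n -> V -> R) : Prop :=
  [/\ forall i, is_root br L C (a i),
      forall c : 'I_n -> R,
        (forall h, C h -> \sum_(i < n) c i * a i h = 0) -> forall i, c i = 0 &
      forall b, is_root br L C b -> exists k : 'I_n -> nat,
        (forall h, C h -> b h = \sum_(i < n) (k i)%:R * a i h) \/
        (forall h, C h -> b h = - \sum_(i < n) (k i)%:R * a i h)].

Definition lie_isomorphic (R : realType) (V W : lmodType R)
    (brV : V -> V -> V) (brW : W -> W -> W) (A : set V) (B : set W) : Prop :=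
  exists f : V -> W,
    [/\ forall (t : R) x y, A x -> A y -> f (t *: x + y) = t *: f x + f y,
        forall x y, A x -> A y -> f (brV x y) = brW (f x) (f y) &
        set_bij A B f].

Definition mx_bracket (R : realType) (m : nat) (A B : 'M[R]_m) : 'M[R]_m :=
  A *m B - B *m A.

Definition sl (R : realType) (m : nat) : set 'M[R]_m := [set A | \tr A = 0].

Notation vfield R N := ('rV[R]_N -> 'rV[R]_N).

Fixpoint Ck_on (R : realType) (N M : nat) (k : nat) (U : set 'rV[R]_N)
    (f : 'rV[R]_N -> 'rV[R]_M) : Prop :=
  (forall p, U p -> {for p, continuous f}) /\
  if k is k'.+1 then
    forall j : 'I_N,
      (forall p, U p -> derivable f p (delta_mx 0 j)) /\
      Ck_on k' U (fun p => 'D_(delta_mx 0 j) f p)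
  else True.

Definition smooth_on (R : realType) (N M : nat) (U : set 'rV[R]_N)
    (f : 'rV[R]_N -> 'rV[R]_M) : Prop :=
  forall k, Ck_on k U f.

(* A vector field on the open set [U] is extended by 0 outside [U], so that
   equality of vector fields on [U] is equality of functions. *)
Definition vector_field_on (R : realType) (N : nat) (U : set 'rV[R]_N)
    (X : vfield R N) : Prop :=
  smooth_on U X /\ forall p, ~ U p -> X p = 0.

(* In coordinates, [X, Y] = \sum_j (X(Y_j) - Y(X_j)) d/dx_j.  Outside an open
   set where both fields are extended by 0, both directions vanish, hence so
   does the bracket. *)
Definition lie_bracket (R : realType) (N : nat) (X Y : vfield R N) :
    vfield R N :=
  fun p => 'D_(X p) Y p - 'D_(Y p) X p.

(* The dimension of the leaf through [p] of the foliation defined by the Lie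
   algebra [A]: the tangent space of that leaf at [p] consists of the values at
   [p] of the elements of [A]. It is the rank at [p] of the matrix of
   coefficients of a basis of [A]. *)
Definition has_leaf_dim (R : realType) (N : nat) (A : set (vfield R N))
    (p : 'rV[R]_N) (r : nat) : Prop :=
  has_dim [set X p | X in A] r.

Definition has_geometric_rank (R : realType) (N : nat)
    (A : set (vfield R N)) (r : nat) : Prop :=
  (exists p, has_leaf_dim A p r) /\
  (forall p s, has_leaf_dim A p s -> (s <= r)%N).

(* [phi] maps [U] diffeomorphically onto [U'] with inverse [psi]; the local
   coordinates on [U] are the components of [phi]. *)
Definition local_coordinates (R : realType) (N : nat) (U U' : set 'rV[R]_N)
    (phi psi : 'rV[R]_N -> 'rV[R]_N) : Prop :=
  [/\ open U /\ open U', smooth_on U phi, smooth_on U' psi,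
      forall p, U p -> U' (phi p) /\ psi (phi p) = p &
      forall y, U' y -> U (psi y) /\ phi (psi y) = y].

(* The push-forward of [X] along [phi], as a vector field on [U']. *)
Definition in_coordinates (R : realType) (N : nat) (U' : set 'rV[R]_N)
    (phi psi : 'rV[R]_N -> 'rV[R]_N) (X : vfield R N) : vfield R N :=
  fun y => if y \in U' then 'D_(X (psi y)) phi (psi y) else 0.

Definition coordinate_field (R : realType) (N : nat) (U' : set 'rV[R]_N)
    (j : 'I_N) : vfield R N :=
  fun y => if y \in U' then delta_mx 0 j else 0.

Definition indep_of_first (R : realType) (N : nat) (n : nat)
    (U' : set 'rV[R]_N) (X : vfield R N) : Prop :=
  forall y z, U' y -> U' z ->
    (forall j : 'I_N, (n <= j)%N -> y 0 j = z 0 j) -> X y = X z.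

(* Main.v *)
(* The basis of [C] dual to the simple roots consists of commuting vector fields. Where they are
   linearly independent, the flow of [sum_i t_i h_i] at time one yields coordinates in which
   [h_i = d/dx_i], and then [h_j, e_i] = delta_ij e_i says that [exp(-x_i) e_i] does not depend on
   [x_1, ..., x_n]. That they are independent somewhere rests on unique continuation: an element of
   [L] that vanishes on a ball is zero. Indeed such elements form an ideal, which if nonzero contains
   a nonzero perfect one, with a finite family [X_l = sum_ij c_lij [X_i, X_j]]; so
   [|X| <= K |DX| |X|], and [X] vanishes wherever [DX] is small, thus on an open and closed set.
   Near a point where the rank [r] of [C] is maximal every [h] in [C] is [sum_i f_i h_i] with [r]
   fixed elements [h_i]. As [C] is abelian, [h_j f_i = 0]. For an eigenvector [e] of weight [lam],
   [(sum_i f_i lam(h_i) - lam(h)) e = sum_i (e f_i) h_i]: where the coefficient of [e] is nonzero, [e]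
   is a combination of the [h_i], so [e f_i = 0] and [e = 0]. By unique continuation that coefficient
   vanishes at the point, for all [lam]; hence [h] is a constant combination of the [h_i], and [r = n].
   On the algebraic side, the Killing form of [L] is definite on [C] and nondegenerate, and
   sl(2)-theory shows that the root spaces of the simple roots are lines. *)

Require Import Defs.
From HB Require Import structures.
From mathcomp Require Import all_boot all_order all_algebra.
From mathcomp Require Import all_classical all_reals all_analysis.
From mathcomp Require Import ring lra.

Set Implicit Arguments.
Unset Strict Implicit.
Unset Printing Implicit Defensive.

Import Order.TTheory GRing.Theory Num.Theory.
Import numFieldNormedType.Exports.

Local Open Scope classical_set_scope.
Local Open Scope ring_scope.

(** * Directional derivatives and C^k functions *)

(** Flows rest on one estimate, the stability of Euler's scheme with dyadic mesh ([good_approx]): it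
    gives the time-one map, its smoothness (through the tangent field) and its derivative in the
    parameters. The flow of [sum_i t_i H_i] carries [t] as extra coordinates, so that
    differentiation in [t] is differentiation in the initial point. Applied to the rows of an
    inverse Jacobian, the same flow yields the inverse function theorem, which turns the flow of the
    Cartan fields into a chart. On the algebraic side everything stays real: [L] is transported to
    row vectors by a joint eigenbasis of [C], and [killing h h] is a sum of squares of weights.
    Positivity takes the place of Cartan's criterion: the radical of the Killing form misses [C], so
    a regular [h0] has no weight zero on it, and an Engel argument excludes a perfect ideal there.
    Unique continuation is needed once more at the end: the chart covers only [U], and the root
    vectors must not vanish on all of it if they are to generate a copy of sl(2). *)

Section directional.
Context {R : realType} {V W : normedModType R}.
Implicit Types (f : V -> W) (x v : V).

Lemma derivable_lineP f x v (s : R) :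
  derivable f (x + s *: v) v <-> derivable (fun t : R => f (x + t *: v)) s 1.
Proof.
rewrite /derivable.
have -> : (fun h : R => h^-1 *: ((f \o shift (x + s *: v)) (h *: v) - f (x + s *: v)))
  = (fun h : R => h^-1 *: (((fun t : R => f (x + t *: v)) \o shift s) (h *: (1 : R)) - f (x + s *: v))).
  apply/funext => h /=; congr (_ *: (f _ - _)).
  by rewrite [h *: 1]mulr1 scalerDl addrCA.
by [].
Qed.

Lemma derive_line f x v (s : R) :
  'D_1 (fun t : R => f (x + t *: v)) s = 'D_v f (x + s *: v).
Proof.
rewrite /derive.
have -> : (fun h : R => h^-1 *: ((f \o shift (x + s *: v)) (h *: v) - f (x + s *: v)))
  = (fun h : R => h^-1 *: (((fun t : R => f (x + t *: v)) \o shift s) (h *: (1 : R)) - f (x + s *: v))).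
  apply/funext => h /=; congr (_ *: (f _ - _)).
  by rewrite [h *: 1]mulr1 scalerDl addrCA.
by [].
Qed.

(** Only derivability along [v] is given, so the chain rule is applied on the line: [t => c * t]
    followed by the restriction of [f]. This also covers [c = 0]. *)
Lemma is_derive_scale f x v (c : R) : derivable f x v ->
  is_derive x (c *: v) f (c *: 'D_v f x).
Proof.
move=> fv.
have e w : x = x + (0 : R) *: w by rewrite scale0r addr0.
have fv0 : derivable (fun t : R => f (x + t *: v)) 0 1.
  by apply/derivable_lineP; rewrite -e.
pose g (t : R) := f (x + t *: v).
have gc : (fun t : R => f (x + t *: (c *: v))) = g \o (fun t => c * t).
  by apply/funext => t /=; rewrite /g scalerA mulrC.
have dg : differentiable g (c * 0) by rewrite mulr0; apply/derivable1_diffP.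
have dc : is_derive (0 : R) 1 (fun t : R => c * t) c.
  by apply: is_derive_eq; rewrite [_ *: _]mulr1.
have dc' : differentiable (fun t : R => c * t) 0.
  by apply/derivable1_diffP; exact: (@ex_derive _ _ _ _ _ _ _ dc).
have dgc := differentiable_comp dc' dg.
split.
  rewrite (e (c *: v)); apply/derivable_lineP; rewrite gc.
  exact/derivable1_diffP.
rewrite [X in 'D_(c *: v) f X](e (c *: v)) -derive_line gc deriveE // diff_comp //=.
rewrite -[('d (fun t => c * t) 0) 1]deriveE // derive_val.
rewrite -[c in 'd g _ c]mulr1 -[c * 1]/(c *: 1) linearZ /= -deriveE // mulr0.
by rewrite derive_line -e.
Qed.

End directional.

Lemma line_mvt (R : realType) (V : normedModType R) (f : V -> R) (x v : V) :
  (forall s : R, 0 <= s <= 1 -> derivable f (x + s *: v) v) ->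
  exists2 t : R, 0 <= t <= 1 & f (x + v) - f x = 'D_v f (x + t *: v).
Proof.
move=> df; pose g (t : R) := f (x + t *: v).
have dg (t : R) : 0 <= t <= 1 -> derivable g t 1.
  by move=> t01; apply/derivable_lineP/df.
have [||c c01 E] := @MVT R g (fun t => 'D_v f (x + t *: v)) 0 1 ltr01.
- move=> t; rewrite in_itv/= => /andP[t0 t1].
  split; first by apply: dg; rewrite !ltW.
  by rewrite derive_line.
- apply/continuous_in_subspaceT => t; rewrite inE/= in_itv/= => t01.
  exact/differentiable_continuous/derivable1_diffP/dg.
move: E; rewrite subr0 mulr1 /g scale1r scale0r addr0 => E.
exists c => //; move: c01; rewrite in_itv/= => /andP[c0 c1].
by rewrite !ltW.
Qed.

Lemma differentiable_littleo (R : realType) (V W : normedModType R)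
    (f : V -> W) (x : V) (df : {linear V -> W}) : continuous df ->
  (forall e : R, 0 < e ->
    \forall h \near (0 : V), `|f (x + h) - f x - df h| <= e * `|h|) ->
  differentiable f x /\ 'd f x = df :> (V -> W).
Proof.
move=> dfc H.
have flin : f \o shift x = cst (f x) + df +o_ 0 id.
  apply/eqaddoP => e e0; near=> h.
  have -> : (f \o shift x - (cst (f x) + df)) h = f (x + h) - f x - df h.
    by rewrite -[LHS]/(f (h + x) - (f x + df h)) opprD addrA [h + x]addrC.
  by near: h; exact: H.
have E : 'd f x = df :> (V -> W) by exact: diff_unique.
by split=> //; apply/diff_locallyP; rewrite E.
Unshelve. all: by end_near. Qed.

Lemma cvg_sumr (R : realType) (V : normedModType R) (T I : Type)
    (F : set_system T) (r : seq I) (f : I -> T -> V) (l : I -> V) : Filter F ->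
  (forall i, f i x @[x --> F] --> l i) ->
  \sum_(i <- r) f i x @[x --> F] --> \sum_(i <- r) l i.
Proof.
move=> FF fl; elim: r => [|i r IH].
  rewrite big_nil; under eq_fun do rewrite big_nil; exact: cvg_cst.
by rewrite big_cons; under eq_fun do rewrite big_cons; exact: cvgD.
Qed.

Section rV_norm.
Context {R : realType}.

Lemma coord_le_norm m n (x : 'M[R]_(m, n)) i j : `|x i j| <= `|x|.
Proof.
by rewrite [leRHS]/Num.Def.normr/= mx_normrE; exact: (le_bigmax _ _ (i, j)).
Qed.

Lemma mx_norm_le m n (x : 'M[R]_(m, n)) (c : R) :
  0 <= c -> (forall i j, `|x i j| <= c) -> `|x| <= c.
Proof.
move=> c0 h; rewrite [leLHS]/Num.Def.normr/= mx_normrE.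
by apply: bigmax_le => // -[i j] _; exact: h.
Qed.

Lemma rV_norm_le n (x : 'rV[R]_n) (c : R) :
  0 <= c -> (forall j, `|x 0 j| <= c) -> `|x| <= c.
Proof. by move=> c0 h; apply: mx_norm_le => // i j; rewrite ord1. Qed.

End rV_norm.

Section partial_differentiable.
Context {R : realType} (N : nat).
Implicit Types (f : 'rV[R]_N -> R) (p h v : 'rV[R]_N) (U : set 'rV[R]_N).

(** Corners of the path from [0] to [h] that runs parallel to the axes, one coordinate at a time. In
    the maximum norm this path stays within the norm of [h]. *)
Definition trunc k h : 'rV[R]_N := \row_j (if (j < k)%N then h 0 j else 0).

Lemma trunc0 h : trunc 0 h = 0.
Proof. by apply/rowP => j; rewrite !mxE. Qed.

Lemma truncN h : trunc N h = h.
Proof. by apply/rowP => j; rewrite !mxE ltn_ord. Qed.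

Lemma truncS (k : 'I_N) h : trunc k.+1 h = trunc k h + h 0 k *: delta_mx 0 k.
Proof.
apply/rowP => j; rewrite !mxE eqxx/= ltnS leq_eqVlt (inj_eq val_inj).
by case: eqVneq => [->|_] /=; rewrite ?ltnn ?mulr1 ?add0r // mulr0 addr0.
Qed.

Lemma norm_trunc_line (k : 'I_N) h (s : R) : 0 <= s <= 1 ->
  `|trunc k h + s *: (h 0 k *: delta_mx 0 k)| <= `|h|.
Proof.
move=> /andP[s0 s1]; apply: rV_norm_le => // j; rewrite !mxE eqxx/=.
case: (eqVneq j k) => [->|_].
  rewrite ltnn add0r mulr1 normrM (ger0_norm s0) (le_trans _ (coord_le_norm h 0 k)) //.
  by rewrite ler_piMl.
rewrite !mulr0 addr0; case: ifP => _; first exact: coord_le_norm.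
by rewrite normr0.
Qed.

(** On each edge of the path through the [trunc k h], the mean value theorem replaces an increment
    by a partial derivative at a nearby point. *)
Lemma partial_increment f p h (e : R) : 0 <= e ->
  (forall z, `|z| <= `|h| -> forall j, derivable f (p + z) (delta_mx 0 j)) ->
  (forall z, `|z| <= `|h| -> forall j,
    `|'D_(delta_mx 0 j) f (p + z) - 'D_(delta_mx 0 j) f p| <= e) ->
  `|f (p + h) - f p - \sum_j h 0 j * 'D_(delta_mx 0 j) f p| <= (N%:R * e) * `|h|.
Proof.
move=> e0 df De.
have -> : f (p + h) - f p = \sum_(j < N) (f (p + trunc j.+1 h) - f (p + trunc j h)).
  rewrite (eq_bigr (fun j : 'I_N => (fun k => f (p + trunc k.+1 h) - f (p + trunc k h)) j)) //.
  rewrite -(big_mkord xpredT (fun k => f (p + trunc k.+1 h) - f (p + trunc k h))).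
  by rewrite telescope_sumr // trunc0 addr0 truncN.
rewrite -sumrB (le_trans (ler_norm_sum _ _ _)) //.
rewrite -mulrA mulr_natl -[X in _ *+ X]card_ord -sumr_const; apply: ler_sum => j _.
rewrite truncS addrA.
have [s s01|t t01 ->] := @line_mvt R _ f (p + trunc j h) (h 0 j *: delta_mx 0 j).
  rewrite -addrA.
  have d := df _ (norm_trunc_line j h s01) j.
  exact: (@ex_derive _ _ _ _ _ _ _ (is_derive_scale (h 0 j) d)).
rewrite -addrA.
have nt := norm_trunc_line j h t01.
have [_ ->] := is_derive_scale (h 0 j) (df _ nt j).
rewrite -mulrBr normrM mulrC ler_pM //; last exact: coord_le_norm.
exact: De.
Qed.

Lemma partial_differentiable f p :
  (\forall z \near p, forall j, derivable f z (delta_mx 0 j)) ->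
  (forall j, {for p, continuous ('D_(delta_mx 0 j) f)}) ->
  differentiable f p /\
  forall v, 'D_v f p = \sum_j v 0 j * 'D_(delta_mx 0 j) f p.
Proof.
move=> df cf.
pose d (v : 'rV[R]_N) : R := \sum_j v 0 j * 'D_(delta_mx 0 j) f p.
have dlin : linear d.
  move=> a u v; rewrite /d scaler_sumr -big_split; apply: eq_bigr => j _ /=.
  by rewrite !mxE mulrDl -mulrA.
pose dL : {linear 'rV[R]_N -> R} := HB.pack d (GRing.isLinear.Build _ _ _ _ d dlin).
have dcont : continuous dL.
  move=> v; rewrite /continuous_at /= /d; apply: (@cvg_sumr R _ _ _ (nbhs v)) => j.
  apply: cvgM; last exact: cvg_cst.
  exact: coord_continuous.
have [fd E] : differentiable f p /\ 'd f p = dL :> ('rV[R]_N -> R).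
  apply: differentiable_littleo => // e e0.
  (* The increment estimate costs a factor [N]; the [+ 1] keeps the denominator positive when
     [N = 0]. *)
  have e1 : 0 < e / (N%:R + 1) by rewrite divr_gt0 // ltr_wpDl.
  have : \forall z \near p, forall j, derivable f z (delta_mx 0 j) /\
     `|'D_(delta_mx 0 j) f p - 'D_(delta_mx 0 j) f z| <= e / (N%:R + 1).
    near=> z; move=> j; split; first by move: j; near: z.
    move: j; near: z; apply: filter_forall => j.
    by have /cvgrPdist_le := cf j; apply.
  move=> /nbhs_ballP[r r0 hr].
  apply/nbhs_norm0P; exists r => // h /= hltr.
  have hr' z : `|z| <= `|h| -> ball p r (p + z).
    move=> zh; rewrite -ball_normE /= opprD addrA subrr add0r normrN.
    exact: le_lt_trans zh hltr.
  have := @partial_increment f p h (e / (N%:R + 1)).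
  move=> /(_ (ltW e1)) H.
  apply: le_trans (H _ _) _.
  - by move=> z zh j; have [] := hr _ (hr' _ zh) j.
  - by move=> z zh j; rewrite distrC; have [] := hr _ (hr' _ zh) j.
  - rewrite ler_wpM2r // mulrCA ler_piMr ?(ltW e0) // ler_pdivrMr ?ltr_wpDl //.
    by rewrite mul1r lerDl.
split=> // v; by rewrite deriveE // E.
Unshelve. all: by end_near. Qed.

End partial_differentiable.

Definition pd (R : realType) N (j : 'I_N) (f : 'rV[R]_N -> R) : 'rV[R]_N -> R :=
  'D_(delta_mx 0 j) f.

(** Scalar counterpart of [Ck_on], for which products and quotients make sense. Vector-valued maps
    are treated coordinate by coordinate through [Cv], and [Ck_onP] is the bridge. *)
Fixpoint Ck (R : realType) N (k : nat) (U : set 'rV[R]_N) (f : 'rV[R]_N -> R) :=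
  (forall p, U p -> {for p, continuous f}) /\
  if k is k'.+1 then
    forall j, (forall p, U p -> derivable f p (delta_mx 0 j)) /\ Ck k' U (pd j f)
  else True.

Section Ck_theory.
Context {R : realType}.
Implicit Types (N M k : nat).

Lemma Ck_continuous N k (U : set 'rV[R]_N) f p :
  Ck k U f -> U p -> {for p, continuous f}.
Proof. by case: k => [|k] [h _]; exact: h. Qed.

Lemma Ck_pd N k (U : set 'rV[R]_N) f j : Ck k.+1 U f -> Ck k U (pd j f).
Proof. by move=> [_ /(_ j)[]]. Qed.

Lemma Ck_derivable N k (U : set 'rV[R]_N) f j p :
  Ck k.+1 U f -> U p -> derivable f p (delta_mx 0 j).
Proof. by move=> [_ /(_ j)[h _]]; exact: h. Qed.

Lemma CkW N k (U : set 'rV[R]_N) f : Ck k.+1 U f -> Ck k U f.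
Proof.
elim: k f => [|k IH] f [cf df]; first by split.
by split=> // j; have [dj Cj] := df j; split=> //; exact: IH.
Qed.

Lemma Ck_sub N k (U V : set 'rV[R]_N) f : V `<=` U -> Ck k U f -> Ck k V f.
Proof.
move=> VU; elim: k f => [|k IH] f [cf df]; split=> //; try by move=> p /VU /cf.
move=> j; have [dj Cj] := df j; split; last exact: IH.
by move=> p /VU /dj.
Qed.

Lemma near_eq_in_open N (U : set 'rV[R]_N) (f g : 'rV[R]_N -> R) p :
  open U -> U p -> (forall q, U q -> f q = g q) -> {near p, f =1 g}.
Proof. by move=> Uo Up fg; exact: (filterS fg (open_nbhs_nbhs (conj Uo Up))). Qed.

Lemma pd_eq N (U : set 'rV[R]_N) (f g : 'rV[R]_N -> R) j p :
  open U -> U p -> (forall q, U q -> f q = g q) -> pd j f p = pd j g p.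
Proof. by move=> Uo Up fg; exact: near_eq_derive (near_eq_in_open Uo Up fg). Qed.

(** Openness makes the values on [U] determine the derivatives there. Thus each closure property can
    be proved on a formula for the partial derivatives that holds only on [U]. *)
Lemma Ck_eq N k (U : set 'rV[R]_N) f g : open U ->
  (forall p, U p -> f p = g p) -> Ck k U f -> Ck k U g.
Proof.
move=> Uo; elim: k f g => [|k IH] f g fg [cf df]; split=> //.
- move=> p Up; have fgp := near_eq_in_open Uo Up fg.
  rewrite /prop_for /continuous_at -(fg _ Up).
  exact: cvg_trans (near_eq_cvg fgp) (cf p Up).
- move=> p Up; have fgp := near_eq_in_open Uo Up fg.
  rewrite /prop_for /continuous_at -(fg _ Up).
  exact: cvg_trans (near_eq_cvg fgp) (cf p Up).
- move=> j; have [dj Cj] := df j; split.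
    by move=> p Up; exact: near_eq_derivable (near_eq_in_open Uo Up fg) (dj p Up).
  by apply: IH Cj => p Up; exact: pd_eq fg.
Qed.

Lemma Ck_near_derivable N k (U : set 'rV[R]_N) f p : open U -> Ck k.+1 U f ->
  U p -> \forall z \near p, forall j, derivable f z (delta_mx 0 j).
Proof.
move=> Uo Cf Up; apply: filterS (open_nbhs_nbhs (conj Uo Up)) => q Uq j.
exact: Ck_derivable Cf Uq.
Qed.

Lemma Ck_differentiable N k (U : set 'rV[R]_N) f p :
  open U -> Ck k.+1 U f -> U p -> differentiable f p.
Proof.
move=> Uo Cf Up; apply: (proj1 (partial_differentiable _ _)).
  exact: Ck_near_derivable Cf Up.
by move=> j; apply: Ck_continuous (Ck_pd j Cf) Up.
Qed.

Lemma Ck_deriveE N k (U : set 'rV[R]_N) f p v :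
  open U -> Ck k.+1 U f -> U p -> 'D_v f p = \sum_j v 0 j * pd j f p.
Proof.
move=> Uo Cf Up; apply: (proj2 (partial_differentiable _ _)).
  exact: Ck_near_derivable Cf Up.
by move=> j; apply: Ck_continuous (Ck_pd j Cf) Up.
Qed.

Lemma CkS N k (U : set 'rV[R]_N) f :
  (forall p, U p -> differentiable f p) -> (forall j, Ck k U (pd j f)) ->
  Ck k.+1 U f.
Proof.
move=> df dj; split; first by move=> p /df /differentiable_continuous.
by move=> j; split=> // p /df; exact: diff_derivable.
Qed.

Lemma pd_cst N (c : R) j (p : 'rV[R]_N) : pd j (fun _ => c) p = 0.
Proof. exact: derive_cst. Qed.

Lemma Ck_cst N k (U : set 'rV[R]_N) (c : R) : Ck k U (fun _ => c).
Proof.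
elim: k c => [|k IH] c; first by split=> // p _; exact: cst_continuous.
apply: CkS => [p _|j]; first exact: differentiable_cst.
by rewrite (_ : pd j _ = fun _ => 0) //; apply/funext => p; exact: pd_cst.
Qed.

Lemma pd_coord N (i j : 'I_N) (p : 'rV[R]_N) :
  pd j (fun q : 'rV[R]_N => q 0 i) p = (j == i)%:R.
Proof.
pose c (q : 'rV[R]_N) : R := q 0 i.
have clin : linear c by move=> a u v; rewrite /c !mxE.
pose cL : {linear 'rV[R]_N -> R} := HB.pack c (GRing.isLinear.Build _ _ _ _ c clin).
rewrite /pd deriveE; last exact: differentiable_coord.
rewrite -[fun q => _]/(cL : _ -> _) diff_lin; last exact: coord_continuous.
by rewrite /= /c mxE eqxx eq_sym.
Qed.

Lemma Ck_coord N k (U : set 'rV[R]_N) (i : 'I_N) : Ck k U (fun q => q 0 i).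
Proof.
case: k => [|k]; first by split=> // p _; exact: coord_continuous.
apply: CkS => [p _|j]; first exact: differentiable_coord.
rewrite (_ : pd j _ = fun _ => (j == i)%:R); first exact: Ck_cst.
by apply/funext => p; exact: pd_coord.
Qed.

Section closure.
Context N (U : set 'rV[R]_N) (Uo : open U).
Implicit Types (f g : 'rV[R]_N -> R).

Lemma pdD f g j p : differentiable f p -> differentiable g p ->
  pd j (fun q => f q + g q) p = pd j f p + pd j g p.
Proof. by move=> df dg; rewrite /pd -deriveD //; exact: diff_derivable. Qed.

Lemma pdN f j p : differentiable f p -> pd j (fun q => - f q) p = - pd j f p.
Proof. by move=> df; rewrite /pd -deriveN //; exact: diff_derivable. Qed.

Lemma pdM f g j p : differentiable f p -> differentiable g p ->
  pd j (fun q => f q * g q) p = pd j f p * g p + f p * pd j g p.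
Proof.
move=> df dg; rewrite /pd -[fun q => _]/(f * g) deriveM; try exact: diff_derivable.
by rewrite addrC [g p *: _]mulrC.
Qed.

Lemma CkD k f g : Ck k U f -> Ck k U g -> Ck k U (fun q => f q + g q).
Proof.
elim: k f g => [|k IH] f g Cf Cg.
  split=> // p Up; exact: (continuousD (Ck_continuous Cf Up) (Ck_continuous Cg Up)).
have df p : U p -> differentiable f p by move=> Up; exact: (Ck_differentiable Uo Cf Up).
have dg p : U p -> differentiable g p by move=> Up; exact: (Ck_differentiable Uo Cg Up).
apply: CkS => [p Up|j]; first by apply: differentiableD; [exact: df|exact: dg].
apply: (@Ck_eq _ _ _ (fun p => pd j f p + pd j g p)) => // [p Up|].
  by rewrite pdD //; [exact: df|exact: dg].
by apply: IH; exact: Ck_pd.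
Qed.

Lemma CkM k f g : Ck k U f -> Ck k U g -> Ck k U (fun q => f q * g q).
Proof.
elim: k f g => [|k IH] f g Cf Cg.
  split=> // p Up; exact: (continuousM (Ck_continuous Cf Up) (Ck_continuous Cg Up)).
have df p : U p -> differentiable f p by move=> Up; exact: (Ck_differentiable Uo Cf Up).
have dg p : U p -> differentiable g p by move=> Up; exact: (Ck_differentiable Uo Cg Up).
apply: CkS => [p Up|j]; first by apply: differentiableM; [exact: df|exact: dg].
apply: (@Ck_eq _ _ _ (fun p => pd j f p * g p + f p * pd j g p)) => // [p Up|].
  by rewrite pdM //; [exact: df|exact: dg].
apply: CkD; apply: IH; try exact: Ck_pd; exact: CkW.
Qed.

Lemma CkN k f : Ck k U f -> Ck k U (fun q => - f q).
Proof.
move=> Cf; apply: (@Ck_eq _ _ _ (fun q => (-1) * f q)) => // [p _|].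
  by rewrite mulN1r.
by apply: CkM => //; exact: Ck_cst.
Qed.

Lemma CkB k f g : Ck k U f -> Ck k U g -> Ck k U (fun q => f q - g q).
Proof. by move=> Cf Cg; apply: CkD => //; exact: CkN. Qed.

Lemma Ck_sum k (I : Type) (r : seq I) (P : pred I) (f : I -> 'rV[R]_N -> R) :
  (forall i, Ck k U (f i)) -> Ck k U (fun q => \sum_(i <- r | P i) f i q).
Proof.
move=> Cf; elim: r => [|i r IH].
  by apply: (@Ck_eq _ _ _ (fun=> 0)) => // [p _|]; rewrite ?big_nil //; exact: Ck_cst.
case Pi: (P i).
  apply: (@Ck_eq _ _ _ (fun q => f i q + \sum_(i <- r | P i) f i q)) => // [p _|].
    by rewrite big_cons Pi.
  exact: CkD.
by apply: (@Ck_eq _ _ _ (fun q => \sum_(i <- r | P i) f i q)) => // p _; rewrite big_cons Pi.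
Qed.

Lemma Ck_prod k (I : Type) (r : seq I) (P : pred I) (f : I -> 'rV[R]_N -> R) :
  (forall i, Ck k U (f i)) -> Ck k U (fun q => \prod_(i <- r | P i) f i q).
Proof.
move=> Cf; elim: r => [|i r IH].
  by apply: (@Ck_eq _ _ _ (fun=> 1)) => // [p _|]; rewrite ?big_nil //; exact: Ck_cst.
case Pi: (P i).
  apply: (@Ck_eq _ _ _ (fun q => f i q * \prod_(i <- r | P i) f i q)) => // [p _|].
    by rewrite big_cons Pi.
  exact: CkM.
by apply: (@Ck_eq _ _ _ (fun q => \prod_(i <- r | P i) f i q)) => // p _; rewrite big_cons Pi.
Qed.

Lemma CkV k f : (forall p, U p -> f p != 0) -> Ck k U f ->
  Ck k U (fun q => (f q)^-1).
Proof.
move=> f0; elim: k => [|k IH] Cf.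
  split=> // p Up; exact: (continuousV (f0 _ Up) (Ck_continuous Cf Up)).
have df p : U p -> differentiable f p by move=> Up; exact: (Ck_differentiable Uo Cf Up).
apply: CkS => [p Up|j]; first by apply: differentiableV; [exact: df|exact: f0].
apply: (@Ck_eq _ _ _ (fun p => - (pd j f p * ((f p)^-1 * (f p)^-1)))) => // [p Up|].
  rewrite /pd deriveV; [|exact: f0|by apply: diff_derivable; exact: df].
  by rewrite expr2 invfM scaleNr [_ *: _]mulrC.
have CV := IH (CkW Cf).
by apply: CkN; apply: CkM; [exact: Ck_pd|exact: CkM].
Qed.

End closure.

Lemma differentiable_row N M (F : 'rV[R]_N -> 'rV[R]_M) p :
  (forall i, differentiable (fun q => F q 0 i) p) -> differentiable F p.
Proof.
move=> dF.
have -> : F = \sum_i (fun q => F q 0 i *: (delta_mx 0 i : 'rV[R]_M)).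
  apply/funext => q; rewrite fct_sumE; exact: row_sum_delta.
by apply: differentiable_sum => i; apply: differentiableZl; exact: dF.
Qed.

Lemma derive_row N M (F : 'rV[R]_N -> 'rV[R]_M) p v : differentiable F p ->
  'D_v F p = \row_i 'D_v (fun q => F q 0 i) p.
Proof.
move=> dF; rewrite derive_mx; last exact: diff_derivable.
by apply/matrixP => i j; rewrite !mxE ord1.
Qed.

Lemma derive_comp N M (W : normedModType R) (F : 'rV[R]_N -> 'rV[R]_M) (g : 'rV[R]_M -> W) p v :
  differentiable F p -> differentiable g (F p) ->
  'D_v (g \o F) p = 'D_('D_v F p) g (F p).
Proof.
move=> dF dg; rewrite deriveE; last exact: differentiable_comp.
by rewrite diff_comp //= [RHS]deriveE // [X in _ = 'd g _ X]deriveE.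
Qed.

Lemma pd_comp N M k (V : set 'rV[R]_M) (F : 'rV[R]_N -> 'rV[R]_M) g j p :
  open V -> V (F p) -> Ck k.+1 V g ->
  (forall i, differentiable (fun q => F q 0 i) p) ->
  pd j (fun q => g (F q)) p = \sum_i pd j (fun q => F q 0 i) p * pd i g (F p).
Proof.
move=> Vo VF Cg dF; have dF' := differentiable_row dF.
rewrite /pd -[fun q => _]/(g \o F) derive_comp //; last exact: (Ck_differentiable Vo Cg VF).
rewrite (Ck_deriveE _ Vo Cg VF); apply: eq_bigr => i _.
by rewrite derive_row // mxE.
Qed.

(** The induction generalises over [g], because the chain rule brings in the partial derivatives of
    [g] composed with the same [F]. *)
Lemma Ck_comp N M k (U : set 'rV[R]_N) (V : set 'rV[R]_M)
    (F : 'rV[R]_N -> 'rV[R]_M) g : open U -> open V ->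
  (forall p, U p -> V (F p)) -> (forall i, Ck k U (fun q => F q 0 i)) ->
  Ck k V g -> Ck k U (fun q => g (F q)).
Proof.
move=> Uo Vo FV; elim: k g => [|k IH] g CF Cg.
  split=> // p Up; apply: (@continuous_comp _ _ _ F g); last first.
    exact: (Ck_continuous Cg (FV _ Up)).
  have -> : F = (fun q => \sum_i (F q 0 i *: (delta_mx 0 i : 'rV[R]_M))).
    apply/funext => q; exact: row_sum_delta.
  apply: (@cvg_sumr R _ _ _ (nbhs p)) => i.
  by apply: cvgZr_tmp; exact: (Ck_continuous (CF i) Up).
have dF p : U p -> forall i, differentiable (fun q => F q 0 i) p.
  by move=> Up i; exact: (Ck_differentiable Uo (CF i) Up).
apply: CkS => [p Up|j].
  apply: (@differentiable_comp _ _ _ _ F g); first exact/differentiable_row/dF.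
  exact: (Ck_differentiable Vo Cg (FV _ Up)).
apply: (@Ck_eq _ _ _ (fun p => \sum_i pd j (fun q => F q 0 i) p * pd i g (F p))) => //.
  by move=> p Up; rewrite (pd_comp _ Vo (FV _ Up) Cg) //; exact: dF.
apply: Ck_sum => // i; apply: CkM => //; first exact: (@Ck_pd _ _ _ (fun q => F q 0 i)).
by apply: IH; [move=> i'; exact: CkW|exact: Ck_pd].
Qed.

Lemma differentiable_expR (x : R) : differentiable expR x.
Proof. by apply/derivable1_diffP; exact: derivable_expR. Qed.

Lemma pd_expR N f j (p : 'rV[R]_N) : differentiable f p ->
  pd j (fun q => expR (f q)) p = pd j f p * expR (f p).
Proof.
move=> dfp; have de := differentiable_expR (f p).
rewrite /pd -[fun q => _]/(expR \o f) [LHS]deriveE; last exact: differentiable_comp.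
rewrite diff_comp //= -[X in 'd expR _ X](deriveE _ dfp).
rewrite -['D_ _ f p in LHS]mulr1 -[_ * 1]/(_ *: (1 : R)) linearZ /= -deriveE //.
by rewrite derive_val.
Qed.

Lemma Ck_expR N k (U : set 'rV[R]_N) f : open U -> Ck k U f ->
  Ck k U (fun q => expR (f q)).
Proof.
move=> Uo; elim: k => [|k IH] Cf.
  split=> // p Up; apply: (@continuous_comp _ _ _ f expR); last exact: continuous_expR.
  exact: (Ck_continuous Cf Up).
have df p : U p -> differentiable f p by move=> Up; exact: (Ck_differentiable Uo Cf Up).
apply: CkS => [p Up|j].
  by apply: (@differentiable_comp _ _ _ _ f expR); [exact: df|exact: differentiable_expR].
apply: (@Ck_eq _ _ _ (fun p => pd j f p * expR (f p))) => // [p Up|].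
  by rewrite pd_expR //; exact: df.
by apply: CkM => //; [exact: Ck_pd|exact/IH/CkW].
Qed.

End Ck_theory.

Definition Cv (R : realType) N M (k : nat) (U : set 'rV[R]_N)
    (F : 'rV[R]_N -> 'rV[R]_M) :=
  forall i, Ck k U (fun q => F q 0 i).

Section vector_valued.
Context {R : realType}.

Lemma continuous_rowP N M (F : 'rV[R]_N -> 'rV[R]_M) p :
  {for p, continuous F} <-> forall i, {for p, continuous (fun q => F q 0 i)}.
Proof.
split=> [cF i|cF].
  apply: (@continuous_comp _ _ _ F (fun x : 'rV[R]_M => x 0 i)) => //.
  exact: coord_continuous.
have -> : F = (fun q => \sum_i (F q 0 i *: (delta_mx 0 i : 'rV[R]_M))).
  apply/funext => q; exact: row_sum_delta.
apply: (@cvg_sumr R _ _ _ (nbhs p)) => i.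
by apply: cvgZr_tmp; exact: cF.
Qed.

Lemma derivable_rowP N M (F : 'rV[R]_N -> 'rV[R]_M) p v :
  derivable F p v <-> forall i, derivable (fun q => F q 0 i) p v.
Proof.
rewrite derivable_mxP; split=> [h i|h i j]; first exact: h.
by rewrite [i]ord1.
Qed.

Lemma Ck_onP N M k (U : set 'rV[R]_N) (F : 'rV[R]_N -> 'rV[R]_M) : open U ->
  Ck_on k U F <-> Cv k U F.
Proof.
move=> Uo; elim: k F => [|k IH] F.
  split=> [[cF _] i|CF].
    by split=> // p Up; exact: (proj1 (continuous_rowP _ _) (cF p Up)).
  split=> // p Up; apply/continuous_rowP => i.
  exact: (Ck_continuous (CF i) Up).
have pdE (dF : forall j p, U p -> derivable F p (delta_mx 0 j)) j i p :
    U p -> ('D_(delta_mx 0 j) F p) 0 i = pd j (fun q => F q 0 i) p.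
  by move=> Up; rewrite derive_mx ?mxE //; exact: dF.
split=> [[cF dF] i|CF].
  have dF' j p : U p -> derivable F p (delta_mx 0 j).
    by have [h _] := dF j; exact: h.
  split=> [p Up|j]; first exact: (proj1 (continuous_rowP _ _) (cF p Up)).
  have [dj Cj] := dF j; split=> [p Up|].
    exact: (proj1 (derivable_rowP _ _ _) (dj p Up)).
  move/IH: Cj => /(_ i); apply: Ck_eq => // p Up; exact: pdE.
have dF j p : U p -> derivable F p (delta_mx 0 j).
  move=> Up; apply/derivable_rowP => i; exact: (Ck_derivable (CF i) Up).
split=> [p Up|j].
  by apply/continuous_rowP => i; exact: (Ck_continuous (CF i) Up).
split=> [p Up|]; first exact: dF.
apply/IH => i; apply: Ck_eq (Ck_pd j (CF i)) => // p Up.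
by rewrite pdE.
Qed.

Lemma Cv_differentiable N M k (U : set 'rV[R]_N) (F : 'rV[R]_N -> 'rV[R]_M) p :
  open U -> Cv k.+1 U F -> U p -> differentiable F p.
Proof.
move=> Uo CF Up; apply: differentiable_row => i.
exact: (Ck_differentiable Uo (CF i) Up).
Qed.

Lemma Cv_comp N M K k (U : set 'rV[R]_N) (V : set 'rV[R]_M)
    (F : 'rV[R]_N -> 'rV[R]_M) (G : 'rV[R]_M -> 'rV[R]_K) : open U -> open V ->
  (forall p, U p -> V (F p)) -> Cv k U F -> Cv k V G ->
  Cv k U (fun q => G (F q)).
Proof.
by move=> Uo Vo FV CF CG i; apply: (Ck_comp (V := V) (g := fun q => G q 0 i)).
Qed.

End vector_valued.

(** * Symmetry of mixed partial derivatives *)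

Section schwarz.
Context {R : realType} (N : nat).
Implicit Types (f : 'rV[R]_N -> R) (p a v : 'rV[R]_N) (U : set 'rV[R]_N).

Lemma derive_translate f a x v :
  'D_v (fun y => f (y + a)) x = 'D_v f (x + a).
Proof.
rewrite /derive.
have -> : (fun h : R => h^-1 *: ((f \o shift (x + a)) (h *: v) - f (x + a)))
  = (fun h : R => h^-1 *: (((fun y => f (y + a)) \o shift x) (h *: v) - f (x + a))).
  by apply/funext => h /=; rewrite addrA.
by [].
Qed.

Lemma derivable_translate f a x v :
  derivable f (x + a) v -> derivable (fun y => f (y + a)) x v.
Proof.
rewrite /derivable.
have -> : (fun h : R => h^-1 *: ((f \o shift (x + a)) (h *: v) - f (x + a)))
  = (fun h : R => h^-1 *: (((fun y => f (y + a)) \o shift x) (h *: v) - f (x + a))).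
  by apply/funext => h /=; rewrite addrA.
by [].
Qed.

Lemma pd_increment U f x (j : 'I_N) (s : R) :
  (forall t, 0 <= t <= s -> U (x + t *: delta_mx 0 j)) -> 0 <= s ->
  (forall y, U y -> derivable f y (delta_mx 0 j)) ->
  exists2 t, 0 <= t <= s &
    f (x + s *: delta_mx 0 j) - f x = s * pd j f (x + t *: delta_mx 0 j).
Proof.
move=> Ux s0 df.
have Us t : 0 <= t <= 1 -> U (x + t *: (s *: delta_mx 0 j)).
  move=> /andP[t0 t1]; rewrite scalerA; apply: Ux.
  by rewrite mulr_ge0 //= ler_piMl.
have [t t01|t t01 E] := @line_mvt R _ f x (s *: delta_mx 0 j).
  exact: (@ex_derive _ _ _ _ _ _ _ (is_derive_scale s (df _ (Us _ t01)))).
have [_ E2] := is_derive_scale s (df _ (Us _ t01)).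
exists (t * s); last by rewrite E E2 scalerA.
by move: t01 => /andP[t0 t1]; rewrite mulr_ge0 //= ler_piMl.
Qed.

(** Two mean value theorems: one along [i] for the difference [g] of [f] in direction [j], then one
    along [j] for [pd i f]. The point found depends on the order of [i] and [j], but stays within
    [s + s] of [p]. *)
Lemma second_difference U f p r (i j : 'I_N) (s : R) :
  open U -> ball p r `<=` U -> Ck 2 U f -> 0 <= s -> s + s < r ->
  exists2 z, `|z - p| <= s + s &
    f (p + s *: delta_mx 0 i + s *: delta_mx 0 j) - f (p + s *: delta_mx 0 i)
    - (f (p + s *: delta_mx 0 j) - f p) = s * (s * pd j (pd i f) z).
Proof.
move=> Uo BU Cf s0 sr.
have nd (t : R) (k : 'I_N) : 0 <= t <= s -> `|t *: (delta_mx 0 k : 'rV[R]_N)| <= s.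
  move=> /andP[t0 ts]; apply: rV_norm_le => // l; rewrite !mxE eqxx /=.
  by case: eqP; rewrite ?mulr1 ?mulr0 ?normr0 // ger0_norm.
have inU t t' (k l : 'I_N) : 0 <= t <= s -> 0 <= t' <= s ->
    `|p + t *: delta_mx 0 k + t' *: delta_mx 0 l - p| <= s + s.
  move=> h1 h2; rewrite -[p + _ + _]addrA [p + (_ + _)]addrC addrK.
  by apply: le_trans (ler_normD _ _) _; apply: lerD; exact: nd.
have inU' t t' (k l : 'I_N) : 0 <= t <= s -> 0 <= t' <= s ->
    U (p + t *: delta_mx 0 k + t' *: delta_mx 0 l).
  move=> h1 h2; apply: BU; rewrite -ball_normE /= distrC.
  exact: le_lt_trans (inU _ _ _ _ h1 h2) sr.
have z01 : (0 : R) <= 0 <= s by apply/andP; split.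
have s01 : 0 <= s <= s by apply/andP; split.
have inU1 t (k : 'I_N) : 0 <= t <= s -> U (p + t *: delta_mx 0 k).
  by move=> h; have := inU' t 0 k k h z01; rewrite scale0r addr0.
pose g y := f (y + s *: delta_mx 0 j) - f y.
have dg t : 0 <= t <= s ->
   is_derive (p + t *: delta_mx 0 i) (delta_mx 0 i) g
    (pd i f (p + t *: delta_mx 0 i + s *: delta_mx 0 j) - pd i f (p + t *: delta_mx 0 i)).
  move=> h.
  have d1 := Ck_derivable (j := i) Cf (inU' _ _ i j h s01).
  have d2 := Ck_derivable (j := i) Cf (inU1 _ i h).
  have d1' := derivable_translate d1.
  split; first exact: derivableB.
  by rewrite /g (deriveB d1' d2) derive_translate.
pose V := [set p + t *: (delta_mx 0 i : 'rV[R]_N) | t in [set t | 0 <= t <= s]].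
have [t ht|_ [t ht <-]|t ht E] := @pd_increment V g p i s _ s0; first by exists t.
  exact: (@ex_derive _ _ _ _ _ _ _ (dg _ ht)).
have [_ E2] := dg _ ht.
rewrite /g /pd E2 in E.
have [t' ht'|y Uy|t' ht' E3] := @pd_increment U (pd i f) (p + t *: delta_mx 0 i) j s _ s0.
- exact: inU'.
- exact: (Ck_derivable (j := j) (Ck_pd i Cf) Uy).
by exists (p + t *: delta_mx 0 i + t' *: delta_mx 0 j); [exact: inU|rewrite E -E3].
Qed.

Lemma square_sum_sym (u u' v w t x y : R) :
  u - v - (w - t) = x -> u' - w - (v - t) = y -> u = u' -> x = y.
Proof. by move=> <- <- ->; ring. Qed.

(** The second difference is symmetric in [i] and [j], so one mixed derivative at [z] equals the
    other at [z'], with both points as close to [p] as desired; continuity does the rest. *)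
Lemma pdC U f i j p : open U -> Ck 2 U f -> U p ->
  pd i (pd j f) p = pd j (pd i f) p.
Proof.
move=> Uo Cf Up.
have [r r0 BU] : exists2 r : R, 0 < r & ball p r `<=` U.
  by have /nbhs_ballP[r r0 h] := open_nbhs_nbhs (conj Uo Up); exists r.
apply/eqP; rewrite -subr_eq0 -normr_le0; apply/ler_addgt0Pr => e e0; rewrite add0r.
have e2 : 0 < e / 2 by rewrite divr_gt0.
have c1 : {for p, continuous (pd i (pd j f))}.
  exact: (Ck_continuous (Ck_pd i (Ck_pd j Cf)) Up).
have c2 : {for p, continuous (pd j (pd i f))}.
  exact: (Ck_continuous (Ck_pd j (Ck_pd i Cf)) Up).
have /cvgrPdist_le/(_ _ e2)/nbhs_ballP[r1 r10 h1] := c1.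
have /cvgrPdist_le/(_ _ e2)/nbhs_ballP[r2 r20 h2] := c2.
pose m := Num.min r (Num.min r1 r2).
have m0 : 0 < m by rewrite !lt_min r0 r10 r20.
have [s s0 ssm] : exists2 s : R, 0 < s & s + s < m.
  exists (m / 2 / 2); first by rewrite !divr_gt0.
  by rewrite -splitr ltr_pdivrMr // ltr_pMr // ltr1n.
have [smr smr1 smr2] : [/\ s + s < r, s + s < r1 & s + s < r2].
  by split; apply: (lt_le_trans ssm); rewrite !ge_min lexx ?orbT.
have [z zp E] := @second_difference U f p r i j s Uo BU Cf (ltW s0) smr.
have [z' zp' E'] := @second_difference U f p r j i s Uo BU Cf (ltW s0) smr.
have EE : pd j (pd i f) z = pd i (pd j f) z'.
  have ns : s != 0 by rewrite gt_eqF.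
  have := square_sum_sym E E'; rewrite addrAC => /(_ erefl).
  by move=> /(mulfI ns)/(mulfI ns).
have b1 : ball p r1 z' by rewrite -ball_normE /= distrC (le_lt_trans zp').
have b2 : ball p r2 z by rewrite -ball_normE /= distrC (le_lt_trans zp).
have {}h1 : `|pd i (pd j f) p - pd i (pd j f) z'| <= e / 2 := h1 _ b1.
have {}h2 : `|pd j (pd i f) p - pd j (pd i f) z| <= e / 2 := h2 _ b2.
rewrite EE distrC in h2.
move: h1 h2; move: (pd i _ p) (pd j _ p) (pd i _ z') => x y w h1 h2.
rewrite (splitr e); apply: le_trans (ler_distD w _ _) _.
exact: lerD.
Qed.

End schwarz.

(** Half-widths vary with the coordinate because, for a tangent field, the base point and the
    tangent vector need different bounds. Boxes are compact and convex. *)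
Definition box (R : realType) N (c r : 'rV[R]_N) : set 'rV[R]_N :=
  [set x | forall i, `|x 0 i - c 0 i| <= r 0 i].

Section boxes.
Context {R : realType}.

Lemma box_segment N (c r x v : 'rV[R]_N) (t : R) : 0 <= t <= 1 ->
  box c r x -> box c r (x + v) -> box c r (x + t *: v).
Proof.
move=> /andP[t0 t1] bx bv i; rewrite !mxE.
have -> : x 0 i + t * v 0 i - c 0 i =
   (1 - t) * (x 0 i - c 0 i) + t * ((x + v) 0 i - c 0 i) by rewrite !mxE; ring.
have -> : r 0 i = (1 - t) * r 0 i + t * r 0 i by ring.
apply: le_trans (ler_normD _ _) _.
rewrite !normrM (ger0_norm t0) ger0_norm ?subr_ge0 //.
by apply: lerD; apply: ler_wpM2l; rewrite ?subr_ge0.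
Qed.

Lemma box_compact N (c r : 'rV[R]_N) : compact (box c r).
Proof.
have -> : box c r = [set x | forall i, `[c 0 i - r 0 i, c 0 i + r 0 i]%classic (x 0 i)].
  by apply/seteqP; split=> x bx i; have := bx i; rewrite /= in_itv /= ler_distl.
by apply: (@rV_compact R N (fun i => `[c 0 i - r 0 i, c 0 i + r 0 i]%classic)) => i; exact: segment_compact.
Qed.

Lemma box_bounded N (c r : 'rV[R]_N) (f : 'rV[R]_N -> R) :
  (forall p, box c r p -> {for p, continuous f}) ->
  exists2 K : R, 0 <= K & forall p, box c r p -> `|f p| <= K.
Proof.
move=> cf; have [/set0P|] := boolP (box c r != set0); last first.
  rewrite negbK => /eqP b0; exists 0 => // p bp.
  by have : set0 p by rewrite -b0.
move=> b0.
have [|q _ hq] := @compact_EVT_max _ R (fun p => `|f p|) _ b0 (@box_compact N c r).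
  apply: continuous_in_subspaceT => p; rewrite inE => bp.
  exact: (@continuous_comp _ _ _ f (fun x => `|x|) p (cf _ bp) (@norm_continuous _ _ _)).
exists `|f q| => // p bp; apply: hq; by rewrite inE.
Qed.

(** Monotonicity in the constant lets the sum of the individual constants serve for all indices. *)
Lemma finite_bound n (P : 'I_n -> R -> Prop) :
  (forall i, exists2 K : R, 0 <= K & P i K) ->
  (forall i K K', K <= K' -> P i K -> P i K') ->
  exists2 K : R, 0 <= K & forall i, P i K.
Proof.
move=> h mono; have /choice[K hK] : forall i, exists K, 0 <= K /\ P i K.
  by move=> i; have [K K0 PK] := h i; exists K.
exists (\sum_i K i) => [|i]; first by apply: sumr_ge0 => i _; have [] := hK i.
apply: mono (proj2 (hK i)).
rewrite (bigD1 i) //= lerDl sumr_ge0 // => j _; exact: (proj1 (hK j)).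
Qed.

Section in_box.
Context N (U : set 'rV[R]_N) (c r : 'rV[R]_N).
Hypotheses (Uo : open U) (bU : box c r `<=` U).

Lemma directional_bound (f : 'rV[R]_N -> R) : Ck 1 U f ->
  exists2 K : R, 0 <= K & forall p v, box c r p -> `|'D_v f p| <= K * `|v|.
Proof.
move=> Cf.
have [j|j K K' KK h p bp|K K0 hK] := @finite_bound N
   (fun j K => forall p, box c r p -> `|pd j f p| <= K).
- apply: box_bounded => p bp; exact: (Ck_continuous (Ck_pd j Cf) (bU bp)).
- exact: le_trans (h _ bp) KK.
exists (N%:R * K) => [|p v bp]; first by rewrite mulr_ge0.
rewrite (Ck_deriveE _ Uo Cf (bU bp)) (le_trans (ler_norm_sum _ _ _)) //.
rewrite -mulrA mulr_natl -[X in _ *+ X]card_ord -sumr_const; apply: ler_sum => j _.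
by rewrite normrM mulrC ler_pM //; [exact: hK|exact: coord_le_norm].
Qed.

Lemma box_mvt (f : 'rV[R]_N -> R) x v : Ck 1 U f -> box c r x -> box c r (x + v) ->
  exists t : R, [/\ 0 <= t <= 1, box c r (x + t *: v) &
    f (x + v) - f x = 'D_v f (x + t *: v)].
Proof.
move=> Cf bx bv; have [s s01|t t01 E] := @line_mvt R _ f x v.
  apply: diff_derivable; apply: (Ck_differentiable Uo Cf).
  by apply: bU; exact: box_segment.
by exists t; split=> //; exact: box_segment.
Qed.

Lemma box_lipschitz1 (f : 'rV[R]_N -> R) : Ck 1 U f ->
  exists2 K : R, 0 <= K & forall x y, box c r x -> box c r y ->
    `|f x - f y| <= K * `|x - y|.
Proof.
move=> Cf; have [K K0 hK] := directional_bound Cf; exists K => // x y bx by'.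
have e : y + (x - y) = x by rewrite addrC subrK.
have [|t [_ bt E]] := @box_mvt f y (x - y) Cf by'; first by rewrite e.
by rewrite e in E; rewrite E; exact: hK.
Qed.

(** The mean value theorem turns the remainder into a difference of first derivatives at two points,
    and these are Lipschitz on the box. *)
Lemma box_taylor1 (f : 'rV[R]_N -> R) : Ck 2 U f ->
  exists2 K : R, 0 <= K & forall x v, box c r x -> box c r (x + v) ->
    `|f (x + v) - f x - 'D_v f x| <= K * (`|v| * `|v|).
Proof.
move=> Cf.
have [j|j K K' KK h x y bx by'|K K0 hK] := @finite_bound N
   (fun j K => forall x y, box c r x -> box c r y -> `|pd j f x - pd j f y| <= K * `|x - y|).
- exact: box_lipschitz1 (Ck_pd j Cf).
- by apply: le_trans (h _ _ bx by') _; apply: ler_wpM2r.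
exists (N%:R * K) => [|x v bx bv]; first by rewrite mulr_ge0.
have Cf1 := CkW Cf.
have [t [t01 bt ->]] := box_mvt Cf1 bx bv.
rewrite (Ck_deriveE _ Uo Cf1 (bU bx)) (Ck_deriveE _ Uo Cf1 (bU bt)) -sumrB.
rewrite (le_trans (ler_norm_sum _ _ _)) //.
rewrite -mulrA mulr_natl -[X in _ *+ X]card_ord -sumr_const; apply: ler_sum => j _.
rewrite -mulrBr normrM [X in _ <= X]mulrCA ler_pM //; first exact: coord_le_norm.
apply: le_trans (hK _ _ _ bt bx) _; apply: ler_wpM2l => //.
move: t01 => /andP[t0 t1]; rewrite [x + _]addrC addrK normrZ ger0_norm //.
by rewrite ler_piMl.
Qed.

Lemma box_lipschitz M (F : 'rV[R]_N -> 'rV[R]_M) : Cv 1 U F ->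
  exists2 K : R, 0 <= K & forall x y, box c r x -> box c r y ->
    `|F x - F y| <= K * `|x - y|.
Proof.
move=> CF.
have [j|j K K' KK h x y bx by'|K K0 hK] := @finite_bound M
   (fun j K => forall x y, box c r x -> box c r y -> `|F x 0 j - F y 0 j| <= K * `|x - y|).
- exact: box_lipschitz1 (CF j).
- by apply: le_trans (h _ _ bx by') _; apply: ler_wpM2r.
exists K => // x y bx by'; apply: rV_norm_le; first by rewrite mulr_ge0.
by move=> j; rewrite !mxE; exact: hK.
Qed.

Lemma box_taylor M (F : 'rV[R]_N -> 'rV[R]_M) : Cv 2 U F ->
  exists2 K : R, 0 <= K & forall x v, box c r x -> box c r (x + v) ->
    `|F (x + v) - F x - 'D_v F x| <= K * (`|v| * `|v|).
Proof.
move=> CF.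
have [j|j K K' KK h x v bx bv|K K0 hK] := @finite_bound M
   (fun j K => forall x v, box c r x -> box c r (x + v) ->
     `|F (x + v) 0 j - F x 0 j - 'D_v (fun q => F q 0 j) x| <= K * (`|v| * `|v|)).
- exact: box_taylor1 (CF j).
- by apply: le_trans (h _ _ bx bv) _; apply: ler_wpM2r => //; rewrite mulr_ge0.
exists K => // x v bx bv; apply: rV_norm_le; first by rewrite !mulr_ge0.
move=> j; rewrite derive_row ?mxE; first exact: hK.
exact: (Cv_differentiable Uo CF (bU bx)).
Qed.

Lemma box_bounded_rV M (F : 'rV[R]_N -> 'rV[R]_M) : Cv 0 U F ->
  exists2 K : R, 0 <= K & forall x, box c r x -> `|F x| <= K.
Proof.
move=> CF.
have [j|j K K' KK h x bx|K K0 hK] := @finite_bound M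
   (fun j K => forall x, box c r x -> `|F x 0 j| <= K).
- apply: box_bounded => p bp; exact: (Ck_continuous (CF j) (bU bp)).
- exact: le_trans (h _ bx) KK.
by exists K => // x bx; apply: rV_norm_le => // j; exact: hK.
Qed.

Lemma derive_bound M (F : 'rV[R]_N -> 'rV[R]_M) : Cv 1 U F ->
  exists2 K : R, 0 <= K & forall p v, box c r p -> `|'D_v F p| <= K * `|v|.
Proof.
move=> CF.
have [j|j K K' KK h p v bp|K K0 hK] := @finite_bound M
   (fun j K => forall p v, box c r p -> `|'D_v (fun q => F q 0 j) p| <= K * `|v|).
- exact: directional_bound (CF j).
- by apply: le_trans (h _ _ bp) _; apply: ler_wpM2r.
exists K => // p v bp; apply: rV_norm_le; first by rewrite mulr_ge0.
move=> j; rewrite derive_row ?mxE; first exact: hK.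
exact: (Cv_differentiable Uo CF (bU bp)).
Qed.

End in_box.
End boxes.

(** * Flows by Euler's polygons *)

(** Nested intervals: the radius [2 * C * 2^-1 ^+ n] is the sum of all bounds from [n] on, so the
    ends [a n] increase and the ends [b n] decrease. The limit is the supremum of the [a n]. *)
Lemma geometric_limit (R : realType) (u : nat -> R) (C : R) : 0 <= C ->
  (forall n, `|u n.+1 - u n| <= C * 2^-1 ^+ n) ->
  exists l, forall n, `|l - u n| <= 2 * C * 2^-1 ^+ n.
Proof.
move=> C0 du.
pose a n := u n - 2 * C * 2^-1 ^+ n; pose b n := u n + 2 * C * 2^-1 ^+ n.
have half n : (2^-1 : R) ^+ n = 2 * 2^-1 ^+ n.+1.
  by rewrite exprS mulrA mulfV ?mul1r // pnatr_eq0.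
have du' n : - (C * 2^-1 ^+ n) <= u n.+1 - u n <= C * 2^-1 ^+ n by rewrite -ler_norml.
have ainc n k : a n <= a (n + k)%N.
  elim: k => [|k IH]; first by rewrite addn0.
  apply: le_trans IH _; rewrite addnS /a.
  have := du' (n + k)%N; have := half (n + k)%N.
  move: (u _) (u _) (2^-1 ^+ (n + k)) (2^-1 ^+ (n + k).+1) => x y e e'.
  by move=> -> /andP[h1 h2]; nra.
have bdec n k : b (n + k)%N <= b n.
  elim: k => [|k IH]; first by rewrite addn0.
  apply: le_trans IH; rewrite addnS /b.
  have := du' (n + k)%N; have := half (n + k)%N.
  move: (u _) (u _) (2^-1 ^+ (n + k)) (2^-1 ^+ (n + k).+1) => x y e e'.
  by move=> -> /andP[h1 h2]; nra.
have e0 n : 0 <= 2 * C * 2^-1 ^+ n by rewrite !mulr_ge0 // exprn_ge0 // invr_ge0.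
have ab n m : a n <= b m.
  apply: le_trans (bdec m n); rewrite addnC; apply: le_trans (ainc n m) _.
  by rewrite /a /b lerD2l; have := e0 (n + m)%N; lra.
have ubs m : ubound (range a) (b m) by move=> _ [n _ <-].
have hs : has_sup (range a).
  by split; [exists (a 0%N), 0%N|exists (b 0%N); exact: ubs].
exists (sup (range a)) => n; rewrite ler_distl; apply/andP; split.
  by apply: sup_upper_bound => //; exists n.
apply: ge_sup; [by exists (a 0%N), 0%N|exact: ubs].
Qed.

(** Growth of an error under [m] Euler steps of length [t] within total time one, bounded
    independently of the mesh. *)
Lemma pow_one_plus_le_exp (R : realType) (K t : R) (m : nat) :
  0 <= K -> 0 <= t -> m%:R * t <= 1 -> (1 + t * K) ^+ m <= expR K.
Proof.
move=> K0 t0 mt.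
have h : 1 + t * K <= expR (t * K) by exact: expR_ge1Dx.
apply: (@le_trans _ _ (expR (t * K) ^+ m)).
  by apply: lerXn2r => //; rewrite nnegrE ?expR_ge0 // addr_ge0 // mulr_ge0.
rewrite -expRM_natr ler_expR mulrC mulrA.
by rewrite -[leRHS]mul1r ler_wpM2r.
Qed.

Section euler.
Context {R : realType}.

Definition step M (X : 'rV[R]_M -> 'rV[R]_M) (t : R) (x : 'rV[R]_M) := x + t *: X x.

(** Meshes are dyadic so that one step of a polygon splits into two steps of the next one;
    consecutive polygons can then be compared step by step, as in [euler_refine]. *)
Definition mesh (j : nat) : R := 2^-1 ^+ j.

Definition euler M (X : 'rV[R]_M -> 'rV[R]_M) j (x : 'rV[R]_M) :=
  iter (2 ^ j) (step X (mesh j)) x.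

Lemma mesh_gt0 j : 0 < mesh j.
Proof. by rewrite exprn_gt0 // invr_gt0. Qed.

Lemma mesh_ge0 j : 0 <= mesh j.
Proof. exact/ltW/mesh_gt0. Qed.

Lemma mesh_natr j : (2 ^ j)%:R * mesh j = 1.
Proof. by rewrite natrX /mesh -exprMn mulfV ?expr1n // pnatr_eq0. Qed.

Lemma mesh_natr_le j k : (k <= 2 ^ j)%N -> k%:R * mesh j <= 1.
Proof.
move=> kj; rewrite -[leRHS](mesh_natr j); apply: ler_wpM2r; first exact: mesh_ge0.
by rewrite ler_nat.
Qed.

Lemma meshS j : mesh j.+1 = mesh j / 2.
Proof. by rewrite /mesh exprSr. Qed.

Lemma mesh_small (C e : R) : 0 <= C -> 0 < e -> exists j, C * mesh j <= e.
Proof.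
move=> C0 e0.
have [n hn] : exists n : nat, C / e < n%:R.
  by exists (Num.truncn (C / e)).+1; exact: truncnS_gt.
exists n; apply: (@le_trans _ _ (e * (n%:R * mesh n))).
  rewrite mulrA; apply: ler_wpM2r; first exact: mesh_ge0.
  by rewrite -ler_pdivrMl // mulrC ltW.
rewrite -[leRHS]mulr1; apply: ler_wpM2l; first exact: ltW.
by apply: mesh_natr_le; exact/ltnW/ltn_expl.
Qed.

(* [U] is so small that the Euler polygons of [X] issued from it stay in the box up to time 1, which
   is reached after [2 ^ j] steps of length [mesh j]; then [euler j] converges on [U] to the time-one
   map of the flow of [X], at the rate [mesh j]. *)
Record good M (X : 'rV[R]_M -> 'rV[R]_M) (O U : set 'rV[R]_M) (c r : 'rV[R]_M) : Prop := Good {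
  good_open : open O;
  good_smooth : forall k, Cv k O X;
  good_box : box c r `<=` O;
  good_start : open U;
  good_stay : forall x j k, U x -> (k <= 2 ^ j)%N ->
    box c r (iter k (step X (mesh j)) x) }.

Section good_euler.
Context M (X : 'rV[R]_M -> 'rV[R]_M) (O U : set 'rV[R]_M) (c r : 'rV[R]_M).
Hypothesis gX : good X O U c r.

(** A discrete Gronwall inequality: [G] is [expR K] for a Lipschitz constant [K] of [X] on the box.
    Any sequence that follows the scheme up to defects of second order in the mesh ends close to the
    Euler polygon. *)
Lemma good_approx : exists2 G : R, 0 <= G & forall x j (C : R) (y : nat -> 'rV[R]_M),
  0 <= C -> U x -> y 0%N = x -> (forall k, (k <= 2 ^ j)%N -> box c r (y k)) ->
  (forall k, (k < 2 ^ j)%N -> `|y k.+1 - step X (mesh j) (y k)| <= C * (mesh j * mesh j)) ->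
  `|euler X j x - y (2 ^ j)%N| <= C * G * mesh j.
Proof.
have [K K0 hK] := box_lipschitz (good_open gX) (@good_box _ _ _ _ _ _ gX) (good_smooth gX 1).
exists (expR K); first exact: expR_ge0.
move=> x j C y C0 Ux y0 yb dy.
pose a k := iter k (step X (mesh j)) x.
(* There are [k] defects, each amplified at most [k] times by the factor [1 + mesh j * K]. *)
have h k : (k <= 2 ^ j)%N ->
    `|a k - y k| <= C * (mesh j * mesh j) * k%:R * (1 + mesh j * K) ^+ k.
  elim: k => [|k IH] kj; first by rewrite /a /= y0 subrr normr0 mulr0 mul0r.
  have bk : box c r (a k) by exact: (good_stay gX Ux (ltnW kj)).
  have e1 : 1 <= (1 + mesh j * K) ^+ k.
    by rewrite exprn_ege1 // lerDl mulr_ge0 // mesh_ge0.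
  have e2 : 1 <= 1 + mesh j * K by rewrite lerDl mulr_ge0 // mesh_ge0.
  have := IH (ltnW kj); set E := `|a k - y k| => hE.
  have -> : a k.+1 - y k.+1 = (a k - y k) + mesh j *: (X (a k) - X (y k))
       - (y k.+1 - step X (mesh j) (y k)).
    by rewrite /a /= -/(a k) /step; apply/rowP => i; rewrite !mxE; ring.
  apply: le_trans (ler_normB _ _) _.
  apply: le_trans (lerD (ler_normD _ _) (dy _ kj)) _.
  have h3 : `|mesh j *: (X (a k) - X (y k))| <= mesh j * (K * E).
    rewrite normrZ ger0_norm ?mesh_ge0 // ler_wpM2l ?mesh_ge0 //.
    by apply: hK => //; exact/yb/ltnW.
  have D0 : 0 <= C * (mesh j * mesh j) by rewrite !mulr_ge0 // mesh_ge0.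
  apply: le_trans (lerD (lerD (lexx _) h3) (lexx _)) _.
  rewrite -/E; have -> : E + mesh j * (K * E) = (1 + mesh j * K) * E by ring.
  apply: (@le_trans _ _ ((1 + mesh j * K) * (C * (mesh j * mesh j) * k%:R * (1 + mesh j * K) ^+ k)
     + C * (mesh j * mesh j))).
    by rewrite lerD2r ler_wpM2l // (le_trans _ e2).
  rewrite -natr1 exprS.
  move: (C * _) D0 ((1 + mesh j * K)) ((1 + mesh j * K) ^+ k) (k%:R) e1 e2 => D D0 A B n e1 e2.
  have -> : D * (n + 1) * (A * B) = A * (D * n * B) + D * (A * B) by ring.
  rewrite lerD2l -[leLHS]mulr1 ler_wpM2l //.
  by rewrite -[leLHS]mulr1 ler_pM.
apply: le_trans (h _ (leqnn _)) _.
have me := pow_one_plus_le_exp K0 (mesh_ge0 j) (mesh_natr_le (leqnn _)).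
have -> : C * (mesh j * mesh j) * (2 ^ j)%:R = C * mesh j * ((2 ^ j)%:R * mesh j) by ring.
rewrite mesh_natr mulr1 [leRHS]mulrAC.
by rewrite ler_wpM2l // mulr_ge0 // mesh_ge0.
Qed.

Lemma good_bounded : exists2 A : R, 0 <= A & forall x, box c r x -> `|X x| <= A.
Proof. exact: (box_bounded_rV (@good_box _ _ _ _ _ _ gX) (good_smooth gX 0)). Qed.

Lemma euler_refine : exists2 C : R, 0 <= C & forall x j, U x ->
  `|euler X j.+1 x - euler X j x| <= C * 2^-1 ^+ j.
Proof.
have [K K0 hK] := box_lipschitz (good_open gX) (@good_box _ _ _ _ _ _ gX) (good_smooth gX 1).
have [A A0 hA] := good_bounded.
have [G G0 hG] := good_approx.
exists (K * A * G) => [|x j Ux]; first by rewrite !mulr_ge0.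
(* The finer polygon, read at every second step, follows the coarser scheme with defects of second
   order. *)
pose y k := iter (k + k) (step X (mesh j.+1)) x.
have yb k : (k <= 2 ^ j)%N -> box c r (y k).
  by move=> kj; apply: (good_stay gX Ux); rewrite expnS mul2n -addnn leq_add.
have -> : euler X j.+1 x = y (2 ^ j)%N by rewrite /y /euler expnS mul2n -addnn.
rewrite distrC; apply: hG => // [|k kj]; first exact: mulr_ge0.
have -> : y k.+1 = step X (mesh j.+1) (step X (mesh j.+1) (y k)).
  by rewrite /y addSn addnS.
have bs : box c r (step X (mesh j.+1) (y k)).
  rewrite (_ : step _ _ _ = iter (k + k).+1 (step X (mesh j.+1)) x) //.
  apply: (good_stay gX Ux).
  by rewrite expnS mul2n -addnn -addnS leq_add // ltnW.
have byk : box c r (y k) by apply: yb; exact: ltnW.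
rewrite meshS; rewrite meshS in bs; move: (y k) byk bs => z bz bs.
have -> : step X (mesh j / 2) (step X (mesh j / 2) z) - step X (mesh j) z =
  (mesh j / 2) *: (X (step X (mesh j / 2) z) - X z).
  by rewrite {1 3}/step {1}/step; apply/rowP => i; rewrite !mxE; field.
have h0 : 0 <= mesh j / 2 by rewrite divr_ge0 // mesh_ge0.
rewrite normrZ ger0_norm //.
apply: le_trans (ler_wpM2l h0 (hK _ _ bs bz)) _.
have -> : step X (mesh j / 2) z - z = (mesh j / 2) *: X z by rewrite /step addrC addKr.
rewrite normrZ (ger0_norm h0).
have := hA _ bz; have := mesh_ge0 j; move: (mesh j) (`|X z|) (normr_ge0 (X z)) => m B B0 m0 BA.
apply: (@le_trans _ _ (m / 2 * (K * (m / 2 * A)))).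
  by do 3! (apply: ler_wpM2l => //; rewrite ?divr_ge0 //).
have -> : m / 2 * (K * (m / 2 * A)) = K * A * (m * m) / 4 by field.
by rewrite ler_pdivrMr // ler_peMr ?ler1n // !mulr_ge0.
Qed.

Lemma good_flow : exists Phi : 'rV[R]_M -> 'rV[R]_M, exists2 C : R, 0 <= C &
  forall x j, U x -> `|euler X j x - Phi x| <= C * mesh j.
Proof.
have [C C0 hC] := euler_refine.
have h x : exists l : 'rV[R]_M, U x -> forall j, `|euler X j x - l| <= 2 * C * mesh j.
  have [Ux|nUx] := pselect (U x); last by exists 0 => /nUx.
  have /choice[l hl] : forall i, exists li, forall j, `|li - euler X j x 0 i| <= 2 * C * mesh j.
    move=> i; apply: geometric_limit => // j.
    apply: le_trans (hC _ _ Ux).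
    by have := coord_le_norm (euler X j.+1 x - euler X j x) 0 i; rewrite !mxE.
  exists (\row_i l i) => _ j; apply: rV_norm_le => [|i].
    by rewrite !mulr_ge0 // mesh_ge0.
  by rewrite !mxE distrC; exact: hl.
have [Phi hPhi] := choice h; exists Phi.
by exists (2 * C) => [|x j Ux]; [rewrite mulr_ge0|exact: hPhi].
Qed.

Lemma iter_step_Cv j k K : (k <= 2 ^ j)%N -> Cv K U (iter k (step X (mesh j))).
Proof.
elim: k => [|k IH] kj; first by move=> i; exact: Ck_coord.
have Uo := good_start gX; have CI := IH (ltnW kj).
have CX : Cv K U (fun q => X (iter k (step X (mesh j)) q)).
  apply: (@Cv_comp _ _ _ _ _ U O) => //; [exact: (good_open gX)| |exact: (good_smooth gX)].
  by move=> p Up; apply: (@good_box _ _ _ _ _ _ gX); apply: (good_stay gX) => //; exact: ltnW.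
move=> i; apply: (@Ck_eq _ _ _ _ (fun q => iter k (step X (mesh j)) q 0 i
   + mesh j * X (iter k (step X (mesh j)) q) 0 i)) => // [p Up|].
  by rewrite /= {3}/step !mxE.
by apply: CkD => //; apply: CkM => //; exact: Ck_cst.
Qed.

(* The variational equation: the Euler scheme of [tangent] is the derivative of that of [X], so the
   time-one map of its flow is the derivative of the time-one map of [X]. *)
Definition tangent (z : 'rV[R]_(M + M)) : 'rV[R]_(M + M) :=
  row_mx (X (lsubmx z)) ('D_(rsubmx z) X (lsubmx z)).

Lemma derive_step (t : R) x v : O x -> 'D_v (step X t) x = v + t *: 'D_v X x.
Proof.
move=> Ox; have dX : derivable X x v.
  apply: diff_derivable; exact: (Cv_differentiable (good_open gX) (good_smooth gX 1) Ox).
rewrite -[step X t]/(id + (t *: X)) deriveD; [|exact: derivable_id|exact: derivableZ].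
by rewrite derive_id deriveZ.
Qed.

Lemma differentiable_step (t : R) x : O x -> differentiable (step X t) x.
Proof.
move=> Ox; have dX : differentiable X x.
  exact: (Cv_differentiable (good_open gX) (good_smooth gX 1) Ox).
by rewrite -[step X t]/(id + (t *: X)); apply: differentiableD => //; exact: differentiableZ.
Qed.

Lemma iter_tangent x v j k : U x -> (k <= 2 ^ j)%N ->
  iter k (step tangent (mesh j)) (row_mx x v) =
  row_mx (iter k (step X (mesh j)) x) ('D_v (iter k (step X (mesh j))) x).
Proof.
move=> Ux; elim: k => [|k IH] kj; first by rewrite /= derive_id.
have Ok : O (iter k (step X (mesh j)) x).
  by apply: (@good_box _ _ _ _ _ _ gX); apply: (good_stay gX) => //; exact: ltnW.
have dk : differentiable (iter k (step X (mesh j))) x.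
  exact: (Cv_differentiable (good_start gX) (@iter_step_Cv j k 1 (ltnW kj)) Ux).
rewrite iterS (IH (ltnW kj)) {1}/step /tangent row_mxKl row_mxKr.
rewrite scale_row_mx add_row_mx -[iter k.+1 _]/(step X (mesh j) \o iter k (step X (mesh j))).
rewrite (derive_comp _ dk (differentiable_step _ Ok)).
by rewrite derive_step.
Qed.

Lemma tangent_Cv k : Cv k (lsubmx @^-1` O) tangent.
Proof.
have Oo : open (lsubmx @^-1` O : set 'rV[R]_(M + M)).
  by apply: open_comp (good_open gX) => z _; exact: continuous_lsubmx.
have Cl (f : 'rV[R]_M -> R) : Ck k O f ->
    Ck k (lsubmx @^-1` O) (fun z : 'rV[R]_(M + M) => f (lsubmx z)).
  move=> Cf; apply: (@Ck_comp _ _ _ _ _ O (fun z : 'rV[R]_(M + M) => lsubmx z)) => //.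
    exact: good_open gX.
  move=> i; apply: (@Ck_eq _ _ _ _ (fun q => q 0 (lshift M i))) => // [p _|].
    by rewrite mxE.
  exact: Ck_coord.
move=> i; case: (split_ordP i) => l ->.
  apply: (@Ck_eq _ _ _ _ (fun q => X (lsubmx q) 0 l)) => // [p _|].
    by rewrite row_mxEl.
  exact: Cl (good_smooth gX k l).
apply: (@Ck_eq _ _ _ _ (fun q => \sum_m q 0 (rshift M m) * pd m (fun p => X p 0 l) (lsubmx q))) => //.
  move=> p Op; rewrite row_mxEr derive_row ?mxE.
    rewrite (Ck_deriveE _ (good_open gX) (good_smooth gX 1 l) Op).
    by apply: eq_bigr => m _; rewrite !mxE.
  exact: (Cv_differentiable (good_open gX) (good_smooth gX 1) Op).
apply: Ck_sum => // m; apply: CkM => //; first exact: Ck_coord.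
apply: Cl; apply: Ck_pd; exact: (good_smooth gX).
Qed.

(** In time one a tangent vector grows at most by the factor [expR K], whence [rho0]. Larger
    half-widths are allowed because [flow_derive_commuting] needs room for a comparison sequence. *)
Lemma tangent_good (rho : R) : exists rho0 : R, forall rho', rho0 <= rho' ->
  good tangent (lsubmx @^-1` O) [set z | U (lsubmx z) /\ `|rsubmx z| < rho]
    (row_mx c 0) (row_mx r (const_mx rho')).
Proof.
have [K K0 hK] := derive_bound (good_open gX) (@good_box _ _ _ _ _ _ gX) (good_smooth gX 1).
exists (expR K * rho) => rho' hrho; split.
- by apply: open_comp (good_open gX) => z _; exact: continuous_lsubmx.
- exact: tangent_Cv.
- move=> z bz; apply: (@good_box _ _ _ _ _ _ gX) => i.
  by have := bz (lshift M i); rewrite !row_mxEl mxE.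
- rewrite (_ : [set z | _] = lsubmx @^-1` U `&` (fun z => `|rsubmx z|) @^-1` [set t : R | t < rho]) //.
  apply: openI.
    by apply: open_comp (good_start gX) => z _; exact: continuous_lsubmx.
  apply: open_comp => [z _|]; last exact: open_lt.
  apply: (@continuous_comp _ _ _ (@rsubmx R 1 M M) (fun x : 'rV[R]_M => `|x|) z).
    exact: continuous_rsubmx.
  exact: norm_continuous.
move=> z j k [Ux hv] kj.
rewrite -[z]hsubmxK; move: (lsubmx z) (rsubmx z) Ux hv => x v Ux hv.
rewrite iter_tangent // => i; case: (split_ordP i) => l ->.
  by rewrite !row_mxEl; exact: (good_stay gX).
rewrite !row_mxEr !mxE subr0; apply: le_trans (coord_le_norm _ _ _) _.
have h m : (m <= k)%N ->
    `|'D_v (iter m (step X (mesh j))) x| <= (1 + mesh j * K) ^+ m * `|v|.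
  elim: m => [|m IH] mk; first by rewrite expr0 mul1r /= derive_id.
  have mj : (m <= 2 ^ j)%N by exact: leq_trans (ltnW mk) kj.
  have bm : box c r (iter m (step X (mesh j)) x) by exact: (good_stay gX).
  have Om := @good_box _ _ _ _ _ _ gX _ bm.
  have dm : differentiable (iter m (step X (mesh j))) x.
    exact: (Cv_differentiable (good_start gX) (@iter_step_Cv j m 1 mj) Ux).
  rewrite -[iter m.+1 _]/(step X (mesh j) \o iter m (step X (mesh j))).
  rewrite (derive_comp _ dm (differentiable_step _ Om)).
  rewrite derive_step //; apply: le_trans (ler_normD _ _) _.
  have := IH (ltnW mk); move: ('D_v _ x) => w hw.
  rewrite normrZ (ger0_norm (mesh_ge0 j)) exprS -mulrA.
  apply: (@le_trans _ _ ((1 + mesh j * K) * `|w|)).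
    by rewrite mulrDl mul1r lerD2l -mulrA; apply: ler_wpM2l; [exact: mesh_ge0|exact: hK].
  by apply: ler_wpM2l => //; rewrite addr_ge0 // mulr_ge0 // mesh_ge0.
apply: le_trans (h _ (leqnn _)) _; apply: le_trans hrho.
apply: ler_pM => //; last exact: ltW.
  by rewrite exprn_ge0 // addr_ge0 // mulr_ge0 // mesh_ge0.
exact: (pow_one_plus_le_exp K0 (mesh_ge0 j) (mesh_natr_le kj)).
Qed.

End good_euler.
Lemma open_radius M (U : set 'rV[R]_M) p : open U -> U p ->
  exists2 d : R, 0 < d & forall x, `|x - p| < d -> U x.
Proof.
move=> Uo Up; have /nbhs_ballP[d d0 hd] := open_nbhs_nbhs (conj Uo Up).
by exists d => // x xp; apply: hd; rewrite -ball_normE /= distrC.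
Qed.

Lemma continuous_radius M (g : 'rV[R]_M -> R) p : {for p, continuous g} <->
  forall e, 0 < e -> exists2 d : R, 0 < d & forall x, `|x - p| < d -> `|g p - g x| <= e.
Proof.
split=> [cg e e0|h].
  have /cvgrPdist_le/(_ _ e0)/nbhs_ballP[d d0 hd] := cg.
  by exists d => // x xp; apply: hd; rewrite -ball_normE /= distrC.
apply/(@cvgrPdist_le _ _ _ (nbhs p)) => e e0; have [d d0 hd] := h _ e0.
by apply/nbhs_ballP; exists d => // x; rewrite -ball_normE /= distrC => /hd.
Qed.

Lemma le_mesh_limit (a b D : R) : 0 <= D -> (forall j, a <= b + D * mesh j) -> a <= b.
Proof.
move=> D0 h; apply/ler_addgt0Pr => e e0; have [j hj] := mesh_small D0 e0.
by apply: le_trans (h j) _; rewrite lerD2l.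
Qed.

Lemma uniform_limit_continuous M (U : set 'rV[R]_M) (f : nat -> 'rV[R]_M -> R) (g : 'rV[R]_M -> R) C p :
  open U -> U p -> 0 <= C -> (forall j, {for p, continuous (f j)}) ->
  (forall j x, U x -> `|f j x - g x| <= C * mesh j) -> {for p, continuous g}.
Proof.
move=> Uo Up C0 cf fg; apply/continuous_radius => e e0.
have e3 : 0 < e / 3 by rewrite divr_gt0.
have [j hj] := mesh_small C0 e3.
have /continuous_radius/(_ _ e3)[d1 d10 hd1] := cf j.
have [d2 d20 hd2] := open_radius Uo Up.
exists (Num.min d1 d2); first by rewrite lt_min d10 d20.
move=> x; rewrite lt_min => /andP[/hd1 h /hd2 Ux].
have h1 := le_trans (fg j _ Up) hj; have h2 := le_trans (fg j _ Ux) hj.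
have -> : g p - g x = (f j p - f j x) - (f j p - g p) + (f j x - g x) by ring.
apply: le_trans (ler_normD _ _) _; rewrite [e](_ : _ = e / 3 + e / 3 + e / 3); last by field.
apply: lerD => //; apply: le_trans (ler_normB _ _) _; exact: lerD.
Qed.

(** The mean value theorem is applied to [f j] with the increment [h] fixed, and [j] tends to
    infinity afterwards. The intermediate point varies with [j], which is harmless because [g] is
    close to [g p] on the whole segment. *)
Lemma uniform_limit_derive M (U : set 'rV[R]_M) (f : nat -> 'rV[R]_M -> R)
    (F g : 'rV[R]_M -> R) C p v :
  open U -> U p -> 0 <= C -> (forall j x, U x -> differentiable (f j) x) ->
  (forall j x, U x -> `|f j x - F x| <= C * mesh j) ->
  (forall j x, U x -> `|'D_v (f j) x - g x| <= C * mesh j) ->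
  {for p, continuous g} -> is_derive p v F (g p).
Proof.
move=> Uo Up C0 df fF dfg cg.
suff H : (h^-1 *: ((F \o shift p) (h *: v) - F p)) @[h --> 0^'] --> g p.
  split; first by apply/cvg_ex; exists (g p).
  exact: cvg_lim H.
apply/cvgrPdist_le => e e0.
have [d d0 hd] : exists2 d : R, 0 < d & forall x, `|x - p| < d -> U x /\ `|g p - g x| <= e.
  have /continuous_radius/(_ _ e0)[d1 d10 hd1] := cg.
  have [d2 d20 hd2] := open_radius Uo Up.
  exists (Num.min d1 d2); first by rewrite lt_min d10 d20.
  by move=> x; rewrite lt_min => /andP[/hd1 h /hd2 Ux].
have d1 : 0 < d / (`|v| + 1) by rewrite divr_gt0 // ltr_wpDl.
exists (d / (`|v| + 1)) => // h /=; rewrite sub0r normrN => hd1 h0.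
have near_p t : 0 <= t <= 1 -> `|p + t *: (h *: v) - p| < d.
  move=> /andP[t0 t1]; rewrite addrC addKr !normrZ (ger0_norm t0).
  apply: (@le_lt_trans _ _ (`|h| * `|v|)); first by rewrite ler_piMl // mulr_ge0.
  apply: (@le_lt_trans _ _ (`|h| * (`|v| + 1))); first by rewrite ler_wpM2l // lerDl.
  by rewrite -ltr_pdivlMr // ltr_wpDl.
have inU t : 0 <= t <= 1 -> U (p + t *: (h *: v)) by move=> /near_p /hd[].
have hp : 0 < `|h| by rewrite normr_gt0.
have -> : g p - h^-1 *: ((F \o shift p) (h *: v) - F p) =
   - (h^-1 * (F (p + h *: v) - F p - h * g p)).
  rewrite /= [h *: v + p]addrC.
  have -> : h^-1 *: (F (p + h *: v) - F p) = h^-1 * (F (p + h *: v) - F p) by [].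
  by field.
rewrite normrN normrM normfV ler_pdivrMl //.
apply: (@le_mesh_limit _ _ (2 * C + `|h| * C)) => [|j].
  by rewrite addr_ge0 // mulr_ge0.
have [t t01|t t01 E] := @line_mvt R _ (f j) p (h *: v).
  by apply: diff_derivable; apply: df; exact: inU.
have dj : derivable (f j) (p + t *: (h *: v)) v.
  by apply: diff_derivable; apply: df; exact: inU.
have [_ E2] := is_derive_scale h dj.
have {E2}E : f j (p + h *: v) - f j p = h * 'D_v (f j) (p + t *: (h *: v)) by rewrite E E2.
have Uh : U (p + h *: v) by have := inU 1; rewrite scale1r; apply; rewrite lexx ler01.
have h1 := fF j _ Uh; have h2 := fF j _ Up; have h3 := dfg j _ (inU _ t01).
have [_ h4] := hd _ (near_p _ t01).
move: E h1 h2 h3 h4.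
move: (f j _) (f j p) (F _) (F p) ('D_v (f j) _) (g p) (g _) (mesh j) (mesh_ge0 j).
move=> a b A B D G G' m m0 E h1 h2 h3 h4.
have -> : A - B - h * G = - (a - A) + (b - B) + h * ((D - G') - (G - G')).
  have -> : a = b + h * D by rewrite -E; ring.
  by ring.
have -> : `|h| * e + (2 * C + `|h| * C) * m = (C * m + C * m) + `|h| * (C * m + e) by ring.
apply: le_trans (ler_normD _ _) _; apply: lerD.
  by apply: le_trans (ler_normD _ _) _; rewrite normrN; exact: lerD.
rewrite normrM ler_wpM2l //.
by apply: le_trans (ler_normB _ _) _; exact: lerD.
Qed.

End euler.

Section flow.
Context {R : realType}.

(** No differential equation is stated: the time-one map is known through the rate at which the
    Euler polygons approach it, and its properties are derived from those of the polygons. *)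
Definition is_flow M (X : 'rV[R]_M -> 'rV[R]_M) (U : set 'rV[R]_M) (Phi : 'rV[R]_M -> 'rV[R]_M) :=
  exists2 C : R, 0 <= C & forall x j, U x -> `|euler X j x - Phi x| <= C * mesh j.

Lemma row_mx_Cv M k (v : 'rV[R]_M) (U : set 'rV[R]_M) : open U ->
  Cv k U (fun q => row_mx q v).
Proof.
move=> Uo i; case: (split_ordP i) => l ->.
  by apply: (@Ck_eq _ _ _ _ (fun q => q 0 l)) => // [p _|]; [rewrite row_mxEl|exact: Ck_coord].
by apply: (@Ck_eq _ _ _ _ (fun=> v 0 l)) => // [p _|]; [rewrite row_mxEr|exact: Ck_cst].
Qed.

Lemma flow_continuous M (X : 'rV[R]_M -> 'rV[R]_M) O U c r Phi :
  good X O U c r -> is_flow X U Phi -> Cv 0 U Phi.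
Proof.
move=> gX [C C0 hC] i; split=> // p Up.
apply: (@uniform_limit_continuous _ _ U (fun j q => euler X j q 0 i) _ C) => //.
- exact: good_start gX.
- by move=> j; apply: (Ck_continuous (@iter_step_Cv _ _ _ _ _ _ _ gX j _ 0 (leqnn _) i) Up).
- move=> j x Ux; apply: le_trans (hC _ j Ux).
  by have := coord_le_norm (euler X j x - Phi x) 0 i; rewrite !mxE.
Qed.

Lemma row_mx_fixed_continuous M (v : 'rV[R]_M) (V : set 'rV[R]_(M + M)) (g : 'rV[R]_(M + M) -> R) p :
  open V -> V (row_mx p v) -> Ck 0 V g -> {for p, continuous (fun q => g (row_mx q v))}.
Proof.
move=> Vo Vp Cg.
apply: (@continuous_comp _ _ _ (fun q : 'rV[R]_M => row_mx q v) g); last exact: (Ck_continuous Cg Vp).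
apply/continuous_rowP => i; exact: (Ck_continuous (@row_mx_Cv _ 0 v setT openT i)).
Qed.

Section tangent_flow.
Context M (X : 'rV[R]_M -> 'rV[R]_M) (O U : set 'rV[R]_M) (c r : 'rV[R]_M).
Context (Phi : 'rV[R]_M -> 'rV[R]_M) (gX : good X O U c r) (fX : is_flow X U Phi).
Context (rho : R) (c' r' : 'rV[R]_(M + M)) (Psi : 'rV[R]_(M + M) -> 'rV[R]_(M + M)).
Let V : set 'rV[R]_(M + M) := [set z | U (lsubmx z) /\ `|rsubmx z| < rho].
Context (gT : good (tangent X) (lsubmx @^-1` O) V c' r') (fT : is_flow (tangent X) V Psi).

Lemma euler_tangent x v j : U x ->
  euler (tangent X) j (row_mx x v) = row_mx (euler X j x) ('D_v (euler X j) x).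
Proof. by move=> Ux; exact: (iter_tangent gX v Ux (leqnn _)). Qed.

Lemma euler_differentiable j x : U x -> differentiable (euler X j) x.
Proof.
move=> Ux.
exact: (Cv_differentiable (good_start gX) (@iter_step_Cv _ _ _ _ _ _ _ gX j _ 1 (leqnn _)) Ux).
Qed.

Lemma flow_is_derive x v i : U x -> `|v| < rho ->
  is_derive x v (fun q => Phi q 0 i) (Psi (row_mx x v) 0 (rshift M i)).
Proof.
move=> Ux hv; have [C C0 hC] := fX; have [C' C'0 hC'] := fT.
have VE q : U q -> V (row_mx q v) by move=> Uq; rewrite /V /= row_mxKl row_mxKr.
apply: (@uniform_limit_derive _ _ U (fun j q => euler X j q 0 i) _
  (fun q => Psi (row_mx q v) 0 (rshift M i)) (C + C')) => //.
- exact: good_start gX.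
- exact: addr_ge0.
- move=> j q Uq.
  exact: (Ck_differentiable (good_start gX) (@iter_step_Cv _ _ _ _ _ _ _ gX j _ 1 (leqnn _) i) Uq).
- move=> j q Uq; apply: (@le_trans _ _ (C * mesh j)); last first.
    by rewrite ler_wpM2r ?mesh_ge0 // lerDl.
  apply: le_trans (hC _ j Uq).
  by have := coord_le_norm (euler X j q - Phi q) 0 i; rewrite !mxE.
- move=> j q Uq; apply: (@le_trans _ _ (C' * mesh j)); last first.
    by rewrite ler_wpM2r ?mesh_ge0 // lerDr.
  apply: le_trans (hC' _ j (VE _ Uq)).
  have := coord_le_norm (euler (tangent X) j (row_mx q v) - Psi (row_mx q v)) 0 (rshift M i).
  rewrite !mxE euler_tangent // row_mxEr derive_row ?mxE //.
  exact: euler_differentiable.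
apply: (@row_mx_fixed_continuous _ v V (fun z => Psi z 0 (rshift M i)) x (good_start gT) (VE _ Ux)).
exact: (flow_continuous gT fT).
Qed.

End tangent_flow.

Lemma tangent_flow_exists M (X : 'rV[R]_M -> 'rV[R]_M) O U c r rho :
  good X O U c r -> exists c' r' Psi,
  good (tangent X) (lsubmx @^-1` O) [set z | U (lsubmx z) /\ `|rsubmx z| < rho] c' r' /\
  is_flow (tangent X) [set z | U (lsubmx z) /\ `|rsubmx z| < rho] Psi.
Proof.
move=> gX; have [rho0 /(_ _ (lexx _)) gT] := tangent_good gX rho.
have [Psi fT] := good_flow gT.
by exists (row_mx c 0), (row_mx r (const_mx rho0)), Psi.
Qed.

(** The induction runs over all dimensions and fields at once: the partial derivatives of the flow
    are components of the flow of [tangent X], which lives in dimension [M + M] and to which the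
    induction hypothesis applies. *)
Lemma flow_smooth k M (X : 'rV[R]_M -> 'rV[R]_M) O U c r Phi :
  good X O U c r -> is_flow X U Phi -> Cv k U Phi.
Proof.
elim: k M X O U c r Phi => [|k IH] M X O U c r Phi gX fX.
  exact: flow_continuous gX fX.
(* The bound 2 exceeds the norm of the coordinate vectors, in whose directions the derivatives are
   taken. *)
have [c' [r' [Psi [gT fT]]]] := tangent_flow_exists 2 gX.
have CPsi := IH _ _ _ _ _ _ _ gT fT.
have e2 (j : 'I_M) : `|delta_mx 0 j : 'rV[R]_M| < 2.
  apply: (@le_lt_trans _ _ 1); last by rewrite ltr1n.
  apply: rV_norm_le => // l; rewrite !mxE eqxx /=.
  by case: (l == j); rewrite ?normr1 ?normr0.
have Uo := good_start gX.
move=> i; split=> [p Up|j]; first exact: (Ck_continuous (flow_continuous gX fX i) Up).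
have dj p : U p -> is_derive p (delta_mx 0 j) (fun q => Phi q 0 i)
    (Psi (row_mx p (delta_mx 0 j)) 0 (rshift M i)).
  by move=> Up; exact: (flow_is_derive gX fX gT fT i Up (e2 j)).
split=> [p Up|]; first exact: (@ex_derive _ _ _ _ _ _ _ (dj _ Up)).
apply: (@Ck_eq _ _ _ _ (fun p => Psi (row_mx p (delta_mx 0 j)) 0 (rshift M i))) => //.
  by move=> p Up; have [_ <-] := dj _ Up.
apply: (@Ck_comp _ _ _ _ U _ (fun q : 'rV[R]_M => row_mx q (delta_mx 0 j))
  (fun z => Psi z 0 (rshift M i))) => //.
- exact: good_start gT.
- by move=> p Up; rewrite /= row_mxKl row_mxKr.
- exact: row_mx_Cv.
Qed.

Lemma flow_in_box M (X : 'rV[R]_M -> 'rV[R]_M) O U c r Phi x :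
  good X O U c r -> is_flow X U Phi -> U x -> box c r (Phi x).
Proof.
move=> gX [C C0 hC] Ux i; apply: (le_mesh_limit C0) => j.
have -> : Phi x 0 i - c 0 i = (euler X j x 0 i - c 0 i) - (euler X j x - Phi x) 0 i.
  by rewrite !mxE; ring.
apply: le_trans (ler_normB _ _) _; apply: lerD.
  exact: (good_stay gX Ux (leqnn _)).
by apply: le_trans (hC _ j Ux); exact: coord_le_norm.
Qed.

Section flow_identities.
Context M (X : 'rV[R]_M -> 'rV[R]_M) (O U : set 'rV[R]_M) (c r : 'rV[R]_M).
Context (Phi : 'rV[R]_M -> 'rV[R]_M) (gX : good X O U c r) (fX : is_flow X U Phi).

(* To be used where [z] is a variation of the parameters of [X] and [Y] is the resulting variation
   of the flow at time one, which is that of an autonomous equation if [Y] commutes with [X]. *)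
Lemma flow_derive_commuting (Y : 'rV[R]_M -> 'rV[R]_M) (z x : 'rV[R]_M) :
  (forall k, Cv k O Y) -> U x ->
  (forall j k, (k <= 2 ^ j)%N -> let u := iter k (step X (mesh j)) x in
     'D_z X u = Y u /\ 'D_(Y u) X u = 'D_(X u) Y u) ->
  'D_z Phi x = z + Y (Phi x).
Proof.
move=> CY Ux hY.
have Oo := good_open gX; have bO := @good_box _ _ _ _ _ _ _ gX.
have [A A0 hA] := good_bounded gX.
have [B B0 hB] := box_bounded_rV bO (CY 0).
have [KY KY0 hKY] := box_taylor Oo bO (CY 2).
have [DY DY0 hDY] := derive_bound Oo bO (CY 1).
have [L L0 hL] := box_lipschitz Oo bO (CY 1).
pose rho := `|z| + 1.
have [rho0 hrho0] := tangent_good gX rho.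
(* The fibre box must hold the polygons of [tangent X] and also the comparison vectors [z + s Y]
   with [s <= 1], where [Y] is bounded by [B]. *)
pose rho' := Num.max rho0 (`|z| + B).
have gT := hrho0 rho' (ltac:(rewrite le_max lexx //)).
have [Psi fT] := good_flow gT.
have [CT CT0 hCT] := fT; have [CX CX0 hCX] := fX.
have [G G0 hG] := good_approx gT.
have Uz : [set z | U (lsubmx z) /\ `|rsubmx z| < rho] (row_mx x z).
  by rewrite /= row_mxKl row_mxKr; split=> //; rewrite /rho ltrDl.
have bx j k (kj : (k <= 2 ^ j)%N) : box c r (iter k (step X (mesh j)) x).
  exact: (good_stay gX).
pose E := KY * (A * A) + DY * A.
have E0 : 0 <= E by rewrite addr_ge0 // !mulr_ge0.
have key j : `|euler (tangent X) j (row_mx x z)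
     - row_mx (euler X j x) (z + Y (euler X j x))| <= E * G * mesh j.
  have m0 : 0 <= mesh j :> R := mesh_ge0 j.
  have mh k := @mesh_natr_le R j k.
  (* Expected solution of the variational equation: after time [s] the vector [z] has become
     [z + s Y]. It follows the Euler scheme up to second order because the derivative of [Y] along
     [X] equals that of [X] along [Y]. *)
  pose y k := row_mx (iter k (step X (mesh j)) x)
     (z + (k%:R * mesh j) *: Y (iter k (step X (mesh j)) x)).
  have -> : row_mx (euler X j x) (z + Y (euler X j x)) = y (2 ^ j)%N.
    by rewrite /y mesh_natr scale1r.
  apply: hG => //.
  - by rewrite /y /= mul0r scale0r addr0.
  - move=> k kj i; case: (split_ordP i) => l ->.
      by rewrite !row_mxEl; exact: bx.
    rewrite !row_mxEr [X in _ - X]mxE subr0 [leRHS]mxE; apply: le_trans (coord_le_norm _ _ _) _.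
    apply: (@le_trans _ _ (`|z| + B)); last by rewrite le_max lexx orbT.
    apply: le_trans (ler_normD _ _) _; rewrite lerD2l normrZ ger0_norm ?mulr_ge0 //.
    rewrite -[leRHS]mul1r; apply: ler_pM => //; [by rewrite mulr_ge0|exact: mh|].
    by apply: hB; exact: bx.
  move=> k kj; rewrite /y iterS; have [h1 h2] := hY j k (ltnW kj).
  have bk := bx j k (ltnW kj); have bk1 := bx j k.+1 kj; rewrite iterS in bk1.
  move: (iter k _ x) h1 h2 bk bk1 => u h1 h2 bk bk1.
  have dX : forall v, 'D_v X u = v *m 'J X u.
    move=> v; apply: deriveEjacobian.
    exact: (Cv_differentiable Oo (good_smooth gX 1) (bO _ bk)).
  rewrite [step (tangent X) _ _]/step /tangent row_mxKl row_mxKr scale_row_mx add_row_mx.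
  rewrite opp_row_mx add_row_mx subrr.
  have hkm := mh k.+1 kj.
  set t := mesh j in m0 hkm bk1 *.
  have -> : z + (k.+1%:R * t) *: Y (step X t u) - (z + (k%:R * t) *: Y u + t *: 'D_(z + (k%:R * t) *: Y u) X u)
    = (k.+1%:R * t) *: (Y (u + t *: X u) - Y u - 'D_(t *: X u) Y u) + (t * t) *: 'D_(X u) Y u.
    rewrite dX mulmxDl -dX h1 -scalemxAl -dX h2.
    have dY : differentiable Y u by exact: (Cv_differentiable Oo (CY 1) (bO _ bk)).
    have -> : 'D_(t *: X u) Y u = t *: 'D_(X u) Y u.
      by have [_ ->] := is_derive_scale t (diff_derivable (v := X u) dY).
    by rewrite -/(step X t u) -natr1; apply/rowP => i; rewrite !mxE; ring.
  apply: rV_norm_le => [|i]; first by rewrite mulr_ge0 // mulr_ge0.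
  case: (split_ordP i) => l ->.
    by rewrite row_mxEl mxE normr0 mulr_ge0 // mulr_ge0.
  rewrite row_mxEr; apply: le_trans (coord_le_norm _ _ _) _.
  apply: le_trans (ler_normD _ _) _; rewrite /E mulrDl; apply: lerD.
    rewrite normrZ ger0_norm ?mulr_ge0 // -[leRHS]mul1r.
    apply: ler_pM => //; first by rewrite mulr_ge0.
    apply: le_trans (hKY _ _ bk bk1) _.
    rewrite normrZ (ger0_norm m0) -[leRHS]mulrA; apply: ler_wpM2l => //.
    have := hA _ bk; move: (`|X u|) (normr_ge0 (X u)) => a a0 aA.
    have -> : t * a * (t * a) = (a * a) * (t * t) by ring.
    by apply: ler_wpM2r; [rewrite mulr_ge0|apply: ler_pM].
  rewrite normrZ ger0_norm ?mulr_ge0 // mulrC; apply: ler_wpM2r; first by rewrite mulr_ge0.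
  by apply: le_trans (hDY _ _ bk) _; apply: ler_wpM2l => //; exact: hA.
have dPhi : differentiable Phi x.
  exact: (Cv_differentiable (good_start gX) (flow_smooth 1 gX fX) Ux).
rewrite derive_row //; apply/rowP => i; rewrite [LHS]mxE.
have zrho : `|z| < rho by rewrite /rho ltrDl.
have [_ ->] := flow_is_derive gX fX gT fT i Ux zrho.
have bP := flow_in_box gX fX Ux.
apply/eqP; rewrite -subr_eq0 -normr_le0.
apply: (@le_mesh_limit _ _ _ (CT + E * G + L * CX)) => [|j].
  by rewrite !addr_ge0 // mulr_ge0.
rewrite add0r; pose w := Psi (row_mx x z) - row_mx (Phi x) (z + Y (Phi x)).
have e (A' B' : 'rV[R]_(M + M)) :
    (A' - B') 0 (rshift M i) = A' 0 (rshift M i) - B' 0 (rshift M i) by rewrite !mxE.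
apply: (@le_trans _ _ `|w 0 (rshift M i)|); first by rewrite /w e row_mxEr.
pose w1 := Psi (row_mx x z) - euler (tangent X) j (row_mx x z).
pose w2 := euler (tangent X) j (row_mx x z) - row_mx (euler X j x) (z + Y (euler X j x)).
pose w3 := Y (euler X j x) - Y (Phi x).
have -> : w 0 (rshift M i) = w1 0 (rshift M i) + w2 0 (rshift M i) + w3 0 i.
  by rewrite /w /w1 /w2 /w3 !e !row_mxEr !mxE; ring.
apply: le_trans (ler_normD _ _) _; rewrite mulrDl; apply: lerD; last first.
  apply: le_trans (coord_le_norm _ _ _) _; apply: le_trans (hL _ _ (bx _ _ (leqnn _)) bP) _.
  by rewrite -mulrA; apply: ler_wpM2l => //; exact: hCX.
apply: le_trans (ler_normD _ _) _; rewrite mulrDl; apply: lerD.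
  by apply: le_trans (coord_le_norm _ _ _) _; rewrite /w1 distrC; exact: hCT.
by apply: le_trans (coord_le_norm _ _ _) (key j).
Qed.

(** Each Euler step adds [mesh j *: b] to [F], up to a Taylor remainder quadratic in the mesh, and
    the [2 ^ j] steps add up to [b]. *)
Lemma flow_integral K (F : 'rV[R]_M -> 'rV[R]_K) (b : 'rV[R]_K) (x : 'rV[R]_M) :
  (forall k, Cv k O F) -> U x ->
  (forall j k, (k <= 2 ^ j)%N -> let u := iter k (step X (mesh j)) x in 'D_(X u) F u = b) ->
  F (Phi x) = F x + b.
Proof.
move=> CF Ux hF.
have Oo := good_open gX; have bO := @good_box _ _ _ _ _ _ _ gX.
have [A A0 hA] := good_bounded gX.
have [T T0 hT] := box_taylor Oo bO (CF 2).
have [L L0 hL] := box_lipschitz Oo bO (CF 1).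
have [CX CX0 hCX] := fX.
have bx j k (kj : (k <= 2 ^ j)%N) : box c r (iter k (step X (mesh j)) x).
  exact: (good_stay gX).
have key j k : (k <= 2 ^ j)%N ->
  `|F (iter k (step X (mesh j)) x) - F x - (k%:R * mesh j) *: b|
     <= (k%:R * mesh j) * (T * (A * A) * mesh j).
  have m0 : 0 <= mesh j :> R := mesh_ge0 j.
  elim: k => [|k IH] kj; first by rewrite /= subrr !mul0r scale0r subrr normr0.
  have := IH (ltnW kj); have := hF j k (ltnW kj).
  have := bx j k.+1 kj; have := bx j k (ltnW kj); rewrite iterS.
  move: (iter k _ x) => u bu bu1 Du hu.
  have dF : differentiable F u by exact: (Cv_differentiable Oo (CF 1) (bO _ bu)).
  have -> : F (step X (mesh j) u) - F x - (k.+1%:R * mesh j) *: b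
    = (F u - F x - (k%:R * mesh j) *: b) + (F (u + mesh j *: X u) - F u - mesh j *: b).
    by rewrite -/(step X (mesh j) u) -natr1; apply/rowP => i; rewrite !mxE; ring.
  have -> : mesh j *: b = 'D_(mesh j *: X u) F u.
    have [_ ->] := is_derive_scale (mesh j) (diff_derivable (v := X u) dF).
    by rewrite Du.
  apply: le_trans (ler_normD _ _) _.
  rewrite -natr1 mulrDl mul1r mulrDl; apply: lerD => //.
  apply: le_trans (hT _ _ bu bu1) _; rewrite normrZ (ger0_norm m0).
  have := hA _ bu; move: (`|X u|) (normr_ge0 (X u)) => a a0 aA.
  have -> : mesh j * (T * (A * A) * mesh j) = T * ((mesh j * A) * (mesh j * A)) by ring.
  apply: ler_wpM2l => //; apply: ler_pM; rewrite ?mulr_ge0 //; exact: ler_wpM2l.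
have bP := flow_in_box gX fX Ux.
apply/eqP; rewrite -subr_eq0 -normr_le0.
apply: (@le_mesh_limit _ _ _ (L * CX + T * (A * A))) => [|j].
  by rewrite !addr_ge0 // !mulr_ge0.
rewrite add0r; have := key j _ (leqnn _); rewrite mesh_natr mul1r scale1r => h.
have -> : F (Phi x) - (F x + b) = (F (Phi x) - F (euler X j x)) + (F (euler X j x) - F x - b).
  by apply/rowP => i; rewrite !mxE; ring.
apply: le_trans (ler_normD _ _) _; rewrite mulrDl; apply: lerD => //.
apply: le_trans (hL _ _ bP (bx _ _ (leqnn _))) _.
by rewrite -mulrA distrC; apply: ler_wpM2l => //; exact: hCX.
Qed.

End flow_identities.
End flow.

Section partial_directions.
Context {R : realType}.

Lemma derive_affine (V W : normedModType R) (f : V -> W) x v w :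
  (forall s : R, f (s *: v + x) = f x + s *: w) -> 'D_v f x = w.
Proof.
move=> h; apply: cvg_lim => //; apply: cvg_near_cst.
near=> s; have s0 : s != 0 by near: s; exact: nbhs_dnbhs_neq.
by rewrite /= h addrC addKr scalerA mulVf // scale1r.
Unshelve. all: by end_near. Qed.

Lemma derive_rdir n N (W : normedModType R) (f : 'rV[R]_(n + N) -> W) t u w :
  'D_(row_mx 0 w) f (row_mx t u) = 'D_w (fun u' => f (row_mx t u')) u.
Proof.
rewrite /derive.
have -> : (fun h : R => h^-1 *: ((f \o shift (row_mx t u)) (h *: row_mx 0 w) - f (row_mx t u)))
  = (fun h : R => h^-1 *: (((fun u' => f (row_mx t u')) \o shift u) (h *: w) - f (row_mx t u))).
  by apply/funext => h /=; rewrite scale_row_mx add_row_mx scaler0 add0r.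
by [].
Qed.

Lemma derive_ldir n N (W : normedModType R) (f : 'rV[R]_(n + N) -> W) t u w :
  'D_(row_mx w 0) f (row_mx t u) = 'D_w (fun t' => f (row_mx t' u)) t.
Proof.
rewrite /derive.
have -> : (fun h : R => h^-1 *: ((f \o shift (row_mx t u)) (h *: row_mx w 0) - f (row_mx t u)))
  = (fun h : R => h^-1 *: (((fun t' => f (row_mx t' u)) \o shift t) (h *: w) - f (row_mx t u))).
  by apply/funext => h /=; rewrite scale_row_mx add_row_mx scaler0 add0r.
by [].
Qed.

Lemma derive_row_mx0 n N M (g : 'rV[R]_M -> 'rV[R]_N) u w : differentiable g u ->
  'D_w (fun u' => row_mx (0 : 'rV[R]_n) (g u')) u = row_mx 0 ('D_w g u).
Proof.
move=> dg.
have dr i : differentiable (fun q => (row_mx (0 : 'rV[R]_n) (g q)) 0 i) u.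
  case: (split_ordP i) => l ->.
    by under eq_fun do rewrite row_mxEl mxE; exact: differentiable_cst.
  under eq_fun do rewrite row_mxEr.
  apply: (@differentiable_comp _ _ _ _ g (fun q : 'rV[R]_N => q 0 l)) => //.
  exact: differentiable_coord.
rewrite derive_row; last exact: differentiable_row.
apply/rowP => i; rewrite mxE; case: (split_ordP i) => l ->.
  rewrite row_mxEl mxE; under eq_fun do rewrite row_mxEl mxE; exact: derive_cst.
by rewrite row_mxEr; under eq_fun do rewrite row_mxEr; rewrite derive_row // mxE.
Qed.

End partial_directions.

Section linear_flow.
Context {R : realType} (n N : nat) (A : 'rV[R]_N -> 'M[R]_(n, N)).
Context (O : set 'rV[R]_N) (Oo : open O).
Hypothesis CA : forall k i j, Ck k O (fun u => A u i j).

(* The flow of [sum_i t_i H_i], where the [H_i] are the rows of [A], with [t] kept as a parameter. *)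
Definition lin_field (z : 'rV[R]_(n + N)) : 'rV[R]_(n + N) :=
  row_mx 0 (lsubmx z *m A (rsubmx z)).

Let O' : set 'rV[R]_(n + N) := rsubmx @^-1` O.

Lemma rsub_open : open O'.
Proof. by apply: open_comp Oo => z _; exact: continuous_rsubmx. Qed.

Lemma Ck_rsub k (f : 'rV[R]_N -> R) : Ck k O f ->
  Ck k O' (fun z : 'rV[R]_(n + N) => f (rsubmx z)).
Proof.
move=> Cf; apply: (@Ck_comp _ _ _ _ _ O (fun z : 'rV[R]_(n + N) => rsubmx z)) => //.
  exact: rsub_open.
move=> i; apply: (@Ck_eq _ _ _ _ (fun q => q 0 (rshift n i))) => // [|p _|].
- exact: rsub_open.
- by rewrite mxE.
exact: Ck_coord.
Qed.

Lemma lin_field_Cv k : Cv k O' lin_field.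
Proof.
have O'o := rsub_open.
move=> i; case: (split_ordP i) => l ->.
  apply: (@Ck_eq _ _ _ _ (fun=> 0)) => // [p _|]; first by rewrite row_mxEl mxE.
  exact: Ck_cst.
apply: (@Ck_eq _ _ _ _ (fun z => \sum_m z 0 (lshift N m) * A (rsubmx z) m l)) => //.
  by move=> p _; rewrite row_mxEr mxE; apply: eq_bigr => m _; rewrite !mxE.
apply: (@Ck_sum _ _ _ O'o) => m; apply: CkM => //; first exact: Ck_coord.
exact: (@Ck_rsub _ (fun u => A u m l)).
Qed.

Lemma lin_traj (t : R) k z : lsubmx (iter k (step lin_field t) z) = lsubmx z.
Proof.
elim: k => // k IH; rewrite iterS {1}/step linearD linearZ /= /lin_field row_mxKl.
by rewrite scaler0 addr0.
Qed.

(** The field is linear in the parameter, so a small parameter means slow motion: a polygon starts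
    within [r / 2] of [x0] and moves by at most [n%:R * K * d <= r / 2] up to time one. *)
Lemma lin_field_good x0 : O x0 -> exists2 d : R, 0 < d & exists c r,
  good lin_field O' [set z | `|lsubmx z| < d /\ `|rsubmx z - x0| < d] c r.
Proof.
move=> Ox0; have [rr rr0 hrr] := open_radius Oo Ox0.
have [r r0 hr] : exists2 r : R, 0 < r & forall x, `|x - x0| <= r -> O x.
  exists (rr / 2); first by rewrite divr_gt0.
  move=> x hx; apply: hrr; apply: le_lt_trans hx _.
  by rewrite ltr_pdivrMr // ltr_pMr // ltr1n.
have bO : box x0 (const_mx r) `<=` O.
  move=> x bx; apply: hr; apply: rV_norm_le; first exact: ltW.
  by move=> j; have := bx j; rewrite !mxE.
have [i|i K K' KK h j x bx|K K0 hK] := @finite_bound R n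
    (fun i K => forall j x, box x0 (const_mx r) x -> `|A x i j| <= K).
- have [j|j K K' KK h x bx|K K0 hK] := @finite_bound R N
    (fun j K => forall x, box x0 (const_mx r) x -> `|A x i j| <= K).
  + by apply: box_bounded => p bp; exact: (Ck_continuous (CA 0 i j) (bO _ bp)).
  + exact: le_trans (h _ bx) KK.
  by exists K.
- exact: le_trans (h _ _ bx) KK.
have bd (t : 'rV[R]_n) x : box x0 (const_mx r) x -> `|t *m A x| <= n%:R * K * `|t|.
  move=> bx; apply: rV_norm_le => [|j]; first by rewrite !mulr_ge0.
  rewrite mxE; apply: le_trans (ler_norm_sum _ _ _) _.
  rewrite -mulrA mulr_natl -[X in _ *+ X]card_ord -sumr_const; apply: ler_sum => i _.
  by rewrite normrM mulrC ler_pM //; [exact: hK|exact: coord_le_norm].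
have nK0 : 0 <= n%:R * K by rewrite mulr_ge0.
have [d d0 [d1 d2 d3]] : exists2 d : R, 0 < d & [/\ d <= 1, d <= r / 2 & n%:R * K * d <= r / 2].
  have r2 : 0 < r / 2 by rewrite divr_gt0.
  have nK1 : 0 < n%:R * K + 1 by rewrite ltr_wpDl.
  exists (Num.min 1 (Num.min (r / 2) (r / 2 / (n%:R * K + 1)))).
    by rewrite !lt_min ltr01 r2 divr_gt0.
  split; rewrite ?ge_min ?lexx ?orbT //.
  apply: (@le_trans _ _ (n%:R * K * (r / 2 / (n%:R * K + 1)))).
    by apply: ler_wpM2l => //; rewrite !ge_min lexx !orbT.
  rewrite mulrA ler_pdivrMr // mulrC; apply: ler_wpM2l; first exact: ltW.
  by rewrite lerDl.
exists d => //; exists (row_mx 0 x0), (row_mx (const_mx 1) (const_mx r)); split.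
- exact: rsub_open.
- exact: lin_field_Cv.
- move=> z bz; apply: bO => i; have := bz (rshift n i).
  by rewrite !row_mxEr [X in `|X - _|](_ : _ = rsubmx z 0 i) // mxE.
- rewrite (_ : [set z | _] = (fun z : 'rV[R]_(n + N) => `|lsubmx z|) @^-1` [set t : R | t < d]
     `&` (fun z : 'rV[R]_(n + N) => `|rsubmx z - x0|) @^-1` [set t : R | t < d]) //.
  apply: openI; apply: open_comp => [z _|]; try exact: open_lt.
    apply: (@continuous_comp _ _ _ (@lsubmx R 1 n N) (fun x : 'rV[R]_n => `|x|) z).
      exact: continuous_lsubmx.
    exact: norm_continuous.
  apply: (@continuous_comp _ _ _ (fun z => @rsubmx R 1 n N z - x0) (fun x : 'rV[R]_N => `|x|) z).
    apply: (@continuousB _ _ _ _ (fun _ => x0)); last exact: cst_continuous.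
    exact: continuous_rsubmx.
  exact: norm_continuous.
move=> z j k [hl hz] kj.
have key m : (m <= k)%N -> `|rsubmx (iter m (step lin_field (mesh j)) z) - rsubmx z|
    <= m%:R * mesh j * (n%:R * K * d)
    /\ `|rsubmx (iter m (step lin_field (mesh j)) z) - x0| <= r.
  have m0 : 0 <= mesh j :> R := mesh_ge0 j.
  have close v l : (l <= k)%N -> `|v - rsubmx z| <= l%:R * mesh j * (n%:R * K * d) -> `|v - x0| <= r.
    move=> lk hv; rewrite (splitr r) -(subrK (rsubmx z) v) -addrA.
    apply: le_trans (ler_normD _ _) _; apply: lerD; last exact: (le_trans (ltW hz) d2).
    apply: le_trans hv _; apply: le_trans d3; rewrite -[leRHS]mul1r; apply: ler_wpM2r.
      by rewrite mulr_ge0 // ltW.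
    by apply: mesh_natr_le; exact: leq_trans lk kj.
  elim: m => [|m IH] mk.
    by have h : `|rsubmx z - rsubmx z| <= 0%:R * mesh j * (n%:R * K * d);
      [rewrite subrr normr0 !mul0r|split=> //; exact: close h].
  have [h1 h2] := IH (ltnW mk).
  have h3 : `|rsubmx (iter m.+1 (step lin_field (mesh j)) z) - rsubmx z|
    <= m.+1%:R * mesh j * (n%:R * K * d).
    rewrite iterS {1}/step linearD linearZ /= {2}/lin_field row_mxKr lin_traj.
    rewrite addrAC; apply: le_trans (ler_normD _ _) _.
    rewrite -natr1 mulrDl mul1r mulrDl; apply: lerD => //.
    rewrite normrZ (ger0_norm m0); apply: ler_wpM2l => //.
    apply: le_trans (bd _ _ _) _; last by apply: ler_wpM2l => //; exact: ltW.
    move=> i; rewrite [leRHS]mxE; apply: le_trans h2.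
    by have := coord_le_norm (rsubmx (iter m (step lin_field (mesh j)) z) - x0) 0 i; rewrite !mxE.
  by split=> //; exact: close h3.
have [_ h] := key k (leqnn _).
move=> i; case: (split_ordP i) => l ->.
  rewrite !row_mxEl !mxE subr0.
  have -> : iter k (step lin_field (mesh j)) z 0 (lshift N l) = lsubmx z 0 l.
    by rewrite -(lin_traj (mesh j) k z) mxE.
  apply: le_trans (coord_le_norm _ _ _) _; exact: (le_trans (ltW hl) d1).
rewrite !row_mxEr [leRHS]mxE; apply: le_trans h.
have := coord_le_norm (rsubmx (iter k (step lin_field (mesh j)) z) - x0) 0 l.
by rewrite !mxE.
Qed.

(** Here [phi (row_mx t u)] is the time-one flow of [t *m A] from [u]. The last two clauses have one
    application each: commuting rows give straightening coordinates, and fields along which a map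
    [F] moves with constant velocity give a right inverse of [F]. *)
Lemma lin_flow x0 : O x0 -> exists2 d : R, 0 < d & exists phi : 'rV[R]_(n + N) -> 'rV[R]_N,
  let U := [set z | `|lsubmx z| < d /\ `|rsubmx z - x0| < d] in
  [/\ open U, forall k, Cv k U phi,
      (forall u, `|u - x0| < d -> phi (row_mx 0 u) = u) /\ (forall z, U z -> O (phi z)),
      (forall u s t, O u -> 'D_(s *m A u) (fun v => t *m A v) u = 'D_(t *m A u) (fun v => s *m A v) u) ->
        forall t u w, U (row_mx t u) ->
          'D_(row_mx w 0) phi (row_mx t u) = w *m A (phi (row_mx t u)) &
      forall K (F : 'rV[R]_N -> 'rV[R]_K) (B : 'M[R]_(n, K)), (forall k, Cv k O F) ->
        (forall u t, O u -> 'D_(t *m A u) F u = t *m B) ->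
        forall t u, U (row_mx t u) -> F (phi (row_mx t u)) = F u + t *m B].
Proof.
move=> Ox0; have [d d0 [c [r gX]]] := lin_field_good Ox0.
exists d => //; have [Phi fX] := good_flow gX; exists (fun z => rsubmx (Phi z)) => U.
have Uo : open U by exact: (good_start gX).
have CPhi k : Cv k U Phi := flow_smooth k gX fX.
have O'o := rsub_open.
have inO z j k : U z -> (k <= 2 ^ j)%N -> O' (iter k (step lin_field (mesh j)) z).
  by move=> Uz kj; apply: (@good_box _ _ _ _ _ _ _ gX); exact: (good_stay gX).
split=> //.
- move=> k i; apply: (@Ck_eq _ _ _ _ (fun q => Phi q 0 (rshift n i))) => // [p _|].
    by rewrite mxE.
  exact: CPhi.
- split=> [u hu|z Uz]; last first.
    by apply: (@good_box _ _ _ _ _ _ _ gX); exact: (flow_in_box gX fX).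
  have Uu : U (row_mx 0 u) by rewrite /U /= row_mxKl row_mxKr normr0.
  rewrite (@flow_integral _ _ _ _ _ _ _ _ gX fX _ rsubmx 0 (row_mx 0 u)) //.
  + by rewrite row_mxKr addr0.
  + move=> k i; apply: (@Ck_eq _ _ _ _ (fun q => q 0 (rshift n i))) => // [p _|].
      by rewrite mxE.
    exact: Ck_coord.
  + by move=> j k kj; rewrite /= /lin_field lin_traj row_mxKl mul0mx row_mx0 derive0.
- move=> hA t u w Uz.
  (* Moving the parameter in direction [w] changes the field by [w *m A]; commutativity of the rows
     is what [flow_derive_commuting] asks of this variation. *)
  pose Y (z : 'rV[R]_(n + N)) := row_mx (0 : 'rV[R]_n) (w *m A (rsubmx z)).
  have CwA s : forall k, Cv k O (fun v => s *m A v).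
    move=> k i; apply: (@Ck_eq _ _ _ _ (fun q => \sum_m s 0 m * A q m i)) => // [p _|].
      by rewrite mxE.
    by apply: (@Ck_sum _ _ _ Oo) => m; apply: CkM => //; exact: Ck_cst.
  have CY k : Cv k O' Y.
    move=> i; case: (split_ordP i) => l ->.
      apply: (@Ck_eq _ _ _ _ (fun=> 0)) => // [p _|]; first by rewrite row_mxEl mxE.
      exact: Ck_cst.
    apply: (@Ck_eq _ _ _ _ (fun z => (w *m A (rsubmx z)) 0 l)) => // [p _|].
      by rewrite row_mxEr.
    exact: (@Ck_rsub _ (fun v => (w *m A v) 0 l) (CwA w k l)).
  have -> : 'D_(row_mx w 0) (fun z => rsubmx (Phi z)) (row_mx t u)
     = rsubmx ('D_(row_mx w 0) Phi (row_mx t u)).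
    have dP : differentiable Phi (row_mx t u) by exact: (Cv_differentiable Uo (CPhi 1) Uz).
    rewrite derive_row; last first.
      by apply: (@differentiable_comp _ _ _ _ Phi rsubmx) => //; exact: differentiable_rsubmx.
    rewrite derive_row //; apply/rowP => i; rewrite !mxE.
    by under eq_fun do rewrite mxE.
  have hD := flow_derive_commuting gX fX (z := row_mx w 0) CY Uz.
  rewrite hD; first by rewrite linearD /= !row_mxKr add0r.
  move=> j k kj /=; have := inO _ _ _ Uz kj.
  move: (iter k _ _) => z.
  have [s [v ->]] : exists s v, z = row_mx s v by exists (lsubmx z), (rsubmx z); rewrite hsubmxK.
  rewrite /O' /= row_mxKr => Ov; split.
    rewrite derive_ldir; apply: derive_affine => a.
    rewrite /lin_field /Y !row_mxKl !row_mxKr scale_row_mx add_row_mx scaler0 addr0.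
    by rewrite mulmxDl -scalemxAl addrC.
  rewrite {1}/Y row_mxKr derive_rdir.
  under eq_fun do rewrite /lin_field row_mxKl row_mxKr.
  rewrite derive_row_mx0; last exact: (Cv_differentiable Oo (CwA s 1) Ov).
  rewrite /lin_field row_mxKl row_mxKr derive_rdir.
  under [in RHS]eq_fun do rewrite /Y row_mxKr.
  rewrite derive_row_mx0; last exact: (Cv_differentiable Oo (CwA w 1) Ov).
  by rewrite hA.
- move=> K F B CF hF t u Uz.
  have h := @flow_integral _ _ _ _ _ _ _ _ gX fX _ (fun z => F (rsubmx z)) (t *m B) (row_mx t u).
  rewrite h ?row_mxKr //.
    by move=> k i; exact: (@Ck_rsub _ (fun v => F v 0 i) (CF k i)).
  move=> j k kj /=; have := inO _ _ _ Uz kj; have := lin_traj (mesh j) k (row_mx t u).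
  move: (iter k _ _) => z.
  have [s [v ->]] : exists s v, z = row_mx s v by exists (lsubmx z), (rsubmx z); rewrite hsubmxK.
  rewrite /O' /= row_mxKr !row_mxKl => -> Ov.
  rewrite /lin_field row_mxKl row_mxKr derive_rdir.
  by under eq_fun do rewrite row_mxKr; rewrite hF.
Qed.

End linear_flow.

(** * Straightening commuting vector fields *)

Section matrix_valued.
Context {R : realType} (N : nat) (U : set 'rV[R]_N) (Uo : open U).

Lemma Ck_det k m (A : 'rV[R]_N -> 'M[R]_m) :
  (forall i j, Ck k U (fun u => A u i j)) -> Ck k U (fun u => \det (A u)).
Proof.
move=> CA; rewrite /determinant; apply: (@Ck_sum _ _ _ Uo) => s.
by apply: CkM => //; [exact: Ck_cst|exact: (@Ck_prod _ _ _ Uo)].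
Qed.

Lemma Ck_mulmx k m p q (A : 'rV[R]_N -> 'M[R]_(m, p)) (B : 'rV[R]_N -> 'M[R]_(p, q)) :
  (forall i j, Ck k U (fun u => A u i j)) -> (forall i j, Ck k U (fun u => B u i j)) ->
  forall i j, Ck k U (fun u => (A u *m B u) i j).
Proof.
move=> CA CB i j.
apply: (@Ck_eq _ _ _ _ (fun u => \sum_l A u i l * B u l j)) => // [u _|]; first by rewrite mxE.
by apply: (@Ck_sum _ _ _ Uo) => l; apply: CkM.
Qed.

Lemma Ck_invmx k m (A : 'rV[R]_N -> 'M[R]_m) :
  (forall u, U u -> \det (A u) != 0) ->
  (forall i j, Ck k U (fun u => A u i j)) ->
  forall i j, Ck k U (fun u => invmx (A u) i j).
Proof.
move=> d0 CA i j.
apply: (@Ck_eq _ _ _ _ (fun u => (\det (A u))^-1 *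
    ((-1) ^+ (j + i) * \det (row' j (col' i (A u)))))) => // [u Uu|].
  by rewrite /invmx unitmxE unitfE d0 // !mxE.
apply: CkM => //; first by apply: CkV => //; exact: Ck_det.
apply: CkM => //; first exact: Ck_cst.
apply: Ck_det => a b.
apply: (@Ck_eq _ _ _ _ (fun u => A u (lift j a) (lift i b))) => // u _; by rewrite !mxE.
Qed.

Lemma open_nonzero (g : 'rV[R]_N -> R) :
  (forall p, U p -> {for p, continuous g}) -> open [set p | U p /\ g p != 0].
Proof.
move=> cg; rewrite openE => p [Up gp].
have g0 : 0 < `|g p| / 2 by rewrite divr_gt0 // normr_gt0.
have [d1 d10 h1] := open_radius Uo Up.
have /continuous_radius/(_ _ g0)[d2 d20 h2] := cg p Up.
apply/nbhs_ballP; exists (Num.min d1 d2); first by rewrite /= lt_min d10 d20.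
move=> x; rewrite -ball_normE /= distrC lt_min => /andP[/h1 Ux /h2 hx]; split=> //.
apply: contraTN hx => /eqP ->; rewrite subr0 -ltNge ltr_pdivrMr //.
by rewrite ltr_pMr ?normr_gt0 // ltr1n.
Qed.

Lemma jacobianE M (F : 'rV[R]_N -> 'rV[R]_M) u j i : differentiable F u ->
  'J F u j i = pd j (fun q => F q 0 i) u.
Proof.
move=> dF; have := deriveEjacobian (delta_mx 0 j) dF.
rewrite derive_row // -rowE => /rowP/(_ i); by rewrite !mxE => <-.
Qed.

Lemma Ck_jacobian k M (F : 'rV[R]_N -> 'rV[R]_M) : (forall k, Cv k U F) ->
  forall j i, Ck k U (fun u => 'J F u j i).
Proof.
move=> CF j i.
apply: (@Ck_eq _ _ _ _ (pd j (fun q => F q 0 i))) => // [u Uu|].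
  by rewrite jacobianE //; exact: (Cv_differentiable Uo (CF 1) Uu).
by apply: Ck_pd; exact: CF.
Qed.

End matrix_valued.

(** * The inverse function theorem *)

Section inverse_function.
Context {R : realType} (N : nat).
Implicit Types (F G : 'rV[R]_N -> 'rV[R]_N) (U V O : set 'rV[R]_N).

(** Along the flow of [t *m invmx ('J F u)] the value of [F] moves with constant velocity [t].
    Starting at [x0] with [t = z - F x0], it reaches [z] at time one. *)
Lemma local_right_inverse F O x0 : open O -> O x0 -> (forall k, Cv k O F) ->
  'J F x0 \in unitmx ->
  exists V G, [/\ open V, V (F x0), forall k, Cv k V G,
     forall z, V z -> O (G z) /\ F (G z) = z & G (F x0) = x0].
Proof.
move=> Oo Ox0 CF Ju.
pose O1 := [set p | O p /\ \det ('J F p) != 0].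
have cd p : O p -> {for p, continuous (fun p => \det ('J F p))}.
  move=> Op; apply: (Ck_continuous (U := O) (k := 0)) => //.
  by apply: Ck_det => // i j; exact: Ck_jacobian.
have O1o : open O1 by exact: open_nonzero.
have O1O : O1 `<=` O by move=> p [].
have O1x : O1 x0 by split=> //; rewrite -unitfE -unitmxE.
have CA k i j : Ck k O1 (fun u => invmx ('J F u) i j).
  apply: Ck_invmx => // [u []//|a b].
  by apply: (Ck_sub O1O); exact: Ck_jacobian.
have [d d0 [phi [Uo Cphi [phi0 Ophi] _ hF]]] := lin_flow O1o CA O1x.
pose V := [set z : 'rV[R]_N | `|z - F x0| < d].
have Vo : open V.
  rewrite (_ : V = ball (F x0) d); first exact: ball_open.
  by apply/seteqP; split=> z; rewrite -ball_normE /V /= distrC.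
exists V, (fun z => phi (row_mx (z - F x0) x0)).
have inU z : V z -> `|lsubmx (row_mx (z - F x0) x0)| < d /\ `|rsubmx (row_mx (z - F x0) x0) - x0| < d.
  by move=> Vz; rewrite row_mxKl row_mxKr subrr normr0.
split=> //.
- by rewrite /V /= subrr normr0.
- move=> k; apply: (@Cv_comp _ _ _ _ _ V _ (fun z => row_mx (z - F x0) x0) phi Vo Uo inU _ (Cphi k)).
  move=> i; case: (split_ordP i) => l ->.
    apply: (@Ck_eq _ _ _ _ (fun z => z 0 l - F x0 0 l)) => // [z _|].
      by rewrite row_mxEl !mxE.
    by apply: CkB => //; [exact: Ck_coord|exact: Ck_cst].
  apply: (@Ck_eq _ _ _ _ (fun z => x0 0 l)) => // [z _|]; first by rewrite row_mxEr.
  exact: Ck_cst.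
- move=> z Vz; split; first exact/O1O/Ophi/inU.
  rewrite (hF _ F 1%:M) ?mulmx1; first by rewrite addrC subrK.
  + by move=> k i; apply: (Ck_sub O1O); exact: CF.
  + move=> u t [Ou du]; have dF := Cv_differentiable Oo (CF 1) Ou.
    have Jun : 'J F u \in unitmx by rewrite unitmxE unitfE.
    by rewrite (deriveEjacobian _ dF) -mulmxA (mulVmx Jun).
  + exact: inU.
- by rewrite subrr phi0 // subrr normr0.
Qed.

(** The right inverse [G] of [F] has in turn a right inverse [K]. Where both are defined,
    [K x = F (G (K x)) = F x], so [G] is also a left inverse of [F]. *)
Lemma local_inverse F O x0 : open O -> O x0 -> (forall k, Cv k O F) ->
  'J F x0 \in unitmx ->
  exists2 e : R, 0 < e & exists U G, let U' := [set x | `|x - x0| < e] in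
    [/\ open U, U' `<=` O, forall k, Cv k U G,
      forall x, U' x -> U (F x) /\ G (F x) = x &
      forall z, U z -> U' (G z) /\ F (G z) = z].
Proof.
move=> Oo Ox0 CF Ju.
have [V [G [Vo VF CG hG G0]]] := local_right_inverse Oo Ox0 CF Ju.
have dF : differentiable F x0 by exact: (Cv_differentiable Oo (CF 1) Ox0).
have dG : differentiable G (F x0) by exact: (Cv_differentiable Vo (CG 1) VF).
have JG : 'J G (F x0) \in unitmx.
  suff JGF : 'J G (F x0) *m 'J F x0 = 1%:M by exact: (proj1 (mulmx1_unit JGF)).
  apply/row_matrixP => i; rewrite !rowE mulmx1 mulmxA.
  rewrite -(deriveEjacobian _ dG) -(deriveEjacobian _ dF).
  have dFG : differentiable F (G (F x0)) by rewrite G0.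
  have := derive_comp (delta_mx 0 i) dG dFG; rewrite G0 => <-.
  rewrite (@near_eq_derive _ _ _ (F \o G) id); first exact: derive_id.
  apply: filterS (open_nbhs_nbhs (conj Vo VF)) => z Vz /=.
  by have [] := hG z Vz.
have [W [K [Wo WF CK hK K0]]] := local_right_inverse Vo VF CG JG.
rewrite G0 in WF.
have hW x : W x -> [/\ O x, V (F x) & G (F x) = x].
  move=> Wx; have [VK GK] := hK x Wx.
  have [OG FG] := hG _ VK; rewrite GK in OG FG.
  by rewrite FG.
have [e e0 he] := open_radius Wo WF.
exists e => //; pose U := V `&` G @^-1` [set x | `|x - x0| < e].
have Bo : open [set x : 'rV[R]_N | `|x - x0| < e].
  rewrite (_ : [set x | _] = ball x0 e); first exact: ball_open.
  by apply/seteqP; split=> z; rewrite -ball_normE /= distrC.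
have Uo : open U.
  rewrite openE => z [Vz Gz].
  have cG : {for z, continuous G}.
    exact: (differentiable_continuous (Cv_differentiable Vo (CG 1) Vz)).
  have h1 : nbhs z V by exact: (open_nbhs_nbhs (conj Vo Vz)).
  have h2 : nbhs z (G @^-1` [set x | `|x - x0| < e]).
    by apply: cG; exact: (open_nbhs_nbhs (conj Bo Gz)).
  exact: (@filterI _ (nbhs z) _ _ _ h1 h2).
exists U, G => U'; split=> //.
- by move=> x U'x; have [] := hW _ (he _ U'x).
- by move=> k i; apply: (Ck_sub _ (CG k i)) => z [].
- move=> x U'x; have [Ox Vx Gx] := hW _ (he _ U'x).
  by split=> //; split=> //; rewrite /preimage /= Gx.
- by move=> z [Vz Gz]; have [_ FG] := hG _ Vz; split.
Qed.

End inverse_function.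

Section completion.
Context {R : realType} (n N : nat) (A : 'M[R]_(n, N)).

(** Its first [n] rows vanish; the others extend the rows of [A] to a basis when these are
    independent, as the last rows of [row_ebase A] span a complement of the row space. *)
Definition completion : 'M[R]_N := copid_mx n *m row_ebase A.

(** Once [row_ebase A] is split off, a block-diagonal matrix remains, with blocks [col_ebase A] and
    the identity; its inverse is written down explicitly. *)
Lemma completion_unit : (n <= N)%N -> \rank A = n ->
  (pid_mx n : 'M[R]_(N, n)) *m A + completion \in unitmx.
Proof.
move=> nN rA; rewrite -[A in X in X + _]mulmx_ebase rA /completion !mulmxA -mulmxDl.
rewrite unitmx_mul row_ebase_unit andbT.
set c := col_ebase A; have cu : c \in unitmx by exact: col_ebase_unit.
have e1 (X : 'M[R]_(N, n)) : X *m (pid_mx n : 'M[R]_(n, N)) *m (pid_mx n : 'M[R]_(N, n)) = X.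
  by rewrite -mulmxA pid_mx_id // pid_mx_1 mulmx1.
suff h : ((pid_mx n : 'M[R]_(N, n)) *m c *m (pid_mx n : 'M[R]_(n, N)) + copid_mx n) *m
   ((pid_mx n : 'M[R]_(N, n)) *m invmx c *m (pid_mx n : 'M[R]_(n, N)) + copid_mx n) = 1%:M.
  exact: (proj1 (mulmx1_unit h)).
have key (X Y Q : 'M[R]_N) : (X + Q) *m (Y + Q) = X *m Y + X *m Q + (Q *m Y + Q *m Q).
  by rewrite mulmxDl !mulmxDr.
rewrite key !mulmxA e1 -[_ *m c *m invmx c]mulmxA mulmxV // mulmx1 pid_mx_id //.
rewrite mul_copid_mx_pid // !mul0mx add0r copid_mx_id //.
rewrite -[_ *m copid_mx n]mulmxA mul_pid_mx_copid // mulmx0 addr0.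
by rewrite /copid_mx addrC subrK.
Qed.

Lemma delta_pid (nN : (n <= N)%N) i :
  (delta_mx 0 (widen_ord nN i) : 'rV[R]_N) *m (pid_mx n : 'M[R]_(N, n)) = delta_mx 0 i.
Proof.
apply/rowP => j; rewrite -rowE !mxE /= ltn_ord andbT.
by rewrite (inj_eq val_inj) eq_sym.
Qed.

Lemma delta_completion (nN : (n <= N)%N) i :
  (delta_mx 0 (widen_ord nN i) : 'rV[R]_N) *m completion = 0.
Proof.
rewrite /completion mulmxA -rowE (_ : row _ _ = 0) ?mul0mx //.
apply/rowP => j; rewrite !mxE -val_eqE /= ltn_ord andbT.
by rewrite subrr.
Qed.

End completion.

Section straightening.
Context {R : realType} (n N : nat).

Lemma smooth_onP M K (U : set 'rV[R]_M) (F : 'rV[R]_M -> 'rV[R]_K) : open U ->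
  smooth_on U F <-> forall k, Cv k U F.
Proof. by move=> Uo; split=> h k; apply/(Ck_onP _ _ Uo); exact: h. Qed.

Lemma Cv_lin M K (U : set 'rV[R]_M) (B : 'M[R]_(M, K)) (b : 'rV[R]_K) k : open U ->
  Cv k U (fun y => b + y *m B).
Proof.
move=> Uo i; apply: (@Ck_eq _ _ _ _ (fun y => b 0 i + \sum_m y 0 m * B m i)) => // [y _|].
  by rewrite !mxE.
apply: CkD => //; first exact: Ck_cst.
by apply: (@Ck_sum _ _ _ Uo) => m; apply: CkM => //; [exact: Ck_coord|exact: Ck_cst].
Qed.

Lemma derive_lin M K (B : 'M[R]_(M, K)) (b : 'rV[R]_K) y v :
  'D_v (fun y => b + y *m B) y = v *m B.
Proof.
apply: derive_affine => s; by rewrite mulmxDl -scalemxAl [s *: _ + _]addrC addrA.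
Qed.

Lemma Cv_row_mx M K K' (U : set 'rV[R]_M) (F : 'rV[R]_M -> 'rV[R]_K)
    (G : 'rV[R]_M -> 'rV[R]_K') k : open U -> Cv k U F -> Cv k U G ->
  Cv k U (fun y => row_mx (F y) (G y)).
Proof.
move=> Uo CF CG i; case: (split_ordP i) => l ->.
  by apply: (@Ck_eq _ _ _ _ (fun y => F y 0 l)) => // y _; rewrite row_mxEl.
by apply: (@Ck_eq _ _ _ _ (fun y => G y 0 l)) => // y _; rewrite row_mxEr.
Qed.

Lemma derive_row_mx M K K' (F : 'rV[R]_M -> 'rV[R]_K) (G : 'rV[R]_M -> 'rV[R]_K') y v :
  differentiable F y -> differentiable G y ->
  differentiable (fun y => row_mx (F y) (G y)) y /\
  'D_v (fun y => row_mx (F y) (G y)) y = row_mx ('D_v F y) ('D_v G y).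
Proof.
move=> dF dG.
have d : differentiable (fun y => row_mx (F y) (G y)) y.
  apply: differentiable_row => i; case: (split_ordP i) => l ->.
    under eq_fun do rewrite row_mxEl.
    apply: (@differentiable_comp _ _ _ _ F (fun x : 'rV[R]_K => x 0 l)) => //.
    exact: differentiable_coord.
  under eq_fun do rewrite row_mxEr.
  apply: (@differentiable_comp _ _ _ _ G (fun x : 'rV[R]_K' => x 0 l)) => //.
  exact: differentiable_coord.
split=> //; rewrite derive_row //; apply/rowP => i; rewrite mxE.
case: (split_ordP i) => l ->.
  by rewrite row_mxEl derive_row // mxE; under eq_fun do rewrite row_mxEl.
by rewrite row_mxEr derive_row // mxE; under eq_fun do rewrite row_mxEr.
Qed.

(** The point [psi y] is reached from [p + y *m B], on a transversal, by flowing for time one along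
    the combination of the [H i] with the first [n] entries of [y] as coefficients. As the fields
    commute, the partial derivatives of [psi] in these entries are the [H i]. At 0 the Jacobian is
    the matrix of [completion_unit]. *)
Lemma straighten (nN : (n <= N)%N) (H : 'I_n -> vfield R N) p :
  (forall i, smooth_on setT (H i)) ->
  (forall i j u, lie_bracket (H i) (H j) u = 0) ->
  \rank (\matrix_i H i p) = n ->
  exists2 e : R, 0 < e & exists U phi psi, let U' := [set y | `|y| < e] in
    [/\ U p, local_coordinates U U' phi psi &
      forall y i, U' y -> 'D_(delta_mx 0 (widen_ord nN i)) psi y = H i (psi y)].
Proof.
move=> sH cH rH.
have CH k i : Cv k setT (H i) by apply/Ck_onP; [exact: openT|exact: sH].
pose A u := \matrix_i H i u.
have CA k i j : Ck k setT (fun u => A u i j).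
  apply: (@Ck_eq _ _ _ _ (fun u => H i u 0 j)) => [|u _|]; [exact: openT|by rewrite mxE|exact: CH].
have AE (w : 'rV[R]_n) u : w *m A u = \sum_i w 0 i *: H i u.
  by rewrite mulmx_sum_row; apply: eq_bigr => i _; rewrite rowK.
have dH i u : differentiable (H i) u by exact: (Cv_differentiable openT (CH 1 i) I).
have DA (t : 'rV[R]_n) u x : 'D_x (fun v => t *m A v) u = \sum_i t 0 i *: (x *m 'J (H i) u).
  have -> : (fun v => t *m A v) = \sum_i (t 0 i *: H i).
    by apply/funext => v; rewrite AE fct_sumE.
  have dtH i : derivable (t 0 i *: H i) u x by apply: derivableZ; exact: diff_derivable.
  rewrite derive_sum //; apply: eq_bigr => i _.
  by rewrite deriveZ ?deriveEjacobian //; exact: diff_derivable.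
have hA u s t : setT u ->
    'D_(s *m A u) (fun v => t *m A v) u = 'D_(t *m A u) (fun v => s *m A v) u.
  move=> _; rewrite !DA !AE.
  under eq_bigr do rewrite mulmx_suml scaler_sumr.
  under [in RHS]eq_bigr do rewrite mulmx_suml scaler_sumr.
  rewrite exchange_big; apply: eq_bigr => i _; apply: eq_bigr => j _ /=.
  have e : H i u *m 'J (H j) u = H j u *m 'J (H i) u.
    apply/esym/subr0_eq; rewrite -!deriveEjacobian; [exact: (cH j i u)|exact: dH..].
  by rewrite -!scalemxAl e !scalerA mulrC.
have [d d0 [phi [Uo Cphi [phi0 _] hphi _]]] := lin_flow openT CA (I : setT p).
pose P : 'M[R]_(N, n) := pid_mx n; pose B := completion (A p).
pose iota (y : 'rV[R]_N) := row_mx (0 + y *m P) (p + y *m B).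
set V := [set z | _] in Uo Cphi hphi.
have Ci k (O : set 'rV[R]_N) : open O -> Cv k O iota.
  by move=> Oo; apply: Cv_row_mx => //; exact: Cv_lin.
have di y : differentiable iota y by exact: (Cv_differentiable openT (Ci 1 setT openT) I).
have Di y v : 'D_v iota y = row_mx (v *m P) (v *m B).
  have d1 M (b : 'rV[R]_M) (C : 'M[R]_(N, M)) z : differentiable (fun y => b + y *m C) z.
    exact: (Cv_differentiable openT (Cv_lin C b 1 openT) I).
  by rewrite (proj2 (derive_row_mx v (d1 _ _ P y) (d1 _ _ B y))) !derive_lin.
pose O := iota @^-1` V.
have Oo : open O.
  by apply: open_comp Uo => y _; exact: (differentiable_continuous (di y)).
pose psi y := phi (iota y).
have i0 : iota 0 = row_mx 0 p by rewrite /iota !mul0mx !addr0.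
have V0 : V (row_mx 0 p) by rewrite /V /= row_mxKl row_mxKr subrr !normr0.
have O0 : O 0 by rewrite /O /preimage /= i0.
have Cpsi k : Cv k O psi by apply: (@Cv_comp _ _ _ _ _ O V iota) => //; exact: Ci.
have dphi z : V z -> differentiable phi z by move=> Vz; exact: (Cv_differentiable Uo (Cphi 1) Vz).
have Dpsi y v : O y -> 'D_v psi y = 'D_(row_mx (v *m P) (v *m B)) phi (iota y).
  by move=> Oy; rewrite /psi -[fun y => _]/(phi \o iota) (derive_comp _ (di y) (dphi _ Oy)) Di.
have psi0 : psi 0 = p by rewrite /psi i0 phi0 // subrr normr0.
have Jpsi : 'J psi 0 = P *m A p + B.
  apply/row_matrixP => i; rewrite !rowE -deriveEjacobian; last first.
    exact: (Cv_differentiable Oo (Cpsi 1) O0).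
  move: (delta_mx 0 i) => v.
  rewrite (Dpsi _ _ O0) i0 mulmxDr.
  have -> : row_mx (v *m P) (v *m B) = row_mx (v *m P) 0 + row_mx 0 (v *m B).
    by rewrite add_row_mx addr0 add0r.
  rewrite deriveEjacobian ?mulmxDl; last exact: dphi.
  rewrite -!deriveEjacobian; try exact: dphi.
  rewrite (hphi hA) // phi0 ?subrr ?normr0 // -[v *m P *m _]mulmxA; congr (_ + _).
  rewrite derive_rdir (@near_eq_derive _ _ _ _ id); first exact: derive_id.
  apply/nbhs_ballP; exists d => // u; rewrite -ball_normE /= distrC; exact: phi0.
have Ju : 'J psi 0 \in unitmx by rewrite Jpsi; exact: completion_unit.
have [e e0 [U [G [Ugo U'O CG h1 h2]]]] := local_inverse Oo O0 Cpsi Ju.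
have e1 : [set y : 'rV[R]_N | `|y - 0| < e] = [set y | `|y| < e].
  by apply/funext => y; rewrite /= subr0.
rewrite e1 in U'O h1 h2.
exists e => //; exists U, G, psi => U'.
have U'o : open U'.
  rewrite (_ : U' = ball 0 e); first exact: ball_open.
  by apply/seteqP; split=> z; rewrite -ball_normE /U' /= distrC subr0.
split.
- by rewrite -psi0; apply: (proj1 (h1 _ _)); rewrite /= normr0.
- split=> //; first by apply/smooth_onP.
  by apply/smooth_onP => // k i; apply: (Ck_sub U'O); exact: Cpsi.
- move=> y i U'y; have Oy := U'O _ U'y.
  rewrite Dpsi // delta_pid delta_completion.
  have Viy : V (iota y) by exact: Oy.
  rewrite /iota (hphi hA) // -/(iota y) -rowE rowK //.
Qed.

End straightening.

(** * Lie brackets of smooth vector fields *)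

Section lie_derivative.
Context {R : realType} (N : nat).
Implicit Types (X Y Z : vfield R N) (f g : 'rV[R]_N -> R).

Definition lieD X f : 'rV[R]_N -> R := fun p => 'D_(X p) f p.

Lemma lie_bracketNC X Y : lie_bracket X Y = - lie_bracket Y X.
Proof. by apply/funext => p; rewrite /lie_bracket !fctE opprB. Qed.

Section on_open.
Context (U : set 'rV[R]_N) (Uo : open U).

Lemma lieDE X f p : Ck 1 U f -> U p -> lieD X f p = \sum_j X p 0 j * pd j f p.
Proof. by move=> Cf Up; rewrite /lieD (Ck_deriveE _ Uo Cf Up). Qed.

Lemma Ck_lieD X f : (forall k, Cv k U X) -> (forall k, Ck k U f) ->
  forall k, Ck k U (lieD X f).
Proof.
move=> CX Cf k; apply: (@Ck_eq _ _ _ _ (fun p => \sum_j X p 0 j * pd j f p)) => // [p Up|].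
  by rewrite (lieDE _ (Cf 1)).
by apply: (@Ck_sum _ _ _ Uo) => j; apply: CkM => //; [exact: CX|exact: Ck_pd].
Qed.

Lemma lie_bracket_coord X Y p i : (forall k, Cv k U X) -> (forall k, Cv k U Y) -> U p ->
  lie_bracket X Y p 0 i = lieD X (fun q => Y q 0 i) p - lieD Y (fun q => X q 0 i) p.
Proof.
move=> CX CY Up.
have dX : differentiable X p by exact: (Cv_differentiable Uo (CX 1) Up).
have dY : differentiable Y p by exact: (Cv_differentiable Uo (CY 1) Up).
by rewrite /lie_bracket /lieD [LHS]mxE [X in _ + X]mxE !derive_row // !mxE.
Qed.

Lemma Cv_lie_bracket X Y : (forall k, Cv k U X) -> (forall k, Cv k U Y) ->
  forall k, Cv k U (lie_bracket X Y).
Proof.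
move=> CX CY k i.
apply: (@Ck_eq _ _ _ _ (fun p => lieD X (fun q => Y q 0 i) p - lieD Y (fun q => X q 0 i) p)) => // [p Up|].
  by rewrite lie_bracket_coord.
by apply: CkB => //; apply: Ck_lieD => // k'; [exact: CY|exact: CX].
Qed.

(** The second-order part is kept apart: it is symmetric in [X] and [Y] by [pdC] and drops out of
    the commutator in [lieD_bracket]. *)
Lemma lieD_lieD X Y f p : (forall k, Cv k U X) -> (forall k, Cv k U Y) ->
  (forall k, Ck k U f) -> U p ->
  lieD X (lieD Y f) p =
    \sum_k lieD X (fun q => Y q 0 k) p * pd k f p +
    \sum_j \sum_k X p 0 j * (Y p 0 k * pd j (pd k f) p).
Proof.
move=> CX CY Cf Up; rewrite (lieDE _ (Ck_lieD CY Cf 1)) //.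
have dY k q : U q -> differentiable (fun q => Y q 0 k) q.
  by move=> Uq; exact: (Ck_differentiable Uo (CY 1 k) Uq).
have df k q : U q -> differentiable (pd k f) q.
  by move=> Uq; exact: (Ck_differentiable Uo (Ck_pd k (Cf 2)) Uq).
have e j : pd j (lieD Y f) p =
    \sum_k (pd j (fun q => Y q 0 k) p * pd k f p + Y p 0 k * pd j (pd k f) p).
  rewrite (@pd_eq _ _ U _ (fun q => \sum_k Y q 0 k * pd k f q)) //; last first.
    by move=> q Uq; rewrite (lieDE _ (Cf 1)).
  have -> : (fun q => \sum_k Y q 0 k * pd k f q) = \sum_k (fun q => Y q 0 k * pd k f q).
    by apply/funext => q; rewrite fct_sumE.
  rewrite /pd derive_sum => [|k].
    apply: eq_bigr => k _; exact: pdM (dY k p Up) (df k p Up).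
  by apply: diff_derivable; apply: differentiableM; [exact: dY|exact: df].
under eq_bigr do rewrite e mulr_sumr.
rewrite [X in X + _](_ : _ = \sum_k \sum_j X p 0 j * (pd j (fun q => Y q 0 k) p * pd k f p)).
  rewrite [X in _ = X + _]exchange_big -big_split; apply: eq_bigr => j _ /=.
  by rewrite -big_split; apply: eq_bigr => k _ /=; rewrite mulrDr.
apply: eq_bigr => k _; rewrite (lieDE _ (CY 1 k)) // mulr_suml.
by apply: eq_bigr => j _; rewrite mulrA.
Qed.

Lemma lieD_bracket X Y f p : (forall k, Cv k U X) -> (forall k, Cv k U Y) ->
  (forall k, Ck k U f) -> U p ->
  lieD (lie_bracket X Y) f p = lieD X (lieD Y f) p - lieD Y (lieD X f) p.
Proof.
move=> CX CY Cf Up; rewrite (lieD_lieD CX CY Cf Up) (lieD_lieD CY CX Cf Up).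
rewrite [X in _ = _ - (_ + X)]exchange_big /=.
rewrite [X in _ = _ - (_ + X)](_ : _ = \sum_j \sum_k X p 0 j * (Y p 0 k * pd j (pd k f) p)).
  rewrite opprD addrACA subrr addr0 -sumrB (lieDE _ (Cf 1)) //.
  by apply: eq_bigr => k _; rewrite lie_bracket_coord // mulrBl.
apply: eq_bigr => j _; apply: eq_bigr => k _.
by rewrite (@pdC _ _ U f k j p Uo (Cf 2) Up) mulrCA.
Qed.

Lemma lieD_eq X f g p : U p -> (forall q, U q -> f q = g q) -> lieD X f p = lieD X g p.
Proof.
by move=> Up fg; rewrite /lieD (near_eq_derive _ (near_eq_in_open Uo Up fg)).
Qed.

Lemma lieDB X f g p : (forall k, Ck k U f) -> (forall k, Ck k U g) -> U p ->
  lieD X (fun q => f q - g q) p = lieD X f p - lieD X g p.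
Proof.
move=> Cf Cg Up; rewrite /lieD -deriveB //; apply: diff_derivable.
  exact: (Ck_differentiable Uo (Cf 1) Up).
exact: (Ck_differentiable Uo (Cg 1) Up).
Qed.

(** On components, each double bracket becomes four twofold derivatives; the twelve terms of the
    cyclic sum cancel in pairs. *)
Lemma lie_bracket_jacobi X Y Z p :
  (forall k, Cv k U X) -> (forall k, Cv k U Y) -> (forall k, Cv k U Z) -> U p ->
  lie_bracket X (lie_bracket Y Z) p + lie_bracket Y (lie_bracket Z X) p
    + lie_bracket Z (lie_bracket X Y) p = 0.
Proof.
have key X' Y' Z' i : (forall k, Cv k U X') -> (forall k, Cv k U Y') -> (forall k, Cv k U Z') ->
    U p -> lie_bracket X' (lie_bracket Y' Z') p 0 i =
     (lieD X' (lieD Y' (fun q => Z' q 0 i)) p - lieD X' (lieD Z' (fun q => Y' q 0 i)) p) -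
     (lieD Y' (lieD Z' (fun q => X' q 0 i)) p - lieD Z' (lieD Y' (fun q => X' q 0 i)) p).
  move=> CX CY CZ Up; have CYZ := Cv_lie_bracket CY CZ.
  rewrite lie_bracket_coord // lieD_bracket //; last by move=> k; exact: CX.
  congr (_ - _).
  rewrite (@lieD_eq _ _ (fun q => lieD Y' (fun q => Z' q 0 i) q - lieD Z' (fun q => Y' q 0 i) q)) //.
    by rewrite lieDB //; apply: Ck_lieD => // k; [exact: CZ|exact: CY].
  by move=> q Uq; rewrite lie_bracket_coord.
move=> CX CY CZ Up; apply/rowP => i.
rewrite [LHS]mxE [X in X + _]mxE [RHS]mxE.
have gen (a b c d e f u v w : R) : u = a - b - (c - d) -> v = c - e - (f - b) ->
  w = f - d - (a - e) -> u + v + w = 0 by move=> -> -> ->; ring.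
exact: (gen _ _ _ _ _ _ _ _ _ (key X Y Z i CX CY CZ Up) (key Y Z X i CY CZ CX Up)
  (key Z X Y i CZ CX CY Up)).
Qed.

End on_open.
End lie_derivative.

Section vector_fields.
Context {R : realType} (N : nat).
Implicit Types (X Y Z : vfield R N).

Definition smooth_field X := forall k, Cv k setT X.

Lemma smooth_fieldP X : vector_field_on setT X <-> smooth_field X.
Proof.
split=> [[/smooth_onP h _]|h]; first by apply: h; exact: openT.
by split=> [|p []//]; apply/smooth_onP => //; exact: openT.
Qed.

Lemma smooth_differentiable X p : smooth_field X -> differentiable X p.
Proof. by move=> sX; exact: (Cv_differentiable openT (sX 1) I). Qed.

Lemma smooth_lin a X Y : smooth_field X -> smooth_field Y -> smooth_field (a *: X + Y).
Proof.
move=> sX sY k i.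
apply: (@Ck_eq _ _ _ _ (fun p => a * X p 0 i + Y p 0 i)) => [|p _|]; first exact: openT.
  by rewrite !fctE !mxE.
apply: CkD; [exact: openT| |exact: sY].
by apply: CkM; [exact: openT|exact: Ck_cst|exact: sX].
Qed.

Lemma lie_bracket_linr a X Y Z : smooth_field X -> smooth_field Y -> smooth_field Z ->
  lie_bracket Z (a *: X + Y) = a *: lie_bracket Z X + lie_bracket Z Y.
Proof.
move=> sX sY sZ; apply/funext => p; rewrite /lie_bracket !fctE.
have [dX dY dZ] : [/\ differentiable X p, differentiable Y p & differentiable Z p].
  by split; exact: smooth_differentiable.
rewrite deriveD; [|exact/derivableZ/diff_derivable|exact: diff_derivable].
rewrite deriveZ; last exact: diff_derivable.
rewrite !deriveEjacobian // mulmxDl -scalemxAl scalerBr.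
have gen (u v w t : 'rV[R]_N) : u + v - (w + t) = u - w + (v - t).
  by rewrite opprD addrACA.
exact: gen.
Qed.

Lemma lie_jacobi X Y Z : smooth_field X -> smooth_field Y -> smooth_field Z ->
  lie_bracket X (lie_bracket Y Z) + lie_bracket Y (lie_bracket Z X)
    + lie_bracket Z (lie_bracket X Y) = 0.
Proof.
by move=> sX sY sZ; apply/funext => p; exact: (lie_bracket_jacobi openT sX sY sZ).
Qed.

End vector_fields.

Section pushforward.
Context {R : realType} (N : nat) (U U' : set 'rV[R]_N) (phi psi : 'rV[R]_N -> 'rV[R]_N).
Hypothesis lc : local_coordinates U U' phi psi.
Implicit Types (X Y : vfield R N).
Local Notation push := (in_coordinates U' phi psi).

Let Uo : open U. Proof. by case: lc => [[]]. Qed.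
Let U'o : open U'. Proof. by case: lc => [[]]. Qed.
Let Cphi k : Cv k U phi.
Proof. by case: lc => _ h _ _ _; apply/Ck_onP => //; exact: h. Qed.
Let Cpsi k : Cv k U' psi.
Proof. by case: lc => _ _ h _ _; apply/Ck_onP => //; exact: h. Qed.
Let psiU y : U' y -> U (psi y). Proof. by case: lc => _ _ _ _ h /h[]. Qed.
Let phiK y : U' y -> phi (psi y) = y. Proof. by case: lc => _ _ _ _ h /h[]. Qed.
Let phiU p : U p -> U' (phi p). Proof. by case: lc => _ _ _ h _ /h[]. Qed.
Let psiK p : U p -> psi (phi p) = p. Proof. by case: lc => _ _ _ h _ /h[]. Qed.

Lemma push_in X y : U' y -> push X y = 'D_(X (psi y)) phi (psi y).
Proof. by move=> U'y; rewrite /in_coordinates mem_set. Qed.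

Lemma push_out X y : ~ U' y -> push X y = 0.
Proof. by move=> nU'y; rewrite /in_coordinates memNset. Qed.

Lemma push_coord X y i : U' y -> push X y 0 i = lieD X (fun q => phi q 0 i) (psi y).
Proof.
move=> U'y; rewrite push_in // derive_row ?mxE //.
exact: (Cv_differentiable Uo (Cphi 1) (psiU U'y)).
Qed.

Lemma push_lin a X Y : push (a *: X + Y) = a *: push X + push Y.
Proof.
apply/funext => y; rewrite !fctE; have [U'y|nU'y] := pselect (U' y); last first.
  by rewrite !push_out // scaler0 addr0.
have dphi : differentiable phi (psi y).
  exact: (Cv_differentiable Uo (Cphi 1) (psiU U'y)).
by rewrite !push_in // !deriveEjacobian // mulmxDl -scalemxAl.
Qed.

Lemma Ck_push_coord X k i : smooth_field X -> Ck k U' (fun y => push X y 0 i).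
Proof.
move=> sX.
apply: (@Ck_eq _ _ _ _ (fun y => lieD X (fun q => phi q 0 i) (psi y))) => // [y U'y|].
  by rewrite push_coord.
apply: (@Ck_comp _ _ _ _ _ U psi) => //; first exact: Cpsi.
apply: Ck_lieD => // [k'|k']; last exact: Cphi.
by move=> j; apply: (Ck_sub (@subsetT _ U)); exact: sX.
Qed.

Lemma push_vector_field X : smooth_field X -> vector_field_on U' (push X).
Proof.
move=> sX; split; last by move=> y; exact: push_out.
by apply/smooth_onP => // k i; exact: Ck_push_coord.
Qed.

Lemma lieD_push X g y : (forall k, Ck k U' g) -> U' y ->
  lieD (push X) g y = lieD X (fun q => g (phi q)) (psi y).
Proof.
move=> Cg U'y; rewrite /lieD push_in //.
have dphi : differentiable phi (psi y).
  exact: (Cv_differentiable Uo (Cphi 1) (psiU U'y)).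
have dg : differentiable g (phi (psi y)).
  by rewrite phiK //; exact: (Ck_differentiable U'o (Cg 1) U'y).
by have := derive_comp (X (psi y)) dphi dg; rewrite phiK // => <-.
Qed.

(** Fields are compared through their action on the components of [phi]: there a bracket is a
    commutator of derivations, and [lieD_push] carries derivations across the chart. *)
Lemma push_bracket X Y : smooth_field X -> smooth_field Y ->
  push (lie_bracket X Y) = lie_bracket (push X) (push Y).
Proof.
move=> sX sY; apply/funext => y; have [U'y|nU'y] := pselect (U' y); last first.
  (* Off [U'] the pushed fields are 0, so both derivatives in their bracket are taken in direction
     0. *)
  by rewrite push_out // /lie_bracket !push_out // !derive0 subrr.
apply/rowP => i.
have CpX k : Cv k U' (push X) by move=> j; exact: Ck_push_coord.
have CpY k : Cv k U' (push Y) by move=> j; exact: Ck_push_coord.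
have UX Z : smooth_field Z -> forall k, Cv k U Z.
  by move=> sZ k j; apply: (Ck_sub (@subsetT _ U)); exact: sZ.
have Cphi' k : Ck k U (fun q => phi q 0 i) by exact: Cphi.
rewrite push_coord // (lieD_bracket Uo (UX _ sX) (UX _ sY) Cphi' (psiU U'y)).
rewrite (lie_bracket_coord U'o i CpX CpY U'y).
have key Z W : smooth_field W -> lieD (push Z) (fun q => push W q 0 i) y =
   lieD Z (lieD W (fun q => phi q 0 i)) (psi y).
  move=> sW; rewrite lieD_push //; last by move=> k; exact: Ck_push_coord.
  apply: (lieD_eq Uo _ (psiU U'y)) => q Uq.
  by rewrite push_coord ?psiK //; exact: phiU.
by rewrite !key.
Qed.

End pushforward.

(** * Unique continuation for perfect families of vector fields *)

Section unique_continuation.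
Context {R : realType} (N m : nat) (X : 'I_m -> vfield R N).
Hypothesis sX : forall i, smooth_field (X i).
Variable c : 'I_m -> 'I_m -> 'I_m -> R.
Hypothesis perfect : forall l p,
  X l p = \sum_i \sum_j c l i j *: lie_bracket (X i) (X j) p.

Let Q p := \sum_i \sum_j \sum_k `|pd j (fun q => X i q 0 k) p|.

Let Q_continuous : continuous Q.
Proof.
move=> p; apply: (@cvg_sumr R _ _ _ (nbhs p)) => i.
apply: (@cvg_sumr R _ _ _ (nbhs p)) => j; apply: (@cvg_sumr R _ _ _ (nbhs p)) => k.
apply: (@continuous_comp _ _ _ (pd j (fun q => X i q 0 k)) (fun x => `|x|)).
  exact: (Ck_continuous (Ck_pd j (sX i 1 k)) (I : setT p)).
exact: norm_continuous.
Qed.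

Let Q_ge0 p : 0 <= Q p.
Proof. by do 3! (apply: sumr_ge0 => ? _). Qed.

Let derive_le p i v : `|'D_v (X i) p| <= Q p * `|v|.
Proof.
apply: rV_norm_le => [|k]; first by rewrite mulr_ge0.
rewrite derive_row; last exact: smooth_differentiable.
rewrite mxE (Ck_deriveE _ openT (sX i 1 k) I).
apply: le_trans (ler_norm_sum _ _ _) _.
rewrite /Q (bigD1 i) //= mulrDl; apply: ler_wpDr.
  by rewrite mulr_ge0 //; do 3! (apply: sumr_ge0 => ? _).
rewrite mulr_suml; apply: ler_sum => j _.
rewrite normrM mulrC; apply: ler_pM => //; last exact: coord_le_norm.
by rewrite (bigD1 k) //= lerDl; apply: sumr_ge0.
Qed.

Let S := \sum_l \sum_i \sum_j `|c l i j|.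

(* Every field of a perfect family is at most [2 S Q] times the largest one, where [Q] is the
   size of the first derivatives; so all of them vanish wherever [Q] is small. *)
Let vanish_small p : 2 * S * Q p < 1 -> forall i, X i p = 0.
Proof.
pose M := \sum_i `|X i p|.
have M0 : 0 <= M by apply: sumr_ge0.
have XM i : `|X i p| <= M by rewrite /M (bigD1 i) //= lerDl sumr_ge0.
have brM i j : `|lie_bracket (X i) (X j) p| <= 2 * Q p * M.
  rewrite /lie_bracket; apply: le_trans (ler_normB _ _) _.
  have -> : 2 * Q p * M = Q p * M + Q p * M by ring.
  by apply: lerD; apply: le_trans (derive_le _ _ _) _; apply: ler_wpM2l.
have hM : M <= 2 * S * Q p * M.
  have -> : 2 * S * Q p * M = S * (2 * Q p * M) by ring.
  rewrite /S mulr_suml {1}/M; apply: ler_sum => l _.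
  rewrite perfect mulr_suml; apply: le_trans (ler_norm_sum _ _ _) _.
  apply: ler_sum => i _; rewrite mulr_suml; apply: le_trans (ler_norm_sum _ _ _) _.
  by apply: ler_sum => j _; rewrite normrZ; apply: ler_wpM2l.
move=> h i; apply/eqP; rewrite -normr_le0; apply: le_trans (XM i) _.
rewrite leNgt; apply/negP => Mp; move: hM; rewrite -{1}[M]mul1r ler_pM2r //.
by rewrite leNgt h.
Qed.

(** The open and closed set is [Q = 0]: fields that vanish near a point have [Q = 0] there, and
    conversely [Q = 0] at a point makes [Q] small nearby. It is taken on the line through [o] and
    [p], so that connectedness of the real line suffices. *)
Lemma perfect_vanish o r : 0 < r -> (forall x, `|x - o| < r -> forall i, X i x = 0) ->
  forall i p, X i p = 0.
Proof.
move=> r0 hO.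
have S0 : 0 <= 2 * S + 1.
  by rewrite addr_ge0 // mulr_ge0 //; do 3! (apply: sumr_ge0 => ? _).
have near0 p : Q p = 0 -> exists2 d : R, 0 < d & forall x, `|x - p| < d -> forall i, X i x = 0.
  (* The threshold gives [2 * S * Q < 1]; the [+ 1] covers the case [S = 0]. *)
  move=> Qp; have e0 : 0 < (2 * S + 1)^-1.
    rewrite invr_gt0 ltr_wpDl // mulr_ge0 //; do 3! (apply: sumr_ge0 => ? _) => //.
  have /continuous_radius/(_ _ e0)[d d0 hd] := @Q_continuous p.
  exists d => // x /hd; rewrite Qp sub0r normrN ger0_norm // => Qx.
  apply: vanish_small; apply: (@le_lt_trans _ _ (2 * S / (2 * S + 1))).
    by apply: ler_wpM2l => //; rewrite mulr_ge0 //; do 3! (apply: sumr_ge0 => ? _).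
  by rewrite ltr_pdivrMr ?mul1r ?ltrDl // -invr_gt0.
have vanQ p d : 0 < d -> (forall x, `|x - p| < d -> forall i, X i x = 0) -> Q p = 0.
  move=> d0 hd; rewrite /Q; do 3! (apply: big1 => ? _).
  rewrite (@pd_eq _ _ [set x | `|x - p| < d] _ (fun=> 0)) ?pd_cst ?normr0 //.
  - rewrite (_ : [set x | _] = ball p d); first exact: ball_open.
    by apply/seteqP; split=> z; rewrite -ball_normE /= distrC.
  - by rewrite /= subrr normr0.
  - by move=> q /hd ->; rewrite mxE.
move=> i p.
pose gam (s : R) := o + s *: (p - o).
have cgam : continuous gam.
  move=> s; apply: (@cvgD _ _ _ (nbhs s)); first exact: cvg_cst.
  by apply: cvgZr_tmp; exact: cvg_id.
have conn : connected [set: R] by apply/connected_intervalP.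
pose B := gam @^-1` (Q @^-1` [set 0]).
have Bo : open B.
  rewrite openE => s Bs; have [d d0 hd] := near0 _ Bs.
  have : nbhs s (gam @^-1` ball (gam s) d).
    by apply: cgam; exact: nbhsx_ballx.
  apply: filterS => t; rewrite -ball_normE /= => ht.
  apply: (vanQ (gam t) (d - `|gam t - gam s|)); first by rewrite subr_gt0 distrC.
  move=> x; rewrite ltrBrDr => hx; apply: hd; apply: le_lt_trans hx.
  exact: ler_distD.
have Bc : closed B.
  apply: preimage_closed; first by move=> s _; exact: cgam.
  apply: preimage_closed; first by move=> x _; exact: Q_continuous.
  exact: closed_eq.
have B0 : B 0 by rewrite /B /preimage /gam /= scale0r addr0; exact: (vanQ o r).
have BT : B = setT.
  apply: conn; first by exists 0.
    by exists B => //; rewrite setTI.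
  by exists B => //; rewrite setTI.
have : B 1 by rewrite BT.
rewrite /B /preimage /gam /= scale1r addrC subrK => /near0[d d0].
by apply; rewrite subrr normr0.
Qed.

End unique_continuation.

(** * Real Lie algebras with a split Cartan subalgebra *)

Section lie_model.
Context {R : realFieldType} (d : nat).
Local Notation V := ('rV[R]_d).
Implicit Types (I J A B W U : {vspace V}) (x y z u : V).
Variable br : V -> V -> V.
Hypothesis br_linr : forall a x y z, br z (a *: x + y) = a *: br z x + br z y.
Hypothesis br_anti : forall x y, br x y = - br y x.
Hypothesis jacobi : forall x y z, br x (br y z) = br (br x y) z + br y (br x z).

Lemma br_linl a x y z : br (a *: x + y) z = a *: br x z + br y z.
Proof. by rewrite br_anti br_linr opprD -scalerN -!br_anti. Qed.

Lemma brxx x : br x x = 0.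
Proof.
have /eqP := br_anti x x; rewrite -addr_eq0 -mulr2n -scaler_nat scaler_eq0 pnatr_eq0 /=.
by move/eqP.
Qed.

Lemma br0r x : br x 0 = 0.
Proof. by have := br_linr (-1) 0 0 x; rewrite scaler0 addr0 scaleN1r addNr. Qed.

Lemma brZr a x y : br x (a *: y) = a *: br x y.
Proof. by have := br_linr a y 0 x; rewrite !addr0 br0r addr0. Qed.

Lemma brDr x y z : br x (y + z) = br x y + br x z.
Proof. by have := br_linr 1 y z x; rewrite !scale1r. Qed.

Lemma brNr x y : br x (- y) = - br x y.
Proof. by rewrite -scaleN1r brZr scaleN1r. Qed.

Lemma brZl a x y : br (a *: x) y = a *: br x y.
Proof. by rewrite br_anti brZr -scalerN -br_anti. Qed.

Lemma brDl x y z : br (x + y) z = br x z + br y z.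
Proof. by have := br_linl 1 x y z; rewrite !scale1r. Qed.

Lemma brNl x y : br (- x) y = - br x y.
Proof. by rewrite -scaleN1r brZl scaleN1r. Qed.

Lemma br0l x : br 0 x = 0.
Proof. by rewrite br_anti br0r oppr0. Qed.

Lemma br_sumr (I : Type) (r : seq I) (F : I -> V) x :
  br x (\sum_(i <- r) F i) = \sum_(i <- r) br x (F i).
Proof.
elim: r => [|i r IH]; first by rewrite !big_nil br0r.
by rewrite !big_cons brDr IH.
Qed.

Lemma br_suml (I : Type) (r : seq I) (F : I -> V) x :
  br (\sum_(i <- r) F i) x = \sum_(i <- r) br (F i) x.
Proof.
rewrite br_anti br_sumr -sumrN; apply: eq_bigr => i _; by rewrite -br_anti.
Qed.

Definition ideal (I : {vspace V}) := forall x y, y \in I -> br x y \in I.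

Definition derived (I : {vspace V}) : {vspace V} :=
  <<[seq br x y | x <- vbasis I, y <- vbasis I]>>%VS.

Lemma mem_derived I x y : x \in I -> y \in I -> br x y \in derived I.
Proof.
move=> xI yI; rewrite (coord_vbasis xI) (coord_vbasis yI) br_suml.
apply: memv_suml => i _; rewrite br_sumr; apply: memv_suml => j _.
rewrite brZl brZr; do 2! apply: memvZ; apply: memv_span.
by apply: allpairs_f; apply: mem_nth; rewrite size_tuple.
Qed.

Lemma derived_sub (I J : {vspace V}) :
  (forall x y, x \in I -> y \in I -> br x y \in J) -> (derived I <= J)%VS.
Proof.
move=> h; apply/span_subvP => _ /allpairsP[[x y] /= [xI yI ->]].
by apply: h; exact: vbasis_mem.
Qed.

Lemma derived_ideal I : ideal I -> ideal (derived I).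
Proof.
move=> iI x y yd; pose X := in_tuple [seq br x y | x <- vbasis I, y <- vbasis I].
have ys : y \in <<X>>%VS by [].
rewrite (coord_span ys) br_sumr; apply: memv_suml => i _; rewrite brZr; apply: memvZ.
have : X`_i \in (X : seq V) by apply: mem_nth; exact: ltn_ord.
move=> /allpairsP[[u v] /= [/vbasis_mem uI /vbasis_mem vI ->]].
rewrite jacobi; apply: memvD; first by apply: mem_derived => //; exact: iI.
by apply: mem_derived => //; exact: iI.
Qed.

(** This is the form in which semisimplicity enters the model; [mbr_no_abelian] derives it from the
    absence of nonzero solvable ideals. *)
Hypothesis no_abelian : forall I, ideal I ->
  (forall x y, x \in I -> y \in I -> br x y = 0) -> I = 0%VS.

(** The derived series of [I] consists of ideals and never reaches 0, for the ideal just before 0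
    would be abelian; so it stops at a nonzero perfect ideal. *)
Lemma perfect_sub I : ideal I -> I != 0%VS ->
  exists J, [/\ ideal J, (J <= I)%VS, J != 0%VS & derived J = J].
Proof.
have [m] := ubnP (\dim I); elim: m I => // m IH I Im iI I0.
have dI : (derived I <= I)%VS by apply: derived_sub => x y _; exact: iI.
have d0 : derived I != 0%VS.
  apply: contra I0 => /eqP d0; apply/eqP; apply: no_abelian => // x y xI yI.
  by apply/eqP; rewrite -memv0 -d0; exact: mem_derived.
have [dd|dd] := eqVneq (derived I) I; first by exists I; split.
have [|||J [iJ JI J0 JJ]] := IH (derived I) => //.
- rewrite -ltnS (leq_trans _ Im) // ltnS ltn_neqAle dimvS // andbT.
  by apply: contra dd => /eqP e; rewrite eqEdim dI e leqnn.
- exact: derived_ideal.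
by exists J; split=> //; exact: (subv_trans JI dI).
Qed.

Lemma vspace_le_max (P : {vspace V} -> Prop) (A0 : {vspace V}) : P A0 ->
  exists2 A, P A & forall B, P B -> (\dim B <= \dim A)%N.
Proof.
move=> P0; have [m] := ubnP (d - \dim A0); elim: m A0 P0 => // m IH A0 P0 hm.
have [h|] := pselect (forall B, P B -> (\dim B <= \dim A0)%N); first by exists A0.
move=> /existsNP[B /not_implyP[PB /negP]]; rewrite -ltnNge => h.
have hB : (\dim B <= d)%N by have := dimvS (subvf B); rewrite dimvf /dim /= mul1n.
apply: (IH B PB); rewrite ltnS in hm; apply: (leq_trans _ hm).
by apply: ltn_sub2l => //; exact: (leq_trans h hB).
Qed.

(** * Weights of one diagonal element and a graded Engel theorem *)

Section grading.
Variables (h0 : V) (l : 'I_d -> R).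
Hypothesis h0E : forall x, br h0 x = \row_i (l i * x 0 i).

Definition homog (w : R) (x : V) := br h0 x = w *: x.
Definition graded (A : {vspace V}) := forall x, x \in A -> br h0 x \in A.
Definition subalg (A : {vspace V}) := forall x y, x \in A -> y \in A -> br x y \in A.

Lemma homog_coord w x i : homog w x -> x 0 i != 0 -> l i = w.
Proof.
move=> hx xi; have := congr1 (fun r : V => r 0 i) hx.
by rewrite h0E !mxE => /(mulIf xi).
Qed.

Lemma homog_br w w' x y : homog w x -> homog w' y -> homog (w + w') (br x y).
Proof.
by move=> hx hy; rewrite /homog jacobi hx hy brZl brZr scalerDl.
Qed.

Definition comp (w : R) (x : V) : V := \row_i (if l i == w then x 0 i else 0).

Lemma comp_homog w x : homog w (comp w x).
Proof.
rewrite /homog h0E; apply/rowP => i; rewrite !mxE.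
by case: eqP => [->|_] //; rewrite !mulr0.
Qed.

(** Lagrange interpolation: the product of [br h0 - u] over the weights [u] other than [w] kills the
    other components of [x] and multiplies the one of weight [w] by the nonzero number [c]. *)
Lemma graded_comp A w x : graded A -> x \in A -> comp w x \in A.
Proof.
move=> gA xA.
have key (s : seq R) : \row_i ((\prod_(u <- s) (l i - u)) * x 0 i) \in A.
  elim: s => [|u s IH].
    rewrite (_ : (\row_i _) = x) //.
    by apply/rowP => i; rewrite mxE big_nil mul1r.
  have -> : \row_i ((\prod_(v <- u :: s) (l i - v)) * x 0 i) =
     br h0 (\row_i ((\prod_(v <- s) (l i - v)) * x 0 i))
     - u *: \row_i ((\prod_(v <- s) (l i - v)) * x 0 i).
    by rewrite h0E; apply/rowP => i; rewrite !mxE big_cons; ring.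
  by apply: memvB; [exact: gA|exact: memvZ].
pose s := [seq u <- undup [seq l i | i <- enum 'I_d] | u != w].
pose c := \prod_(u <- s) (w - u).
have c0 : c != 0.
  rewrite /c prodf_seq_neq0; apply/allP => u; rewrite mem_filter => /andP[uw _].
  by rewrite subr_eq0 eq_sym.
have -> : comp w x = c^-1 *: \row_i ((\prod_(u <- s) (l i - u)) * x 0 i).
  apply/rowP => i; rewrite !mxE; case: eqP => [->|/eqP lw].
    by rewrite mulrA mulVf // mul1r.
  rewrite (_ : \prod_(u <- s) _ = 0) ?mul0r ?mulr0 //.
  apply/eqP; rewrite prodf_seq_eq0; apply/hasP; exists (l i); last by rewrite subrr eqxx.
  by rewrite mem_filter lw mem_undup map_f // mem_enum.
by apply: memvZ; exact: key.
Qed.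

Lemma comp_sum x : x = \sum_(w <- undup [seq l i | i <- enum 'I_d]) comp w x.
Proof.
apply/rowP => i; rewrite summxE (bigD1_seq (l i)) ?undup_uniq //=; last first.
  by rewrite mem_undup map_f // mem_enum.
rewrite mxE eqxx big1 ?addr0 // => w /negbTE lw; by rewrite mxE eq_sym lw.
Qed.

Lemma exists_homog (A B : {vspace V}) : graded B -> ~~ (B <= A)%VS ->
  exists x w, [/\ x \in B, x \notin A & homog w x].
Proof.
move=> gB /subvPn[x xB xA].
have [h|] := pselect (forall w, comp w x \in A).
  by move: xA; rewrite (comp_sum x) memv_suml // => w _; exact: h.
move=> /existsNP[w /negP hw]; exists (comp w x), w; split=> //.
  exact: graded_comp.
exact: comp_homog.
Qed.

(* The nonzero iterates of an operator shifting weights by [w != 0] have pairwise distinct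
   weights, and there are at most [d] weights. *)
Lemma homog_iter_vanish (w v : R) (f : V -> V) u : w != 0 -> homog v u ->
  (forall (t : R) y, homog t y -> homog (t + w) (f y)) ->
  exists k, iter k f u = 0.
Proof.
move=> w0 hu hf.
have hk k : homog (v + k%:R * w) (iter k f u).
  elim: k => [|k IH]; first by rewrite mul0r addr0.
  by rewrite iterS -natr1 mulrDl mul1r addrA; exact: hf.
have [|h] := pselect (exists k, iter k f u = 0) => //.
have hn k : exists i : 'I_d, l i = v + k%:R * w.
  have : iter k f u != 0 by apply/eqP => e; apply: h; exists k.
  move=> /rV0Pn[i ui]; exists i; exact: homog_coord (hk k) ui.
have [g hg] := choice hn.
have /leq_card : injective (fun k : 'I_d.+1 => g k).
  move=> k k' e; apply/val_inj; have := congr1 l e; rewrite !hg => /addrI/(mulIf w0)/eqP.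
  by rewrite eqr_nat => /eqP.
by rewrite !card_ord ltnn.
Qed.

Definition nozero (A : {vspace V}) := forall x, x \in A -> br h0 x = 0 -> x = 0.

(** This is Engel's conclusion for the action of [A] on [U / W]. The vector is asked to be
    homogeneous so that adjoining it to a graded subspace gives a graded subspace again. *)
Definition engel_on A := forall W U : {vspace V}, graded W -> graded U ->
  (W <= U)%VS -> ~~ (U <= W)%VS ->
  (forall a u, a \in A -> u \in U -> br a u \in U) ->
  (forall a u, a \in A -> u \in W -> br a u \in W) ->
  exists u w, [/\ u \in U, u \notin W, homog w u & forall a, a \in A -> br a u \in W].

(** [B] is of largest dimension among the proper graded subalgebras. Engel's conclusion for [B]
    acting on [A / B] gives a homogeneous [a] outside [B] that [B] carries into [B]; then [B +
    <[a]>] is a larger graded subalgebra, hence all of [A]. *)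
Lemma codim1_ideal A : graded A -> subalg A -> nozero A -> A != 0%VS ->
  (forall B, graded B -> subalg B -> nozero B -> (\dim B < \dim A)%N -> engel_on B) ->
  exists B a w, [/\ graded B, subalg B, nozero B & (\dim B < \dim A)%N] /\
     [/\ a \in A, a \notin B, homog w a, A = (B + <[a]>)%VS & forall b, b \in B -> br b a \in B].
Proof.
move=> gA sA nA A0 IH.
pose P B := [/\ (B <= A)%VS, graded B, subalg B & ~~ (A <= B)%VS].
have P0 : P 0%VS.
  split; first exact: sub0v.
  - by move=> x; rewrite !memv0 => /eqP ->; rewrite br0r.
  - by move=> x y; rewrite !memv0 => /eqP -> _; rewrite br0l.
  - by rewrite subv0.
have [B [BA gB sB AB] maxB] := vspace_le_max P0.
have dB : (\dim B < \dim A)%N.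
  rewrite ltn_neqAle dimvS // andbT; apply: contra AB => /eqP e.
  have BeA : B = A by apply/eqP; rewrite eqEdim BA e leqnn.
  by rewrite BeA subvv.
have nB : nozero B by move=> x xB; apply: nA; exact: (subvP BA).
have BaA b u : b \in B -> u \in A -> br b u \in A.
  by move=> bB; apply: sA; exact: (subvP BA).
have [a [w [aA aB ha Ba]]] := IH B gB sB nB dB B A gB gA BA AB BaA sB.
exists B, a, w; split=> //; split=> //.
have BaS : (B + <[a]> <= A)%VS.
  by rewrite subv_add BA -memvE.
apply/eqP; rewrite eqEsubv BaS andbT.
have [//|nle] := boolP (A <= B + <[a]>)%VS.
have : (\dim (B + <[a]>) <= \dim B)%N.
  apply: maxB; split=> //.
    move=> x /memv_addP[b bB [_ /vlineP[t ->] ->]]; rewrite brDr brZr ha scalerA.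
    by apply: memv_add; [exact: gB|apply: memvZ; exact: memv_line].
  move=> x y /memv_addP[b bB [_ /vlineP[t ->] ->]] /memv_addP[b' b'B [_ /vlineP[t' ->] ->]].
  rewrite (subvP (addvSl B <[a]>)) // brDl !brDr !brZl !brZr brxx !scaler0 addr0.
  rewrite (br_anti a); apply: memvD; last by rewrite memvZ // memvN Ba.
  by apply: memvD; [exact: sB|rewrite memvZ // Ba].
move=> h; have /eqP e : B == (B + <[a]>)%VS by rewrite eqEdim addvSl h.
by move: aB; rewrite e (subvP (addvSr B <[a]>)) // memv_line.
Qed.

(* Engel's theorem relative to a pair of submodules [W <= U]; that the ad-operators are nilpotent is
   replaced by the absence of [h0]-weight zero. *)
Lemma engel A : graded A -> subalg A -> nozero A -> engel_on A.
Proof.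
have [m] := ubnP (\dim A); elim: m A => // m IH A Am gA sA nA W U gW gU WU UW AU AW.
have [A0|A0] := eqVneq A 0%VS.
  have [u [w [uU uW hu]]] := exists_homog gU UW.
  exists u, w; split=> // a; rewrite A0 memv0 => /eqP ->; rewrite br0l; exact: mem0v.
have [|B [a [w [[gB sB nB dB] [aA aB ha AE Ba]]]]] := codim1_ideal gA sA nA A0.
  by move=> B gB sB nB dB; apply: IH => //; exact: (leq_trans dB Am).
have BA : (B <= A)%VS by rewrite AE addvSl.
have w0 : w != 0.
  apply/eqP => w0; move: ha; rewrite /homog w0 scale0r => /(nA _ aA) a0.
  by move: aB; rewrite a0 mem0v.
have [||u0 [v [u0U u0W hu0 Bu0]]] := IH B (leq_trans dB Am) gB sB nB W U gW gU WU UW.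
  by move=> b u /(subvP BA); exact: AU.
  by move=> b u /(subvP BA); exact: AW.
(* Since [a] normalises [B], all iterates are carried into [W] by [B]. They vanish eventually,
   because [a] shifts weights by [w != 0], and a last iterate outside [W] is the vector sought. *)
pose u k := iter k (br a) u0.
have uU k : u k \in U by elim: k => // k ukU; exact: AU.
have hu k : exists v', homog v' (u k).
  by elim: k => [|k [v' hv']]; [exists v|exists (w + v'); exact: homog_br].
have Bu k b : b \in B -> br b (u k) \in W.
  elim: k b => [|k IHk] b bB; first exact: Bu0.
  rewrite /u iterS -/(u k) jacobi; apply: memvD; last by apply: AW => //; exact: IHk.
  by apply: IHk; exact: Ba.
have [k hk] : exists k, u k = 0.
  apply: (homog_iter_vanish w0 hu0) => t y hy; rewrite addrC; exact: homog_br.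
have [j [ujW ujW']] : exists j, u j \notin W /\ br a (u j) \in W.
  elim: k hk => [|k IHk] hk; first by move: u0W; rewrite -[u0]/(u 0%N) hk mem0v.
  have [ukW|ukW] := boolP (u k \in W); last first.
    by exists k; split=> //; rewrite -[br a _]/(u k.+1) hk mem0v.
  elim: {hk} k ukW {IHk} => [|k IHk] ukW; first by move: u0W; rewrite -[u0]/(u 0%N) ukW.
  have [ukW'|ukW'] := boolP (u k \in W); first exact: IHk.
  by exists k.
have [v' hv'] := hu j; exists (u j), v'; split=> // x.
rewrite AE => /memv_addP[b bB [_ /vlineP[t ->] ->]].
by rewrite brDl brZl; apply: memvD; [exact: Bu|exact: memvZ].
Qed.

(** In [A = B + <[a]>] every bracket lies in [B], as [br a a = 0] and [a] normalises [B]; so a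
    nonzero [A] would differ from its derived algebra. *)
Lemma nozero_not_perfect A : graded A -> subalg A -> nozero A -> derived A = A -> A = 0%VS.
Proof.
move=> gA sA nA pA; have [//|A0] := eqVneq A 0%VS.
have [|B [a [w [[gB sB nB dB] [aA aB ha AE Ba]]]]] := codim1_ideal gA sA nA A0.
  by move=> B gB sB nB _; exact: engel.
have : (derived A <= B)%VS.
  apply: derived_sub => x y; rewrite AE.
  move=> /memv_addP[b bB [_ /vlineP[t ->] ->]] /memv_addP[b' b'B [_ /vlineP[t' ->] ->]].
  rewrite brDl !brDr !brZl !brZr brxx !scaler0 addr0.
  rewrite (br_anti a); apply: memvD; last by rewrite memvZ // memvN Ba.
  by apply: memvD; [exact: sB|rewrite memvZ // Ba].
by rewrite pA => /subvP/(_ a aA); rewrite (negbTE aB).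
Qed.

End grading.

(** * The Killing form and the root vectors *)

Definition adm x : 'M[R]_d := \matrix_i br x (delta_mx 0 i).

Lemma mul_adm x y : y *m adm x = br x y.
Proof.
rewrite mulmx_sum_row [in RHS](row_sum_delta y) br_sumr; apply: eq_bigr => i _.
by rewrite rowK brZr.
Qed.

(** Rows are multiplied by matrices from the right, so [adm] reverses the order of composition;
    hence the sign opposite to the usual one. *)
Lemma adm_br x y : adm (br x y) = adm y *m adm x - adm x *m adm y.
Proof.
apply/row_matrixP => i; rewrite !rowE mulmxBr !mulmxA !mul_adm.
by rewrite jacobi addrK.
Qed.

Lemma adm_lin a x y : adm (a *: x + y) = a *: adm x + adm y.
Proof.
apply/row_matrixP => i; rewrite !rowE mulmxDr -scalemxAr !mul_adm.
exact: br_linl.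
Qed.

Definition killing x y : R := \tr (adm x *m adm y).

Lemma killingC x y : killing x y = killing y x.
Proof. exact: mxtrace_mulC. Qed.

Lemma killing_br x y z : killing (br x y) z = killing x (br y z).
Proof.
rewrite /killing !adm_br mulmxBl mulmxBr !linearB /= -!mulmxA; congr (_ - _).
by rewrite mxtrace_mulC -mulmxA.
Qed.

Lemma killing_linl a x y z : killing (a *: x + y) z = a * killing x z + killing y z.
Proof. by rewrite /killing adm_lin mulmxDl -scalemxAl linearD linearZ. Qed.

Lemma killing_linr a x y z : killing z (a *: x + y) = a * killing z x + killing z y.
Proof. by rewrite killingC killing_linl !(killingC z). Qed.

Lemma killing0l x : killing 0 x = 0.
Proof. by have := killing_linl (-1) 0 0 x; rewrite scaler0 addr0 mulN1r addNr. Qed.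

Lemma killing0r x : killing x 0 = 0.
Proof. by rewrite killingC killing0l. Qed.

Lemma killingZl a x y : killing (a *: x) y = a * killing x y.
Proof. by have := killing_linl a x 0 y; rewrite killing0l !addr0. Qed.

Lemma killingZr a x y : killing x (a *: y) = a * killing x y.
Proof. by rewrite killingC killingZl killingC. Qed.

Lemma killing_eq0 x : (forall i, killing x (delta_mx 0 i) = 0) -> forall y, killing x y = 0.
Proof.
move=> h y; rewrite (row_sum_delta y); elim/big_rec: _ => [|i z _ hz]; first exact: killing0r.
by rewrite killing_linr h hz mulr0 addr0.
Qed.

Variables (C : V -> Prop) (lam : 'I_d -> V -> R).
Hypothesis C_lin : forall a x y, C x -> C y -> C (a *: x + y).
Hypothesis C_diag : forall h, C h -> forall x, br h x = \row_i (lam i h * x 0 i).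
Hypothesis C_centralizer : forall x, (forall c, C c -> br c x = 0) -> C x.

Lemma C_zero : C 0.
Proof. by apply: C_centralizer => c _; rewrite br0r. Qed.

Lemma killing_Cartan h : C h -> killing h h = \sum_i lam i h ^+ 2.
Proof.
move=> Ch; rewrite /killing /mxtrace; apply: eq_bigr => i _.
have e : adm h = diag_mx (\row_i lam i h).
  apply/matrixP => j k; rewrite !mxE C_diag // !mxE eqxx /= eq_sym.
  by case: eqP => [->|]; rewrite ?mulr1 ?mulr0.
by rewrite e mulmx_diag !mxE eqxx mulr1n expr2.
Qed.

(** A vanishing sum of squares of real weights makes every weight of [h] zero, so [h] is central and
    spans an abelian ideal. *)
Lemma killing_definite h : C h -> killing h h = 0 -> h = 0.
Proof.
move=> Ch; rewrite killing_Cartan // => /eqP.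
rewrite psumr_eq0; last by move=> i _; exact: sqr_ge0.
move=> /allP lh; have hz x : br h x = 0.
  rewrite C_diag //; apply/rowP => i; rewrite !mxE.
  by have := lh i (mem_index_enum i); rewrite sqrf_eq0 => /eqP ->; rewrite mul0r.
have /eqP : (<[h]> = 0)%VS.
  apply: no_abelian => [x y /vlineP[t ->]|x y /vlineP[t ->] _].
    by rewrite br_anti brZl hz scaler0 oppr0 mem0v.
  by rewrite brZl hz scaler0.
by rewrite -subv0 -memvE memv0 => /eqP.
Qed.

Section regular.
Variable h0 : V.
Hypotheses (Ch0 : C h0) (h0_regular : forall x, br h0 x = 0 -> C x).

(* The radical of the Killing form meets [C] trivially as [killing h h] is the sum of the squares of
   the weights of [h]; hence it has no vector of [h0]-weight zero and cannot be perfect. *)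
Lemma killing_nondegenerate x : (forall y, killing x y = 0) -> x = 0.
Proof.
pose f (x : V) : V := \row_i killing x (delta_mx 0 i).
have flin : linear f.
  by move=> a u v; apply/rowP => i; rewrite !mxE killing_linl.
pose fL : {linear V -> V} := HB.pack f (GRing.isLinear.Build _ _ _ _ f flin).
pose K := lker (linfun fL).
have KP u : u \in K <-> forall y, killing u y = 0.
  rewrite memv_ker lfunE /=; split=> [/eqP e|h].
    by apply: killing_eq0 => i; have := congr1 (fun r : V => r 0 i) e; rewrite !mxE.
  by apply/eqP/rowP => i; rewrite !mxE.
have iK : ideal K.
  move=> u v /KP vK; apply/KP => y.
  by rewrite br_anti -scaleN1r killingZl killing_br vK mulr0.
suff K0 : K = 0%VS by move=> /KP; rewrite K0 memv0 => /eqP.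
have [//|Kn0] := eqVneq K 0%VS.
have [J [iJ JK J0 JJ]] := perfect_sub iK Kn0.
suff J00 : J = 0%VS by move: J0; rewrite J00 eqxx.
apply: (@nozero_not_perfect h0 (fun i => lam i h0) (C_diag Ch0) J) => //.
- by move=> u uJ; exact: iJ.
- by move=> u v _ vJ; exact: iJ.
move=> u uJ /h0_regular Cu; apply: killing_definite => //.
by move/(subvP JK)/KP: uJ.
Qed.

Definition root_vec (a : V -> R) x := forall h, C h -> br h x = a h *: x.

(** Some basis vector pairs nontrivially with [e]. The basis consists of joint eigenvectors of [C],
    and invariance of the Killing form leaves [- a] as the only possible weight of that vector. *)
Lemma dual_root_vec a e : root_vec a e -> e != 0 ->
  exists2 f, root_vec (fun h => - a h) f & killing e f != 0.
Proof.
move=> ra e0.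
have [i hi] : exists i, killing e (delta_mx 0 i) != 0.
  apply/not_existsP => h; move/eqP: e0; apply; apply: killing_nondegenerate.
  apply: killing_eq0 => i; apply/eqP/negP => /negP hi; exact: (h i).
exists (delta_mx 0 i) => // h Ch.
have rE : br h (delta_mx 0 i) = lam i h *: delta_mx 0 i.
  rewrite C_diag //; apply/rowP => j; rewrite !mxE eqxx /=.
  by case: eqP => [->|]; rewrite ?mulr0.
rewrite rE; congr (_ *: _).
have := killing_br e h (delta_mx 0 i); rewrite rE (br_anti e) ra //.
by rewrite -scaleNr killingZl killingZr => /(mulIf hi).
Qed.

(** The second part says that [br e f] is [killing e f] times the element of [C] which represents
    [a] under the Killing form. *)
Lemma root_bracket a e f : root_vec a e -> root_vec (fun h => - a h) f ->
  C (br e f) /\ forall c, C c -> killing (br e f) c = a c * killing e f.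
Proof.
move=> re rf; split.
  apply: C_centralizer => c Cc; rewrite jacobi (re c Cc) (rf c Cc) brZl brZr.
  by rewrite scaleNr addrN.
move=> c Cc; rewrite killing_br br_anti rf // scaleNr opprK.
by rewrite killingZr.
Qed.

(* A lowest weight vector of positive weight would generate an infinite string. *)
Lemma lowest_weight_vanish a e f x : root_vec a e -> root_vec (fun h => - a h) f ->
  a (br e f) = 2 -> root_vec a x -> br x f = 0 -> x = 0.
Proof.
move=> re rf a2 rx xf0; pose h := br e f.
have [Ch _] := root_bracket re rf.
have [//|x0] := eqVneq x 0.
pose u k := iter k (br e) x.
have hu k : br h (u k) = (2 + 2 * k%:R) *: u k.
  elim: k => [|k IH]; first by rewrite mulr0 addr0 rx // a2.
  rewrite /u iterS -/(u k) jacobi IH brZr re // a2 brZl -scalerDl.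
  by congr (_ *: _); rewrite -natr1; ring.
(* String of a lowest weight 2: the coefficient does not vanish in characteristic zero, so no [u k]
   is zero and infinitely many weights would occur. *)
have fu k : br f (u k.+1) = - (k.+1%:R * (k.+1%:R + 1)) *: u k.
  elim: k => [|k IH].
    rewrite /u /= jacobi (br_anti f x) xf0 oppr0 br0r addr0 (br_anti f e) brNl.
    by rewrite -/h (hu 0%N) -scaleNr; congr (_ *: _); ring.
  rewrite /u iterS -/(u k.+1) jacobi IH brZr (br_anti f e) brNl -/h hu.
  rewrite -[br e (u k)]/(u k.+1) -scaleNr -scalerDl; congr (_ *: _).
  by rewrite -!natr1; ring.
have u0 k : u k != 0.
  elim: k => [//|k IH]; apply/eqP => e0.
  have /eqP := fu k; rewrite e0 br0r eq_sym scaler_eq0 (negbTE IH) orbF oppr_eq0.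
  by rewrite mulf_eq0 natr1 !pnatr_eq0.
have hn k : exists i : 'I_d, lam i h = 2 + 2 * k%:R.
  have /rV0Pn[i ui] := u0 k; exists i.
  exact: (homog_coord (C_diag Ch) (hu k) ui).
have [g hg] := choice hn.
have /leq_card : injective (fun k : 'I_d.+1 => g k).
  move=> k k' ek; apply/val_inj; have := congr1 (lam ^~ h) ek; rewrite !hg => /addrI.
  have n2 : (2 : R) != 0 by rewrite pnatr_eq0.
  by move=> /(mulfI n2)/eqP; rewrite eqr_nat => /eqP.
by rewrite !card_ord ltnn.
Qed.

(** With this [t], the vector [x - t *: e] is orthogonal to [f]. Its bracket with [f] is then an
    element of [C] orthogonal to [C], hence 0 by definiteness, and [x - t *: e] is a lowest weight
    vector of weight 2. *)
Lemma root_space_line a e f x : root_vec a e -> root_vec (fun h => - a h) f ->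
  a (br e f) = 2 -> killing e f != 0 -> root_vec a x -> exists t, x = t *: e.
Proof.
move=> re rf a2 k0 rx; exists (killing x f / killing e f).
set t := _ / _; apply/eqP; rewrite -subr_eq0; apply/eqP.
have rx' : root_vec a (x - t *: e).
  by move=> h Ch; rewrite brDr brNr brZr rx // re // scalerBr !scalerA mulrC.
apply: (lowest_weight_vanish re rf a2 rx').
have [Cb kb] := root_bracket rx' rf.
apply: killing_definite => //; rewrite kb //.
rewrite (_ : killing (x - t *: e) f = 0) ?mulr0 //.
by rewrite addrC -scaleNr killing_linl /t mulNr divfK // addNr.
Qed.

(** If [a] vanished on [br e f], this element would be orthogonal to itself and hence 0, against
    [a c * killing e f != 0]. So [f] can be rescaled until [a] takes the value 2. The line for [- a]
    results from exchanging [e] and [f]. *)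
Lemma sl2_triple a e : root_vec a e -> e != 0 -> (exists2 c, C c & a c != 0) ->
  (forall t g h, C g -> C h -> a (t *: g + h) = t * a g + a h) ->
  exists f, [/\ root_vec (fun h => - a h) f, C (br e f), a (br e f) = 2, killing e f != 0 &
    (forall x, root_vec a x -> exists t, x = t *: e) /\
    (forall x, root_vec (fun h => - a h) x -> exists t, x = t *: f)].
Proof.
move=> re e0 [c Cc ac] alin.
have [f rf kf] := dual_root_vec re e0.
have [Cb kb] := root_bracket re rf.
have ab : a (br e f) != 0.
  apply/eqP => ab; have : killing (br e f) (br e f) = 0 by rewrite kb // ab mul0r.
  move=> /(killing_definite Cb) b0; have := kb c Cc; rewrite b0.
  rewrite killing0l.
  by move=> /esym/eqP; rewrite mulf_eq0 (negbTE ac) (negbTE kf).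
have a0 : a 0 = 0.
  by have := alin (-1) 0 0 C_zero C_zero; rewrite scaler0 addr0 mulN1r addNr.
have aZ t g : C g -> a (t *: g) = t * a g.
  by move=> Cg; have := alin t g 0 Cg C_zero; rewrite addr0 a0 addr0.
pose s := 2 / a (br e f); pose f' := s *: f.
have s0 : s != 0 by rewrite mulf_neq0 ?invr_eq0 // pnatr_eq0.
have rf' : root_vec (fun h => - a h) f' by move=> h Ch; rewrite brZr rf // !scalerA mulrC.
have bE : br e f' = s *: br e f by rewrite brZr.
have a2 : a (br e f') = 2 by rewrite bE aZ // /s divfK.
have kf' : killing e f' != 0.
  by rewrite killingZr mulf_neq0.
have Cb' : C (br e f') by rewrite bE -[_ *: _]addr0; apply: C_lin => //; exact: C_zero.
exists f'; split=> //; split.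
- by move=> x; exact: (root_space_line re rf' a2 kf').
move=> x rx; apply: (@root_space_line (fun h => - a h) f' e x) => //.
- by move=> h Ch; rewrite opprK; exact: re.
- have -> : br f' e = (-1) *: br e f' by rewrite br_anti scaleN1r.
  by rewrite aZ // a2 mulN1r opprK.
- by rewrite killingC.
Qed.

End regular.
End lie_model.

(** * Subspaces, bases and Lie algebras given as sets *)

Section spans.
Context {R : realType} {V : lmodType R}.
Implicit Types (A S : set V) (x y : V).

Lemma subspace0 A : is_subspace A -> A 0.
Proof. by case. Qed.

Lemma subspace_lin A a x y : is_subspace A -> A x -> A y -> A (a *: x + y).
Proof. by case=> _ h; exact: h. Qed.

Lemma subspaceZ A a x : is_subspace A -> A x -> A (a *: x).
Proof. by move=> sA Ax; rewrite -[_ *: _]addr0; apply: subspace_lin => //; exact: subspace0. Qed.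

Lemma subspaceD A x y : is_subspace A -> A x -> A y -> A (x + y).
Proof. by move=> sA Ax Ay; rewrite -[x]scale1r; exact: subspace_lin. Qed.

Lemma subspace_sum A (I : Type) (r : seq I) (F : I -> V) : is_subspace A ->
  (forall i, A (F i)) -> A (\sum_(i <- r) F i).
Proof.
move=> sA AF; elim: r => [|i r IH]; first by rewrite big_nil; exact: subspace0.
by rewrite big_cons; exact: subspaceD.
Qed.

Lemma lspan_subspace S : is_subspace (lspan S).
Proof.
split=> [A [sA _]|a x y hx hy A [sA SA]]; first exact: subspace0.
by apply: subspace_lin => //; [exact: hx|exact: hy].
Qed.

Lemma sub_lspan S : S `<=` lspan S.
Proof. by move=> x Sx A [_ SA]; exact: SA. Qed.

Lemma lspan_min S A : is_subspace A -> S `<=` A -> lspan S `<=` A.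
Proof. by move=> sA SA x; apply. Qed.

Lemma lspan_range m (b : 'I_m -> V) :
  lspan (range b) = [set \sum_i c i *: b i | c in [set: 'I_m -> R]].
Proof.
apply/seteqP; split.
  apply: lspan_min.
    split; first by exists (fun=> 0) => //; rewrite big1 // => i _; rewrite scale0r.
    move=> a _ _ [c _ <-] [c' _ <-]; exists (fun i => a * c i + c' i) => //.
    rewrite scaler_sumr -big_split; apply: eq_bigr => i _ /=.
    by rewrite scalerDl scalerA.
  move=> _ [i _ <-]; exists (fun j => (j == i)%:R) => //.
  rewrite (bigD1 i) //= eqxx scale1r big1 ?addr0 // => j /negbTE ->.
  by rewrite scale0r.
move=> _ [c _ <-]; have sS := lspan_subspace (range b).
apply: (subspace_sum _ sS) => i; apply: (subspaceZ _ sS).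
by apply: sub_lspan; exists i.
Qed.

Lemma basis_subspace A m (b : 'I_m -> V) : is_basis A b -> is_subspace A.
Proof. by case=> _ ->; exact: lspan_subspace. Qed.

Lemma basis_mem A m (b : 'I_m -> V) i : is_basis A b -> A (b i).
Proof. by case=> _ ->; apply: sub_lspan; exists i. Qed.

Lemma basis_coord A m (b : 'I_m -> V) x : is_basis A b -> A x ->
  exists c : 'rV[R]_m, x = \sum_i c 0 i *: b i.
Proof.
case=> _ -> ; rewrite lspan_range => -[c _ <-]; exists (\row_i c i).
by apply: eq_bigr => i _; rewrite mxE.
Qed.

Lemma lin_indep_inj m (b : 'I_m -> V) (c c' : 'rV[R]_m) : lin_indep b ->
  \sum_i c 0 i *: b i = \sum_i c' 0 i *: b i -> c = c'.
Proof.
move=> lb /eqP; rewrite -subr_eq0 -sumrB => /eqP e.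
apply/rowP => i; apply/eqP; rewrite -subr_eq0; apply/eqP.
apply: (lb (fun i => c 0 i - c' 0 i)); rewrite -[RHS]e; apply: eq_bigr => j _.
by rewrite scalerBl.
Qed.

Lemma sum_mx_comb m p (b : 'I_m -> V) (c : 'rV[R]_p) (M : 'M[R]_(p, m)) :
  \sum_i c 0 i *: (\sum_k M i k *: b k) = \sum_k (c *m M) 0 k *: b k.
Proof.
under eq_bigr do rewrite scaler_sumr.
rewrite exchange_big; apply: eq_bigr => k _ /=.
by rewrite mxE scaler_suml; apply: eq_bigr => i _; rewrite scalerA.
Qed.

Lemma basis_change A m (b : 'I_m -> V) (P : 'M[R]_m) : is_basis A b -> P \in unitmx ->
  is_basis A (fun i => \sum_k P i k *: b k).
Proof.
move=> bA Pu; have [lb AE] := bA; split.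
  move=> c; pose c' := \row_i c i => e.
  have : \sum_i c' 0 i *: (\sum_k P i k *: b k) = 0.
    by rewrite -[RHS]e; apply: eq_bigr => i _; rewrite mxE.
  rewrite sum_mx_comb => /lb h i.
  have : c' *m P = 0 by apply/rowP => k; rewrite h mxE.
  move=> /(congr1 (mulmx^~ (invmx P))); rewrite mulmxK // mul0mx => /rowP/(_ i).
  by rewrite !mxE.
apply/seteqP; split=> [x /(basis_coord bA)[c ->]|].
  rewrite lspan_range; exists (fun i => (c *m invmx P) 0 i) => //.
  by rewrite sum_mx_comb mulmxKV.
apply: (lspan_min (basis_subspace bA)).
move=> _ [i _ <-]; apply: (subspace_sum _ (basis_subspace bA)) => k.
by apply: (subspaceZ _ (basis_subspace bA)); exact: (basis_mem _ bA).
Qed.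

End spans.

Section lie_set.
Context {R : realType} {V : lmodType R} (br : V -> V -> V) (L : set V).
Hypothesis L_alg : lie_subalgebra br L.
(** The laws are required on [L] only, because [lie_bracket] is linear on differentiable fields but
    not on arbitrary functions. *)
Hypothesis L_linr : forall a x y z, L x -> L y -> L z -> br z (a *: x + y) = a *: br z x + br z y.
Hypothesis L_anti : forall x y, L x -> L y -> br x y = - br y x.
Hypothesis L_jac : forall x y z, L x -> L y -> L z ->
  br x (br y z) = br (br x y) z + br y (br x z).

Let Ls : is_subspace L. Proof. by case: L_alg. Qed.
Let Lb x y : L x -> L y -> L (br x y). Proof. by case: L_alg => _; apply. Qed.

Lemma L_linl a x y z : L x -> L y -> L z -> br (a *: x + y) z = a *: br x z + br y z.
Proof.
move=> Lx Ly Lz; rewrite L_anti ?L_linr //; last exact: subspace_lin.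
by rewrite opprD -scalerN -!L_anti.
Qed.

Lemma L_br0r z : L z -> br z 0 = 0.
Proof.
move=> Lz; have L0 := subspace0 Ls.
by have := L_linr (-1) L0 L0 Lz; rewrite scaler0 addr0 scaleN1r addNr.
Qed.

Lemma L_sumr z m (c : 'I_m -> R) (b : 'I_m -> V) : L z -> (forall i, L (b i)) ->
  br z (\sum_i c i *: b i) = \sum_i c i *: br z (b i).
Proof.
move=> Lz Lbb; elim: (index_enum _) => [|i r IH]; first by rewrite !big_nil L_br0r.
rewrite !big_cons L_linr ?IH //; apply: subspace_sum => // j.
exact: subspaceZ.
Qed.

Lemma L_suml z m (c : 'I_m -> R) (b : 'I_m -> V) : L z -> (forall i, L (b i)) ->
  br (\sum_i c i *: b i) z = \sum_i c i *: br (b i) z.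
Proof.
move=> Lz Lbb; rewrite L_anti //; last first.
  by apply: subspace_sum => // j; exact: subspaceZ.
rewrite L_sumr // -sumrN; apply: eq_bigr => i _.
by rewrite (L_anti Lz) // scalerN opprK.
Qed.

Variable C : set V.
Hypothesis C_split : split_cartan_subalgebra br L C.

Let CL x : C x -> L x. Proof. by case: C_split => -[h _ _ _] _; exact: h. Qed.
Let Cs : is_subspace C. Proof. by case: C_split => -[_ [h _] _ _] _. Qed.

(* An operator that is both diagonalizable and nilpotent on [g] kills [g]. *)
Lemma Cartan_abelian h g : C h -> C g -> br h g = 0.
Proof.
move=> Ch Cg; have [[_ _ [k hk] _] dg] := C_split.
have [m [b [l [bL hb]]]] := dg h Ch.
have [c gE] := basis_coord bL (CL Cg).
have Lbi i : L (b i) by exact: (basis_mem _ bL).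
have powE j : iter j (br h) g = \sum_i (c 0 i * l i ^+ j) *: b i.
  elim: j => [|j IH]; first by rewrite /= {1}gE; apply: eq_bigr => i _; rewrite mulr1.
  rewrite iterS IH (L_sumr (fun i => c 0 i * l i ^+ j)) //; last exact: CL.
  by apply: eq_bigr => i _; rewrite hb scalerA exprSr mulrA.
have inD j : iter j (commutator br C) C (iter j (br h) g).
  elim: j => // j IH; rewrite !iterS; apply: sub_lspan.
  by exists h => //; exists (iter j (br h) g).
have := hk _ (inD k); rewrite powE /= => /(proj1 bL) c0.
rewrite gE (L_sumr (c 0)) //; last exact: CL.
apply: big1 => i _; rewrite hb scalerA; have /eqP := c0 i.
rewrite mulf_eq0 => /orP[/eqP ->|]; first by rewrite mul0r scale0r.
by rewrite expf_eq0 => /andP[_ /eqP ->]; rewrite mulr0 scale0r.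
Qed.

Lemma ad_matrix m (b : 'I_m -> V) h : is_basis L b -> L h ->
  exists M : 'M[R]_m, forall i, br h (b i) = \sum_k M i k *: b k.
Proof.
move=> bL Lh.
have /choice[c hc] : forall i, exists c : 'rV[R]_m, br h (b i) = \sum_k c 0 k *: b k.
  by move=> i; apply: (basis_coord bL); apply: Lb => //; exact: (basis_mem _ bL).
exists (\matrix_i c i) => i; rewrite hc; apply: eq_bigr => k _; by rewrite mxE.
Qed.

Lemma br_ad_matrix m (b : 'I_m -> V) h (M : 'M[R]_m) (x : 'rV[R]_m) : is_basis L b -> L h ->
  (forall i, br h (b i) = \sum_k M i k *: b k) ->
  br h (\sum_i x 0 i *: b i) = \sum_i (x *m M) 0 i *: b i.
Proof.
move=> bL Lh hM; rewrite (L_sumr (x 0)) //; last by move=> i; exact: (basis_mem _ bL).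
by under eq_bigr do rewrite hM; rewrite sum_mx_comb.
Qed.

Lemma ad_matrix_diagonalizable m (b : 'I_m -> V) h (M : 'M[R]_m) : is_basis L b -> L h ->
  (forall i, br h (b i) = \sum_k M i k *: b k) -> ad_diagonalizable br L h ->
  diagonalizable M.
Proof.
move=> bL Lh hM [p [b' [l [b'L hb']]]].
have /choice[P' hP'] : forall i, exists c : 'rV[R]_m, b' i = \sum_k c 0 k *: b k.
  by move=> i; apply: (basis_coord bL); exact: basis_mem b'L.
have /choice[Q' hQ'] : forall i, exists c : 'rV[R]_p, b i = \sum_k c 0 k *: b' k.
  by move=> i; apply: (basis_coord b'L); exact: (basis_mem _ bL).
(* The equality [p = m] is not established; [P] is rectangular with the two-sided inverse [Q], which
   suffices for diagonalisation. *)
pose P := \matrix_i P' i; pose Q := \matrix_i Q' i.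
have hP i : b' i = \sum_k P i k *: b k by rewrite hP'; apply: eq_bigr => k _; rewrite mxE.
have hQ i : b i = \sum_k Q i k *: b' k by rewrite hQ'; apply: eq_bigr => k _; rewrite mxE.
have rowsum (q r : nat) (bb : 'I_q -> V) (A : 'M[R]_(r, q)) i :
    \sum_k A i k *: bb k = \sum_k (row i A) 0 k *: bb k.
  by apply: eq_bigr => k _; rewrite mxE.
have delta (q : nat) (bb : 'I_q -> V) i : bb i = \sum_k (delta_mx 0 i : 'rV[R]_q) 0 k *: bb k.
  rewrite (bigD1 i) //= mxE !eqxx scale1r big1 ?addr0 // => j ji.
  by rewrite mxE eqxx /= (negbTE ji) scale0r.
have QP : Q *m P = 1%:M.
  apply/row_matrixP => i; rewrite row_mul row1; apply: (lin_indep_inj (proj1 bL)).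
  rewrite -sum_mx_comb -delta [RHS]hQ; apply: eq_bigr => k _; by rewrite -hP [row _ _ _ _]mxE.
have PQ : P *m Q = 1%:M.
  apply/row_matrixP => i; rewrite row_mul row1; apply: (lin_indep_inj (proj1 b'L)).
  rewrite -sum_mx_comb -delta [RHS]hP; apply: eq_bigr => k _; by rewrite -hQ [row _ _ _ _]mxE.
have PM : P *m M = diag_mx (\row_i l i) *m P.
  apply/row_matrixP => i; apply: (lin_indep_inj (proj1 bL)).
  rewrite row_mul -(br_ad_matrix _ bL Lh hM) -rowsum -hP hb' hP scaler_sumr.
  by apply: eq_bigr => k _; rewrite row_mul row_diag_mx -scalemxAl -rowE scalerA !mxE.
have Pfull : row_full P by apply/row_fullP; exists Q.
have Pfree : row_free P by apply/row_freeP; exists Q.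
apply/codiagonalizable1/codiagonalizablePfull; exists p, P => //=.
rewrite andbT; apply/diagonalizable_forPex; exists (\row_i l i).
exact: (simmxW Pfree PM).
Qed.

Variable (n : nat).
Hypothesis C_dim : has_dim C n.
Hypothesis L_dim : exists d, has_dim L d.

(** The operators [br (c j)] commute, by the Jacobi identity and since [C] is abelian, and each is
    diagonalizable; so their matrices are simultaneously diagonalizable. *)
Lemma joint_eigenbasis : exists d (b : 'I_d -> V) (lam : 'I_d -> V -> R),
  is_basis L b /\ forall h, C h -> forall i, br h (b i) = lam i h *: b i.
Proof.
have [d [b bL]] := L_dim; have [c cC] := C_dim.
have Cc i : C (c i) by exact: (basis_mem _ cC).
have /choice[M hM] : forall j, exists M : 'M[R]_d, forall i, br (c j) (b i) = \sum_k M i k *: b k.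
  by move=> j; apply: ad_matrix => //; exact: CL.
have comm i j : M i *m M j = M j *m M i.
  apply/row_matrixP => r; rewrite !rowE; move: (delta_mx _ _) => x; rewrite !mulmxA.
  apply: (lin_indep_inj (proj1 bL)).
  have [Li Lj] := (CL (Cc i), CL (Cc j)).
  have hb k : L (b k) by exact: (basis_mem _ bL).
  have Lx : L (\sum_k x 0 k *: b k) by apply: subspace_sum => // k; exact: subspaceZ.
  rewrite -(br_ad_matrix _ bL Lj (hM j)) -(br_ad_matrix _ bL Li (hM i)).
  rewrite -(br_ad_matrix _ bL Li (hM i)) -(br_ad_matrix _ bL Lj (hM j)).
  have L0 := subspace0 Ls.
  rewrite (L_jac Lj Li Lx) (Cartan_abelian (Cc j) (Cc i)).
  by rewrite (L_anti L0 Lx) (L_br0r Lx) oppr0 add0r.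
have /codiagonalizableP[P Pu /allP PD] :
    {in [seq M i | i <- enum 'I_n] &, forall A B, comm_mx A B} /\
    {in [seq M i | i <- enum 'I_n], forall A, diagonalizable A}.
  split=> [_ _ /mapP[i _ ->] /mapP[j _ ->]|_ /mapP[i _ ->]]; first exact: comm.
  apply: (ad_matrix_diagonalizable bL (CL (Cc i)) (hM i)).
  by case: C_split => _; apply.
have hD i : exists D : 'rV[R]_d, P *m M i = diag_mx D *m P.
  have /PD/= : M i \in [seq M i | i <- enum 'I_n] by rewrite map_f // mem_enum.
  by move=> /diagonalizable_forPex[D /(simmxP Pu) e]; exists D.
have [D {}hD] := choice hD.
pose b' i := \sum_k P i k *: b k.
have b'L : is_basis L b' by exact: basis_change.
have hc j i : br (c j) (b' i) = D j 0 i *: b' i.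
  have -> : b' i = \sum_k (row i P) 0 k *: b k.
    by apply: eq_bigr => k _; rewrite mxE.
  rewrite (br_ad_matrix _ bL (CL (Cc j)) (hM j)) -row_mul hD row_mul row_diag_mx.
  rewrite -scalemxAl -rowE scaler_sumr; apply: eq_bigr => k _.
  by rewrite !mxE scalerA.
have /choice[la hla] : forall h, exists la : 'I_d -> R, C h -> forall i, br h (b' i) = la i *: b' i.
  (* Off [C] the weights get the default value 0. *)
  move=> h; have [Ch|nCh] := pselect (C h); last by exists (fun=> 0) => /nCh.
  have [a hE] := basis_coord cC Ch; exists (fun i => \sum_j a 0 j * D j 0 i) => _ i.
  rewrite hE (L_suml (a 0)) => [||j]; last exact: CL.
    by rewrite scaler_suml; apply: eq_bigr => j _; rewrite hc scalerA.
  exact: (basis_mem _ b'L).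
by exists d, b', (fun i h => la h i); split=> // h Ch i; exact: hla.
Qed.

Hypothesis L_ss : forall I, lie_ideal br L I -> solvable_lie br I -> I `<=` [set 0].

(** * Transport of the Lie algebra to row vectors *)

Section coordinates.
Variables (d : nat) (b : 'I_d -> V) (bL : is_basis L b).

Definition iota (x : 'rV[R]_d) := \sum_i x 0 i *: b i.
(** Coordinates in the basis [b], with default value 0 off [L]. Row vectors give access to
    dimensions of subspaces and to traces; the results on [lie_model] are applied to the transported
    bracket [mbr]. *)
Definition coords (X : V) : 'rV[R]_d := xget 0 [set x | X = iota x].
Definition mbr x y := coords (br (iota x) (iota y)).

Lemma L_iota x : L (iota x).
Proof.
by apply: (subspace_sum _ Ls) => i; apply: (subspaceZ _ Ls); exact: (basis_mem _ bL).
Qed.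

Lemma coordsK X : L X -> iota (coords X) = X.
Proof.
move=> LX; rewrite /coords; case: xgetP => [x _ /= <-//|h].
by have [c hc] := basis_coord bL LX; have := h c; rewrite /= hc.
Qed.

Lemma iota_inj : injective iota.
Proof. move=> x y; exact: (lin_indep_inj (proj1 bL)). Qed.

Lemma iota_lin a x y : iota (a *: x + y) = a *: iota x + iota y.
Proof.
rewrite /iota scaler_sumr -big_split; apply: eq_bigr => i _ /=.
by rewrite !mxE scalerDl scalerA.
Qed.

Lemma iota0 : iota 0 = 0.
Proof. by rewrite /iota big1 // => i _; rewrite mxE scale0r. Qed.

Lemma iotaZ a x : iota (a *: x) = a *: iota x.
Proof. by rewrite -[a *: x]addr0 iota_lin iota0 addr0. Qed.

Lemma iotaN x : iota (- x) = - iota x.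
Proof. by rewrite -[in LHS]scaleN1r iotaZ scaleN1r. Qed.

Lemma iotaD x y : iota (x + y) = iota x + iota y.
Proof. by have := iota_lin 1 x y; rewrite !scale1r. Qed.

Lemma iota_sum (I : Type) (r : seq I) (F : I -> 'rV[R]_d) :
  iota (\sum_(i <- r) F i) = \sum_(i <- r) iota (F i).
Proof.
elim: r => [|i r IH]; first by rewrite !big_nil iota0.
by rewrite !big_cons iotaD IH.
Qed.

Lemma iota_mbr x y : iota (mbr x y) = br (iota x) (iota y).
Proof. by rewrite coordsK //; apply: Lb; exact: L_iota. Qed.

Lemma mbr_linr a x y z : mbr z (a *: x + y) = a *: mbr z x + mbr z y.
Proof.
apply: iota_inj; rewrite iota_lin !iota_mbr iota_lin L_linr //; exact: L_iota.
Qed.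

Lemma mbr_anti x y : mbr x y = - mbr y x.
Proof. apply: iota_inj; rewrite iotaN !iota_mbr L_anti //; exact: L_iota. Qed.

Lemma mbr_jacobi x y z : mbr x (mbr y z) = mbr (mbr x y) z + mbr y (mbr x z).
Proof. apply: iota_inj; rewrite iotaD !iota_mbr L_jac //; exact: L_iota. Qed.

Lemma iota_ideal (I : {vspace 'rV[R]_d}) : ideal mbr I ->
  lie_ideal br L [set iota x | x in [set x | x \in I]].
Proof.
move=> iI; split.
- split; first by exists 0; [exact: mem0v|exact: iota0].
  move=> a _ _ [x xI <-] [y yI <-]; exists (a *: x + y); last exact: iota_lin.
  by apply: memvD => //; exact: memvZ.
- by move=> _ [x _ <-]; exact: L_iota.
move=> X _ LX [x xI <-]; exists (mbr (coords X) x); first exact: iI.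
by rewrite iota_mbr coordsK.
Qed.

Lemma mbr_no_abelian (I : {vspace 'rV[R]_d}) : ideal mbr I ->
  (forall x y, x \in I -> y \in I -> mbr x y = 0) -> I = 0%VS.
Proof.
move=> iI abI; have I0 := L_ss (iota_ideal iI).
apply/eqP; rewrite -subv0; apply/subvP => x xI; rewrite memv0; apply/eqP/iota_inj.
rewrite iota0; apply: I0; last by exists x.
exists 1%N; rewrite /= /commutator; apply: lspan_min.
  by split=> // a _ _ -> ->; rewrite scaler0 addr0.
by move=> _ [_ [u uI <-] [_ [v vI <-] <-]]; rewrite -iota_mbr abI // iota0.
Qed.

(** This produces the input of [perfect_vanish]: a basis of a nonzero perfect ideal inside [K],
    whose members are combinations of their own brackets. *)
Lemma perfect_family (K : set V) : lie_ideal br L K -> (exists2 X, K X & X != 0) ->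
  exists m (X : 'I_m -> V) (c : 'I_m -> 'I_m -> 'I_m -> R),
    [/\ forall i, K (X i), exists i, X i != 0 &
      forall l, X l = \sum_i \sum_j c l i j *: br (X i) (X j)].
Proof.
move=> [Ks KL Kid] [X0 KX0 X00].
have [I0 hI0] : exists I : {vspace 'rV[R]_d}, forall x, x \in I <-> K (iota x).
  (* The set [K] is converted into a [{vspace}] as a subspace of largest dimension among those
     contained in it. *)
  pose P (A : {vspace 'rV[R]_d}) := forall x, x \in A -> K (iota x).
  have P0 : P 0%VS by move=> x; rewrite memv0 => /eqP ->; rewrite iota0; exact: subspace0.
  have [A PA maxA] := vspace_le_max P0; exists A => x; split; first exact: PA.
  move=> Kx; have : P (A + <[x]>)%VS.
    move=> _ /memv_addP[a aA [_ /vlineP[t ->] ->]]; rewrite iotaD iotaZ.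
    by apply: (subspaceD Ks); [exact: PA|exact: subspaceZ].
  move/maxA => h; have /eqP e : A == (A + <[x]>)%VS by rewrite eqEdim addvSl h.
  by rewrite e (subvP (addvSr A <[x]>)) // memv_line.
have iI0 : ideal mbr I0.
  by move=> x y /hI0 Ky; apply/hI0; rewrite iota_mbr; apply: Kid => //; exact: L_iota.
have I00 : I0 != 0%VS.
  apply/eqP => e; have : coords X0 \in I0 by apply/hI0; rewrite coordsK //; exact: KL.
  rewrite e memv0 => /eqP c0; move: X00; rewrite -(coordsK (KL _ KX0)) c0 iota0.
  by rewrite eqxx.
have [J [iJ JI J0 JJ]] := perfect_sub mbr_linr mbr_anti mbr_jacobi mbr_no_abelian iI0 I00.
pose v := vbasis J; pose X (i : 'I_(\dim J)) := iota (v`_i).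
have vJ (i : 'I_(\dim J)) : v`_i \in J by apply: vbasis_mem; apply: mem_nth; rewrite size_tuple.
have : exists c : 'I_(\dim J) -> 'I_(\dim J) -> 'I_(\dim J) -> R, forall l : 'I_(\dim J),
    v`_l = \sum_i \sum_j c l i j *: mbr v`_i v`_j.
  suff /choice[c hc] : forall l : 'I_(\dim J), exists c : 'I_(\dim J) -> 'I_(\dim J) -> R,
      v`_l = \sum_i \sum_j c i j *: mbr v`_i v`_j by exists c.
  move=> l; have : v`_l \in derived mbr J by rewrite JJ.
  suff h A : (forall x y, x \in J -> y \in J -> exists c : 'I_(\dim J) -> 'I_(\dim J) -> R,
        mbr x y = \sum_i \sum_j c i j *: mbr v`_i v`_j) ->
      A \in derived mbr J -> exists c : 'I_(\dim J) -> 'I_(\dim J) -> R,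
        A = \sum_i \sum_j c i j *: mbr v`_i v`_j.
    apply: h => x y xJ yJ; exists (fun i j => coord v i x * coord v j y).
    rewrite {1}(coord_vbasis xJ) {1}(coord_vbasis yJ).
    rewrite (br_suml mbr_linr mbr_anti); apply: eq_bigr => i _.
    rewrite (br_sumr mbr_linr); apply: eq_bigr => j _.
    by rewrite (brZl mbr_linr mbr_anti) (brZr mbr_linr) scalerA.
  move=> hxy; pose s := in_tuple [seq mbr x y | x <- vbasis J, y <- vbasis J].
  rewrite -[derived mbr J]/(span s) => /coord_span ->.
  have hs (i : 'I_(size [seq mbr x y | x <- vbasis J, y <- vbasis J])) :
      exists c : 'I_(\dim J) -> 'I_(\dim J) -> R, s`_i = \sum_i \sum_j c i j *: mbr v`_i v`_j.
    have : s`_i \in (s : seq _) by apply: mem_nth; exact: ltn_ord.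
    by move=> /allpairsP[[x y] /= [/vbasis_mem xJ /vbasis_mem yJ ->]]; exact: hxy.
  have [c hc] := choice hs.
  exists (fun i j => \sum_k coord s k A * c k i j).
  under eq_bigr do rewrite hc scaler_sumr.
  rewrite exchange_big; apply: eq_bigr => i _ /=.
  under eq_bigr do rewrite scaler_sumr.
  rewrite exchange_big; apply: eq_bigr => j _ /=.
  by rewrite scaler_suml; apply: eq_bigr => k _; rewrite scalerA.
move=> [c hc]; exists (\dim J), (fun i => X i), c; split.
- by move=> i; apply/hI0; exact: (subvP JI).
- have dJ : (0 < \dim J)%N by rewrite lt0n dimv_eq0.
  exists (Ordinal dJ); apply/eqP => e; have : v`_0 = 0 by apply: iota_inj; rewrite iota0.
  have : free v by exact: basis_free (vbasisP J).
  move=> /free_not0; move/(_ v`_0 (mem_nth _ _)); rewrite size_tuple => /(_ dJ) /eqP.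
  by [].
move=> l; rewrite /X hc iota_sum; apply: eq_bigr => i _.
rewrite iota_sum; apply: eq_bigr => j _; by rewrite iotaZ iota_mbr.
Qed.

Variable lam : 'I_d -> V -> R.
Hypothesis hlam : forall h, C h -> forall i, br h (b i) = lam i h *: b i.

Let Cm x := C (iota x).
Let lamm i x := lam i (iota x).

Lemma Cm_lin a x y : Cm x -> Cm y -> Cm (a *: x + y).
Proof. by move=> Cx Cy; rewrite /Cm iota_lin; exact: subspace_lin. Qed.

Lemma Cm_diag h : Cm h -> forall x, mbr h x = \row_i (lamm i h * x 0 i).
Proof.
move=> Ch x; apply: iota_inj; rewrite iota_mbr {2}/iota (L_sumr (x 0)).
- rewrite /iota; apply: eq_bigr => i _; by rewrite hlam // scalerA mxE mulrC.
- exact: L_iota.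
- by move=> i; exact: (basis_mem _ bL).
Qed.

Lemma Cm_centralizer x : (forall c, Cm c -> mbr c x = 0) -> Cm x.
Proof.
move=> h; have [[_ _ _ Cn] _] := C_split; apply: Cn; first exact: L_iota.
move=> c Cc; rewrite L_anti; [|exact: L_iota|exact: CL].
have cE := coordsK (CL Cc).
rewrite -{1}cE -iota_mbr h; last by rewrite /Cm cE.
by rewrite iota0 oppr0; exact: subspace0.
Qed.

Lemma Cartan_zero h : C h -> (forall i, lam i h = 0) -> h = 0.
Proof.
move=> Ch l0; have hE := coordsK (CL Ch).
rewrite -hE (_ : coords h = 0) ?iota0 //.
have Cmh : Cm (coords h) by rewrite /Cm hE.
apply: (killing_definite mbr_linr mbr_anti mbr_no_abelian Cm_diag Cmh).
rewrite (killing_Cartan Cm_diag Cmh) big1 // => i _.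
by rewrite /lamm hE l0 expr0n.
Qed.

Lemma lin_indep_neq0 i : b i != 0.
Proof.
apply/eqP => bi0; have := proj1 bL (fun j => (j == i)%:R).
have -> : \sum_j (j == i)%:R *: b j = 0.
  apply: big1 => j _; case: eqP => [->|_]; last by rewrite scale0r.
  by rewrite bi0 scaler0.
by move=> /(_ erefl i) /eqP; rewrite eqxx oner_eq0.
Qed.

Lemma Cartan_normal x : L x -> (forall y, C y -> br y x = 0) -> C x.
Proof.
move=> Lx h; have [[_ _ _ Cn] _] := C_split; apply: Cn => // y Cy.
by rewrite L_anti //; [rewrite h // oppr0; exact: subspace0|exact: CL].
Qed.

Lemma lam_lin k t g h : C g -> C h -> lam k (t *: g + h) = t * lam k g + lam k h.
Proof.
move=> Cg Ch; have Lbk : L (b k) by exact: (basis_mem _ bL).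
have := L_linl t (CL Cg) (CL Ch) Lbk; rewrite !hlam //; last exact: subspace_lin.
rewrite scalerA -scalerDl => /eqP; rewrite -subr_eq0 -scalerBl scaler_eq0.
by rewrite (negbTE (lin_indep_neq0 k)) orbF subr_eq0 => /eqP.
Qed.

(* The sum of the fundamental coweights is regular: a root takes an integer value on it, its
   height, which is nonzero because the coefficients of a root have the same sign. *)
Lemma Cartan_regular (alpha : 'I_n -> V -> R) h0 : simple_roots br L C alpha ->
  C h0 -> (forall i, alpha i h0 = 1) -> forall x, mbr (coords h0) x = 0 -> Cm x.
Proof.
move=> [_ _ span_roots] Ch0 a1 x; have h0E := coordsK (CL Ch0).
rewrite Cm_diag => [/rowP x0|]; last by rewrite /Cm h0E.
apply: (subspace_sum _ Cs) => k.
have [->|xk] := eqVneq (x 0 k) 0; first by rewrite scale0r; exact: subspace0.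
apply: (subspaceZ _ Cs).
have Lbk : L (b k) by exact: (basis_mem _ bL).
have lk0 : lam k h0 = 0.
  by have /eqP := x0 k; rewrite !mxE mulf_eq0 (negbTE xk) orbF /lamm h0E => /eqP.
apply: Cartan_normal => // y Cy; rewrite hlam //.
have [->|lky] := eqVneq (lam k y) 0; first by rewrite scale0r.
have rk : is_root br L C (lam k).
  split; [exact: lam_lin|by exists y|].
  exists (b k); last exact: lin_indep_neq0.
  by split=> // z Cz; exact: hlam.
have ksum0 (m : 'I_n -> nat) : \sum_i (m i)%:R * alpha i h0 = 0 -> forall i, m i = 0%N.
  move=> /eqP; under eq_bigr do rewrite a1 mulr1.
  by rewrite psumr_eq0 // => /allP m0 i; have := m0 i (mem_index_enum i); rewrite pnatr_eq0 => /eqP.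
have [m [lm|lm]] := span_roots _ rk.
  have m0 := ksum0 m (etrans (esym (lm _ Ch0)) lk0).
  by move: lky; rewrite lm // big1 ?eqxx // => i _; rewrite m0 mul0r.
have m0 : forall i, m i = 0%N.
  by apply: ksum0; apply/eqP; rewrite -oppr_eq0 -lm // lk0.
by move: lky; rewrite lm // big1 ?oppr0 ?eqxx // => i _; rewrite m0 mul0r.
Qed.

Lemma lspan1 (e : V) : lspan [set e] = [set t *: e | t in [set: R]].
Proof.
apply/seteqP; split.
  apply: lspan_min.
    split; first by exists 0; rewrite ?scale0r.
    by move=> a _ _ [t _ <-] [s _ <-]; exists (a * t + s) => //; rewrite scalerDl scalerA.
  by move=> _ ->; exists 1; rewrite ?scale1r.
move=> _ [t _ <-]; apply: (subspaceZ _ (lspan_subspace _)); exact: sub_lspan.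
Qed.

(** The [h i] are the fundamental coweights and will become the coordinate fields; the
    [br (e i) (f i)] are the coroots. That both families span [C] yields the equality of spans in
    the theorem. *)
Lemma simple_root_sl2 (alpha : 'I_n -> V -> R) : simple_roots br L C alpha ->
  exists h e f : 'I_n -> V,
  [/\ forall i, C (h i) /\ forall j, alpha j (h i) = (j == i)%:R,
      forall x, C x -> x = \sum_i alpha i x *: h i,
      forall i, root_space br L C (alpha i) = lspan [set e i] /\
        root_space br L C (fun h => - alpha i h) = lspan [set f i],
      forall i, [/\ e i != 0, f i != 0, C (br (e i) (f i)) & alpha i (br (e i) (f i)) = 2] &
      forall x, C x -> exists c : 'I_n -> R, x = \sum_i c i *: br (e i) (f i)].
Proof.
move=> [roots indep span_roots]; have [c cC] := C_dim.
have Cc i : C (c i) by exact: (basis_mem _ cC).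
have alin i : forall t g h, C g -> C h -> alpha i (t *: g + h) = t * alpha i g + alpha i h.
  by have [] := roots i.
have a0 i : alpha i 0 = 0.
  by have := alin i (-1) 0 0 (subspace0 Cs) (subspace0 Cs); rewrite scaler0 addr0 mulN1r addNr.
have asum i m (t : 'I_m -> R) (g : 'I_m -> V) : (forall j, C (g j)) ->
    alpha i (\sum_j t j *: g j) = \sum_j t j * alpha i (g j).
  move=> Cg; elim: (index_enum _) => [|j r IH]; first by rewrite !big_nil a0.
  rewrite !big_cons alin ?IH //; apply: (subspace_sum _ Cs) => k; exact: subspaceZ.
(* Square, as there are [n = dim C] simple roots, and invertible by their independence on [C]; the
   columns of the inverse give the dual basis. *)
pose M := \matrix_(i, j) alpha i (c j).
have Mu : M \in unitmx.
  rewrite -row_free_unit; apply/row_freeP; suff : row_free M by move/row_freeP.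
  rewrite -kermx_eq0; apply/eqP/row_matrixP => r; rewrite row0.
  have := mulmx_ker M; move/(congr1 (row r)); rewrite row_mul row0.
  move: (row r _) => u uM; apply/rowP => i; rewrite mxE; apply: (indep (u 0)) => x Cx.
  have [t ->] := basis_coord cC Cx.
  under eq_bigr do rewrite asum // mulr_sumr.
  rewrite exchange_big big1 // => j _ /=.
  transitivity (t 0 j * (u *m M) 0 j); last by rewrite uM mxE mulr0.
  by rewrite mxE mulr_sumr; apply: eq_bigr => k _; rewrite mxE mulrCA.
pose h i := \sum_j invmx M j i *: c j.
have Ch i : C (h i) by apply: (subspace_sum _ Cs) => j; exact: subspaceZ.
have ah i j : alpha j (h i) = (j == i)%:R.
  rewrite asum //; have := congr1 (fun A : 'M[R]_n => A j i) (mulmxV Mu); rewrite !mxE => <-.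
  by apply: eq_bigr => k _; rewrite !mxE mulrC.
have char0 y : C y -> (forall j, alpha j y = 0) -> y = 0.
  move=> Cy ay; have [t yE] := basis_coord cC Cy.
  have tM : t *m M^T = 0.
    apply/rowP => j; rewrite !mxE -[RHS](ay j) yE asum //.
    by apply: eq_bigr => k _; rewrite !mxE.
  have MTu : M^T \in unitmx by rewrite unitmx_tr.
  have t0 : t = 0 by rewrite -(mulmxK MTu t) tM mul0mx.
  by rewrite yE t0 big1 // => i _; rewrite mxE scale0r.
have Cspan x : C x -> x = \sum_i alpha i x *: h i.
  move=> Cx; apply/eqP; rewrite -subr_eq0 addrC -scaleN1r; apply/eqP; apply: char0.
    apply: subspace_lin => //; apply: (subspace_sum _ Cs) => i; exact: subspaceZ.
  move=> j; rewrite alin //; last by apply: (subspace_sum _ Cs) => i; exact: subspaceZ.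
  rewrite asum // (bigD1 j) //= ah eqxx mulr1 big1 ?addr0 ?mulN1r ?addNr // => i ij.
  by rewrite ah eq_sym (negbTE ij) mulr0.
(* The sum of the coweights is the regular element. The factor 1 gives it the shape to which [asum]
   applies. *)
pose h0 := \sum_i 1 *: h i.
have Ch0 : C h0 by apply: (subspace_sum _ Cs) => i; exact: subspaceZ.
have ah0 j : alpha j h0 = 1.
  rewrite asum // (bigD1 j) //= ah eqxx mulr1 big1 ?addr0 // => i ij.
  by rewrite ah eq_sym (negbTE ij) mulr0.
have reg := Cartan_regular (And3 roots indep span_roots) Ch0 ah0.
have Cmh0 : Cm (coords h0) by rewrite /Cm coordsK //; exact: CL.
have triple i : exists ef : 'rV[R]_d * 'rV[R]_d,
   [/\ root_vec mbr Cm (fun x => alpha i (iota x)) ef.1, ef.1 != 0,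
       root_vec mbr Cm (fun x => - alpha i (iota x)) ef.2,
       [/\ Cm (mbr ef.1 ef.2), alpha i (iota (mbr ef.1 ef.2)) = 2 & killing mbr ef.1 ef.2 != 0] &
       (forall x, root_vec mbr Cm (fun x => alpha i (iota x)) x -> exists t, x = t *: ef.1) /\
       (forall x, root_vec mbr Cm (fun x => - alpha i (iota x)) x -> exists t, x = t *: ef.2)].
  have [_ [c0 Cc0 ac0] [x [Lx rx] x0]] := roots i.
  have re : root_vec mbr Cm (fun x => alpha i (iota x)) (coords x).
    by move=> y Cy; apply: iota_inj; rewrite iota_mbr iotaZ coordsK // rx.
  have e0 : coords x != 0.
    by apply/eqP => e; move: x0; rewrite -(coordsK Lx) e iota0 eqxx.
  have cex : exists2 c, Cm c & alpha i (iota c) != 0.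
    by exists (coords c0); rewrite /Cm coordsK //; exact: CL.
  have al t g y : Cm g -> Cm y -> alpha i (iota (t *: g + y)) = t * alpha i (iota g) + alpha i (iota y).
    by move=> Cg Cy; rewrite iota_lin alin.
  have [f [rf Cf a2 kf [l1 l2]]] := sl2_triple mbr_linr mbr_anti mbr_jacobi mbr_no_abelian
    Cm_lin Cm_diag Cm_centralizer Cmh0 reg re e0 cex al.
  by exists (coords x, f); split.
have {triple}[ef hef] := choice triple.
pose e i := iota (ef i).1; pose f i := iota (ef i).2.
exists h, e, f.
have rootspace (a : V -> R) (u : 'rV[R]_d) : root_vec mbr Cm (fun x => a (iota x)) u ->
    (forall x, root_vec mbr Cm (fun x => a (iota x)) x -> exists t, x = t *: u) ->
    root_space br L C a = lspan [set iota u].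
  move=> ru hu; rewrite lspan1; apply/seteqP; split=> [X [LX rX]|_ [t _ <-]].
    have [t cX] : exists t, coords X = t *: u.
      by apply: hu => y Cy; apply: iota_inj; rewrite iota_mbr iotaZ coordsK // rX.
    by exists t => //; rewrite -iotaZ -cX coordsK.
  split; first by rewrite -iotaZ; exact: L_iota.
  move=> y Cy; have yE := coordsK (CL Cy).
  have Cmy : Cm (coords y) by rewrite /Cm yE.
  rewrite -{1}yE -iotaZ -iota_mbr (brZr mbr_linr) (ru _ Cmy) !iotaZ yE.
  by rewrite !scalerA mulrC.
have iota_eq0 u : u != 0 -> iota u != 0.
  by move=> u0; apply: contra u0 => /eqP u0; apply/eqP/iota_inj; rewrite iota0.
split=> //.
- by move=> i; have [re e0 rf _ [l1 l2]] := hef i; split; exact: rootspace.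
- move=> i; have [re e0 rf [Cf a2 kf] _] := hef i; rewrite /e /f -iota_mbr; split=> //.
    exact: iota_eq0.
  apply: iota_eq0; apply/eqP => f0; move: kf; rewrite f0.
  by rewrite (killing0r mbr_linr mbr_anti) eqxx.
pose H i := mbr (ef i).1 (ef i).2.
have CH i : Cm (H i) by have [_ _ _ []] := hef i.
(* This is the Cartan matrix. A row [u] in its kernel satisfies [sum_i u_i H i = 0], as the simple
   roots separate the elements of [C]. Under the Killing form this becomes a relation between the
   simple roots with coefficients [u_i * killing e_i f_i], so [u = 0]. *)
pose A := \matrix_(i, j) alpha j (iota (H i)).
have Au : A \in unitmx.
  rewrite -row_free_unit -kermx_eq0; apply/eqP/row_matrixP => r; rewrite row0.
  have := mulmx_ker A; move/(congr1 (row r)); rewrite row_mul row0.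
  move: (row r _) => u uA; apply/rowP => i; rewrite [RHS]mxE.
  have uH : \sum_i u 0 i *: H i = 0.
    apply: iota_inj; rewrite iota0 iota_sum; apply: char0.
      by apply: (subspace_sum _ Cs) => k; rewrite iotaZ; apply: subspaceZ => //; exact: CH.
    move=> j; under eq_bigr do rewrite iotaZ; rewrite asum; last exact: CH.
    transitivity ((u *m A) 0 j); last by rewrite uA mxE.
    by rewrite mxE; apply: eq_bigr => k _; rewrite mxE.
  have [re _ rf [_ _ kf] _] := hef i.
  suff : u 0 i * killing mbr (ef i).1 (ef i).2 = 0.
    by move=> /eqP; rewrite mulf_eq0 (negbTE kf) orbF => /eqP.
  apply: (indep (fun i => u 0 i * killing mbr (ef i).1 (ef i).2)) => x Cx.
  have xE := coordsK (CL Cx); have Cmx : Cm (coords x) by rewrite /Cm xE.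
  transitivity (killing mbr (\sum_i u 0 i *: H i) (coords x)); last first.
    by rewrite uH (killing0l mbr_linr mbr_anti).
  elim: (index_enum _) => [|k s IH].
    by rewrite !big_nil (killing0l mbr_linr mbr_anti).
  rewrite !big_cons (killing_linl mbr_linr mbr_anti) -IH; congr (_ + _).
  have [rek _ rfk _ _] := hef k.
  have [_ kb] := root_bracket mbr_linr mbr_anti mbr_jacobi Cm_centralizer rek rfk.
  by rewrite kb // xE -mulrA [killing _ _ _ * _]mulrC.
move=> x Cx; exists (fun i => (\row_j alpha j x *m invmx A) 0 i).
apply/eqP; rewrite -subr_eq0 addrC -scaleN1r; apply/eqP.
have CS : C (\sum_i (\row_j alpha j x *m invmx A) 0 i *: br (e i) (f i)).
  apply: (subspace_sum _ Cs) => i; apply: subspaceZ => //.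
  by rewrite /e /f -iota_mbr; exact: CH.
apply: char0; first exact: subspace_lin.
move=> j; rewrite alin // asum => [|i]; last by rewrite /e /f -iota_mbr; exact: CH.
transitivity (- ((\row_j alpha j x *m invmx A) *m A) 0 j + alpha j x).
  rewrite mulN1r; congr (- _ + _); rewrite [RHS]mxE; apply: eq_bigr => i _.
  by rewrite [A i j]mxE /H iota_mbr.
by rewrite mulmxKV // mxE addNr.
Qed.

End coordinates.
End lie_set.

(** * Unique continuation and the rank of a Cartan subalgebra *)

Section row_space.
Context {R : realType} {N : nat}.

Lemma sum_row m (c : 'I_m -> R) (b : 'I_m -> 'rV[R]_N) :
  \sum_i c i *: b i = (\row_i c i) *m (\matrix_i b i).
Proof. by rewrite mulmx_sum_row; apply: eq_bigr => i _; rewrite mxE rowK. Qed.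

Lemma row_eta m (v : 'rV[R]_m) : \row_i v 0 i = v.
Proof. by apply/rowP => i; rewrite mxE. Qed.

Lemma lin_indep_row_free m (b : 'I_m -> 'rV[R]_N) : lin_indep b <-> row_free (\matrix_i b i).
Proof.
split=> [lb|fb c].
  rewrite -kermx_eq0; apply/rowV0P => v /sub_kermxP vb.
  by apply/rowP => i; rewrite mxE; apply: (lb (v 0)); rewrite sum_row row_eta.
rewrite sum_row -(mul0mx 1 (\matrix_i b i)) => /(row_free_inj fb) /rowP e i.
by have := e i; rewrite !mxE.
Qed.

Lemma has_dim_submx m (A : 'M[R]_(m, N)) s :
  has_dim [set v : 'rV[R]_N | (v <= A)%MS] s <-> s = \rank A.
Proof.
have span k (b : 'I_k -> 'rV[R]_N) :
    lspan (range b) = [set v : 'rV[R]_N | (v <= \matrix_i b i)%MS].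
  rewrite lspan_range; apply/seteqP; split=> v.
    by move=> [c _ <-]; rewrite sum_row /= submxMl.
  by move=> /submxP[D ->]; exists (D 0) => //; rewrite sum_row row_eta.
split=> [[b [/lin_indep_row_free fb]]|->].
  rewrite span => e.
  suff /eqmx_rank -> : (A == \matrix_i b i)%MS by rewrite (eqP fb).
  apply/andP; split; apply/row_subP => i.
    have : [set v : 'rV[R]_N | (v <= A)%MS] (row i A) by exact: row_sub.
    by rewrite e.
  have : [set v : 'rV[R]_N | (v <= \matrix_i b i)%MS] (row i (\matrix_i b i)) by exact: row_sub.
  by rewrite -e.
have bE : \matrix_i row i (row_base A) = row_base A by apply/row_matrixP => i; rewrite rowK.
exists (fun i => row i (row_base A)); split.
  by apply/lin_indep_row_free; rewrite bE; exact: row_base_free.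
by rewrite span bE; apply/funext => v /=; rewrite eq_row_base.
Qed.

End row_space.

Section combinations.
Context {R : realType} {N : nat}.
Implicit Types (X Y Z : vfield R N).

Lemma lieD_comb (U : set 'rV[R]_N) X n (G H : 'I_n -> 'rV[R]_N -> R) q : open U ->
  (forall j, Ck 1 U (G j)) -> (forall j, Ck 1 U (H j)) -> U q ->
  lieD X (fun q => \sum_j G j q * H j q) q =
  \sum_j (lieD X (G j) q * H j q + G j q * lieD X (H j) q).
Proof.
move=> Uo CG CH Uq; rewrite /lieD.
have dG j : derivable (G j) q (X q).
  by apply: diff_derivable; exact: (Ck_differentiable Uo (CG j) Uq).
have dH j : derivable (H j) q (X q).
  by apply: diff_derivable; exact: (Ck_differentiable Uo (CH j) Uq).
have -> : (fun q => \sum_j G j q * H j q) = \sum_j (fun q => G j q * H j q) by rewrite fct_sumE.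
rewrite derive_sum; last by move=> j; exact: derivableM.
apply: eq_bigr => j _; rewrite deriveM //.
have gen (a b c d : R) : a *: b + c *: d = d * c + a * b by rewrite addrC mulrC.
exact: gen.
Qed.

Lemma bracket_comb (U : set 'rV[R]_N) n (c : 'I_n -> vfield R N) X Y
    (G : 'I_n -> 'rV[R]_N -> R) q : open U ->
  (forall j, smooth_field (c j)) -> smooth_field X -> smooth_field Y ->
  (forall j, Ck 1 U (G j)) -> (forall q, U q -> X q = \sum_j G j q *: c j q) -> U q ->
  lie_bracket X Y q = \sum_j (G j q *: lie_bracket (c j) Y q - lieD Y (G j) q *: c j q).
Proof.
move=> Uo sc sX sY CG XE Uq; apply/rowP => s.
rewrite (lie_bracket_coord openT s sX sY I) summxE.
have -> : lieD X (fun q => Y q 0 s) q = \sum_j G j q * lieD (c j) (fun q => Y q 0 s) q.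
  rewrite (lieDE openT X (sY 1 s) I) XE //.
  under eq_bigr do rewrite summxE mulr_suml.
  rewrite exchange_big; apply: eq_bigr => j _ /=.
  rewrite (lieDE openT (c j) (sY 1 s) I) mulr_sumr; apply: eq_bigr => i _.
  by rewrite mxE mulrA.
have -> : lieD Y (fun q => X q 0 s) q =
    \sum_j (lieD Y (G j) q * c j q 0 s + G j q * lieD Y (fun q => c j q 0 s) q).
  rewrite -(lieD_comb Y Uo CG) => [|j|//]; last exact: (Ck_sub (@subsetT _ U) (sc j 1 s)).
  apply: (lieD_eq Uo) => // u Uu; rewrite XE // summxE; apply: eq_bigr => j _.
  by rewrite mxE.
rewrite -sumrB; apply: eq_bigr => j _.
have entry (u v : 'rV[R]_N) (a b : R) : (a *: u - b *: v) 0 s = a * u 0 s - b * v 0 s.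
  by rewrite !mxE.
rewrite entry.
rewrite (lie_bracket_coord openT s (sc j) sY I).
have gen (a b x y z : R) : a * b - (x * y + a * z) = a * (b - z) - x * y by ring.
exact: gen.
Qed.

End combinations.

Section semisimple_fields.
Context {R : realType} {N n : nat} {L C : set (vfield R N)}.
Hypothesis L_vf : L `<=` vector_field_on setT.
Hypothesis L_semisimple : semisimple_lie (@lie_bracket R N) L.

Let L_smooth X : L X -> smooth_field X.
Proof. by move=> /L_vf /smooth_fieldP. Qed.

Let L_alg : lie_subalgebra (@lie_bracket R N) L. Proof. by case: L_semisimple. Qed.
Let Ls : is_subspace L. Proof. by case: L_alg. Qed.
Let L_ss : forall I, lie_ideal (@lie_bracket R N) L I ->
  solvable_lie (@lie_bracket R N) I -> I `<=` [set 0].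
Proof. by case: L_semisimple. Qed.
Let L_dim : exists d, has_dim L d. Proof. by case: L_semisimple. Qed.

Lemma field_linr a x y z : L x -> L y -> L z ->
  lie_bracket z (a *: x + y) = a *: lie_bracket z x + lie_bracket z y.
Proof.
by move=> /L_smooth sx /L_smooth sy /L_smooth sz; exact: lie_bracket_linr.
Qed.

Lemma field_anti x y : L x -> L y -> lie_bracket x y = - lie_bracket y x.
Proof. by move=> _ _; exact: lie_bracketNC. Qed.

Lemma field_jacobi x y z : L x -> L y -> L z ->
  lie_bracket x (lie_bracket y z) =
  lie_bracket (lie_bracket x y) z + lie_bracket y (lie_bracket x z).
Proof.
move=> Lx Ly Lz; have Lb u v : L u -> L v -> L (lie_bracket u v) by case: L_alg => _; apply.
have := lie_jacobi (L_smooth Lx) (L_smooth Ly) (L_smooth Lz).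
have -> : lie_bracket y (lie_bracket z x) = - lie_bracket y (lie_bracket x z).
  rewrite [lie_bracket z x]lie_bracketNC -[- _]scaleN1r -[_ *: _]addr0.
  rewrite field_linr ?(L_br0r L_alg field_linr) ?addr0 ?scaleN1r //; last exact: subspace0.
  exact: Lb.
rewrite [lie_bracket z _]lie_bracketNC => /eqP; rewrite subr_eq0 subr_eq => /eqP.
by [].
Qed.

Lemma unique_continuation X o r : L X -> 0 < r -> (forall x, `|x - o| < r -> X x = 0) ->
  X = 0.
Proof.
move=> LX r0 X0; apply: contrapT => /eqP Xn0.
pose K := [set Y | L Y /\ forall x, `|x - o| < r -> Y x = 0].
have [d [b bL]] := L_dim.
have Ki : lie_ideal (@lie_bracket R N) L K.
  split.
  - split; first by split=> //; exact: subspace0.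
    move=> a Y Z [LY Y0] [LZ Z0]; split; first exact: subspace_lin.
    by move=> x xo; rewrite -[LHS]/(a *: Y x + Z x) Y0 // Z0 // scaler0 addr0.
  - by move=> Y [].
  move=> Y Z LY [LZ Z0]; split; first by case: L_alg => _; apply.
  move=> x xo; apply/rowP => i.
  rewrite (lie_bracket_coord openT i (L_smooth LY) (L_smooth LZ) I).
  rewrite (lieDE openT Y (L_smooth LZ 1 i) I) (lieDE openT Z (L_smooth LY 1 i) I).
  rewrite [X in _ - X]big1 => [|j _]; last by rewrite Z0 // mxE mul0r.
  rewrite big1 ?subrr ?mxE // => j _.
  rewrite (@pd_eq _ _ [set x | `|x - o| < r] _ (fun=> 0)) ?pd_cst ?mulr0 //.
    rewrite (_ : [set x | _] = ball o r); first exact: ball_open.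
    by apply/seteqP; split=> z; rewrite -ball_normE /= distrC.
  by move=> q /Z0 ->; rewrite mxE.
have [m [Z [c [KZ [i Zi0] ZE]]]] := perfect_family L_alg field_linr field_anti field_jacobi
  L_ss bL Ki (ex_intro2 _ _ X (conj LX X0) Xn0).
suff Z0 : Z i = 0 by rewrite Z0 eqxx in Zi0.
apply/funext => p; have sZ j : smooth_field (Z j) by apply: L_smooth; case: (KZ j).
apply: (@perfect_vanish _ _ _ Z sZ c _ o r) => //; last first.
  by move=> x xo j; case: (KZ j) => _; exact.
by move=> l q; rewrite {1}ZE fct_sumE; apply: eq_bigr => j _; rewrite fct_sumE.
Qed.

Hypothesis C_split : split_cartan_subalgebra (@lie_bracket R N) L C.
Variable c : 'I_n -> vfield R N.
Hypothesis cC : is_basis C c.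

Let CL x : C x -> L x. Proof. by case: C_split => -[h _ _ _] _; exact: h. Qed.
Let Cs : is_subspace C. Proof. by case: C_split => -[_ [h _] _ _] _. Qed.
Let Cc i : C (c i). Proof. exact: (basis_mem _ cC). Qed.
Let csm i : smooth_field (c i). Proof. by apply: L_smooth; exact: CL. Qed.

Definition basis_at (q : 'rV[R]_N) : 'M[R]_(n, N) := \matrix_i c i q.

Lemma comb_at (t : 'rV[R]_n) q : (\sum_i t 0 i *: c i) q = t *m basis_at q.
Proof. by rewrite fct_sumE /basis_at -[in RHS](row_eta t) -sum_row. Qed.

Lemma leaf_submx q : [set X q | X in C] = [set v : 'rV[R]_N | (v <= basis_at q)%MS].
Proof.
apply/seteqP; split=> [_ [X CX <-]|v /submxP[t ->]].
  by have [t ->] := basis_coord cC CX; rewrite comb_at /= submxMl.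
exists (\sum_i t 0 i *: c i); last exact: comb_at.
by apply: (subspace_sum _ Cs) => i; apply: (subspaceZ _ Cs).
Qed.

Lemma leaf_dimP q s : has_leaf_dim C q s <-> s = \rank (basis_at q).
Proof. by rewrite /has_leaf_dim leaf_submx; exact: has_dim_submx. Qed.

(* Where the rank [r] of the Cartan fields is maximal, every one of them is a combination of [r]
   fixed ones with smooth coefficients. *)
Lemma max_rank_comb p : (forall q, (\rank (basis_at q) <= \rank (basis_at p))%N) ->
  exists (U : set 'rV[R]_N) (P : 'M[R]_(\rank (basis_at p), n))
    (F : 'rV[R]_N -> 'M[R]_(n, \rank (basis_at p))),
  [/\ open U /\ U p, forall k i j, Ck k U (fun q => F q i j),
      forall q, U q -> basis_at q = F q *m P *m basis_at q &
      forall q, U q -> row_free (P *m basis_at q)].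
Proof.
set r := \rank (basis_at p) => pmax.
(* [P] and [Q] cut out of [basis_at] a block of size [r] that is the identity at [p], hence
   invertible near [p]. They are constant matrices, so inverting the block gives smooth
   coefficients. *)
pose P : 'M[R]_(r, n) := pid_mx r *m invmx (col_ebase (basis_at p)).
pose Q : 'M[R]_(N, r) := invmx (row_ebase (basis_at p)) *m pid_mx r.
have rn : (r <= n)%N by exact: rank_leq_row.
have rN : (r <= N)%N by exact: rank_leq_col.
have PQ : P *m basis_at p *m Q = 1%:M.
  rewrite /P /Q -{2}(mulmx_ebase (basis_at p)) !mulmxA.
  rewrite mulmxKV ?col_ebase_unit // mulmxK ?row_ebase_unit //.
  by rewrite pid_mx_id // pid_mx_id // pid_mx_1.
have Cb k i j : Ck k setT (fun q => basis_at q i j).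
  by apply: (@Ck_eq _ _ _ _ (fun q => c i q 0 j)) => [|q _|]; [exact: openT|rewrite mxE|exact: csm].
have Ccst k m1 m2 (A : 'M[R]_(m1, m2)) i j : Ck k [set: 'rV[R]_N] (fun=> A i j).
  exact: Ck_cst.
pose B q := P *m basis_at q *m Q.
have CB k i j : Ck k setT (fun q => B q i j).
  apply: (Ck_mulmx openT) => i' j'; last exact: Ccst.
  by apply: (Ck_mulmx openT) => i'' j''; [exact: Ccst|exact: Cb].
pose U := [set q | [set: 'rV[R]_N] q /\ \det (B q) != 0].
have Uo : open U.
  apply: (open_nonzero openT) => q _.
  exact: (Ck_continuous (Ck_det openT (CB 0)) I).
have CBi k i j : Ck k U (fun q => invmx (B q) i j).
  apply: (Ck_invmx Uo) => [u []//|i' j'].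
  exact: (Ck_sub (@subsetT _ U) (CB k i' j')).
have Bu q : U q -> B q \in unitmx by case=> _; rewrite unitmxE unitfE.
have fP q : U q -> row_free (P *m basis_at q).
  move=> Uq; apply/row_freeP; exists (Q *m invmx (B q)).
  by rewrite mulmxA mulmxV // Bu.
exists U, P, (fun q => basis_at q *m Q *m invmx (B q)); split=> //.
- by split=> //; split=> //; rewrite /B PQ det1 oner_neq0.
- move=> k; apply: (Ck_mulmx Uo) => i' j'; last exact: CBi.
  apply: (Ck_mulmx Uo) => i'' j''; last exact: Ck_cst.
  exact: (Ck_sub (@subsetT _ U) (Cb k i'' j'')).
(* The [r] rows of [P *m basis_at q] are independent and [r] is the maximal rank, so they span the
   whole row space. *)
move=> q Uq; have /submxP[D DE] : (basis_at q <= P *m basis_at q)%MS.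
  rewrite -(mxrank_leqif_sup (submxMl P (basis_at q))) eqn_leq mxrankS ?submxMl //=.
  by rewrite (eqP (fP q Uq)) pmax.
have -> : basis_at q *m Q *m invmx (B q) = D.
  by rewrite {1}DE -(mulmxA D) mulmxK // Bu.
by rewrite -mulmxA.
Qed.

Lemma max_rank_full p : (forall q, (\rank (basis_at q) <= \rank (basis_at p))%N) ->
  \rank (basis_at p) = n.
Proof.
move=> pmax; have [U [P [F [[Uo Up] CF FE fP]]]] := max_rank_comb pmax.
have Cdim : has_dim C n by exists c.
have [d [b [lam [bL hlam]]]] := joint_eigenbasis L_alg field_linr field_anti field_jacobi
  C_split Cdim L_dim.
have Lb k : L (b k) by exact: (basis_mem _ bL).
pose G q := F q *m P.
have CG k i j : Ck k U (fun q => G q i j).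
  by apply: (Ck_mulmx Uo) => // i' j'; exact: Ck_cst.
have cE i q : U q -> c i q = \sum_j G q i j *: c j q.
  move=> Uq; have := congr1 (row i) (FE q Uq); rewrite rowK row_mul => ->.
  by rewrite mulmx_sum_row; apply: eq_bigr => j _; rewrite rowK mxE.
(* The bracket of [c i] with the eigenvector [b k], computed once by its weight and once by the
   Leibniz rule. *)
have comb0 k q : U q -> forall i, (lam k (c i) - \sum_j G q i j * lam k (c j)) *: b k q =
    - \sum_j lieD (b k) (fun q => G q i j) q *: c j q.
  move=> Uq i.
  have := bracket_comb Uo csm (csm i) (L_smooth (Lb k)) (fun j => CG 1 i j) (cE i) Uq.
  rewrite hlam // sumrB -[(_ *: b k) q]/(_ *: b k q) => e.
  rewrite scalerBl e scaler_suml addrAC.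
  under eq_bigr do rewrite hlam //.
  rewrite [X in X + _ = _](_ : _ = 0) ?add0r //.
  apply/eqP; rewrite subr_eq0; apply/eqP/eq_bigr => j _.
  by rewrite -[(_ *: b k) q]/(_ *: b k q) scalerA.
(* Coefficients with respect to all [n] fields are not unique, but those in [F], with respect to the
   independent rows of [P *m basis_at q], are. Hence the relation that comes from commutativity of
   [C] forces their derivatives to vanish. *)
have dF m q : U q -> forall i s, lieD (c m) (fun q => F q i s) q = 0.
  move=> Uq i.
  have := bracket_comb Uo csm (csm i) (csm m) (fun j => CG 1 i j) (cE i) Uq.
  rewrite (Cartan_abelian L_alg field_linr C_split (Cc i) (Cc m)) => e.
  have : (\row_s lieD (c m) (fun q => F q i s) q) *m (P *m basis_at q) = 0.
    transitivity (\sum_j lieD (c m) (fun q => G q i j) q *: c j q).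
      rewrite mulmxA mulmx_sum_row; apply: eq_bigr => j _; rewrite rowK; congr (_ *: _).
      rewrite [LHS]mxE.
      have -> : (fun q => G q i j) = (fun q => \sum_s F q i s * P s j).
        by apply/funext => u; rewrite [LHS]mxE.
      rewrite (lieD_comb _ Uo (fun s => CF 1 i s) (fun s => Ck_cst 1 U (P s j))) //.
      apply: eq_bigr => s _; rewrite mxE [X in _ + X](_ : _ = 0) ?addr0 //.
      by rewrite /lieD derive_cst mulr0.
    apply/eqP; rewrite -oppr_eq0 -sumrN; apply/eqP; apply: (etrans _ (esym e)).
    apply: eq_bigr => j _.
    by rewrite (Cartan_abelian L_alg field_linr C_split (Cc j) (Cc m)) scaler0 sub0r.
  rewrite -[RHS](mul0mx 1 (P *m basis_at q)) => /(row_free_inj (fP q Uq)) /rowP h s.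
  by have := h s; rewrite !mxE.
pose g k i q := lam k (c i) - \sum_j G q i j * lam k (c j).
have gb k i q : U q -> g k i q = 0 \/ b k q = 0.
  move=> Uq; have [g0|gn0] := eqVneq (g k i q) 0; [by left|right].
  (* Where [g k i] is nonzero, [comb0] can be solved for [b k q], which is thus tangent to the leaf
     of [C]. The coefficients then have derivative zero along [b k] as well, and [comb0] leaves
     [b k q = 0]. *)
  have [t bE] : exists t : 'I_n -> R, b k q = \sum_m t m *: c m q.
    exists (fun m => - (g k i q)^-1 * lieD (b k) (fun q => G q i m) q).
    under eq_bigr do rewrite -scalerA.
    rewrite -scaler_sumr scaleNr -scalerN -comb0 // scalerA mulVf // scale1r //.
  have db f : Ck 1 U f -> (forall m, lieD (c m) f q = 0) -> lieD (b k) f q = 0.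
    move=> Cf cf; rewrite (lieDE Uo _ Cf Uq) bE.
    under eq_bigr do rewrite summxE mulr_suml.
    rewrite exchange_big big1 // => m _ /=.
    transitivity (t m * lieD (c m) f q); last by rewrite cf mulr0.
    rewrite (lieDE Uo _ Cf Uq) mulr_sumr; apply: eq_bigr => j _.
    by rewrite mxE mulrA.
  have dG j : lieD (b k) (fun q => G q i j) q = 0.
    have -> : (fun q => G q i j) = (fun q => \sum_s F q i s * P s j).
      by apply/funext => u; rewrite [LHS]mxE.
    rewrite (lieD_comb _ Uo (fun s => CF 1 i s) (fun s => Ck_cst 1 U (P s j))) //.
    apply: big1 => s _; rewrite /lieD derive_cst mulr0 addr0.
    rewrite -[X in X * _]/(lieD (b k) (fun q => F q i s) q) db ?mul0r // => m.
    exact: dF.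
  have := comb0 k q Uq i; rewrite [RHS](_ : _ = 0); last first.
    by rewrite big1 ?oppr0 // => j _; rewrite dG scale0r.
  by move=> /eqP; rewrite scaler_eq0 -/(g k i q) (negbTE gn0) => /eqP.
have gp0 k i : g k i p = 0.
  apply/eqP; apply: contraT => gp.
  have Cg : Ck 0 U (g k i).
    apply: CkB => //; first exact: Ck_cst.
    apply: Ck_sum => // j; apply: CkM => //; exact: Ck_cst.
  have [e e0 he] := open_radius (open_nonzero Uo (fun q => Ck_continuous Cg)) (conj Up gp).
  have b0 : b k = 0.
    apply: (unique_continuation (Lb k) e0) => x /he[Ux gx].
    by have [/eqP|//] := gb k i x Ux; rewrite (negbTE gx).
  by have := lin_indep_neq0 bL k; rewrite b0 eqxx.
(* By [gp0] the fields [c i] and [sum_j G p i j *: c j] have the same weights, so they agree by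
   [Cartan_zero]. As [G p] factors through dimension [\rank (basis_at p)], this forces full rank. *)
have GP1 : G p = 1%:M.
  apply/row_matrixP => i; rewrite row1.
  apply: (lin_indep_inj (proj1 cC)).
  transitivity (c i); last first.
    rewrite (bigD1 i) //= mxE !eqxx scale1r big1 ?addr0 // => j ji.
    by rewrite mxE eqxx /= (negbTE ji) scale0r.
  under eq_bigr do rewrite mxE.
  have llin k := lam_lin L_alg field_linr field_anti C_split bL hlam k.
  have lam0 k : lam k 0 = 0.
    have := llin k (-1) 0 0 (subspace0 Cs) (subspace0 Cs).
    by rewrite scaler0 addr0 mulN1r addNr.
  have CS : C (\sum_j G p i j *: c j).
    by apply: (subspace_sum _ Cs) => j; apply: (subspaceZ _ Cs).
  have lamS k : lam k (\sum_j G p i j *: c j) = \sum_j G p i j * lam k (c j).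
    elim: (index_enum _) => [|j s IH]; first by rewrite !big_nil lam0.
    rewrite !big_cons llin ?IH //; apply: (subspace_sum _ Cs) => m.
    by apply: (subspaceZ _ Cs).
  have X0 : -1 *: (\sum_j G p i j *: c j) + c i = 0.
    apply: (Cartan_zero L_alg field_linr field_anti C_split L_ss bL hlam).
      exact: subspace_lin.
    by move=> k; rewrite llin // lamS mulN1r addrC; exact: gp0.
  by apply/esym/eqP; rewrite -subr_eq0 addrC -scaleN1r X0.
apply/eqP; rewrite eqn_leq rank_leq_row /=.
rewrite -[X in (X <= _)%N](mxrank1 R) -GP1 /G.
exact: (leq_trans (mxrankM_maxl _ _) (rank_leq_col _)).
Qed.

End semisimple_fields.

(** * Copies of sl(2, R) *)

Section sl2.
Context {R : realType} {V : lmodType R} {br : V -> V -> V} {L : set V}.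
Hypothesis L_alg : lie_subalgebra br L.
Hypothesis L_linr : forall a x y z, L x -> L y -> L z -> br z (a *: x + y) = a *: br z x + br z y.
Hypothesis L_anti : forall x y, L x -> L y -> br x y = - br y x.
Context {E F : V}.
Hypotheses (LE : L E) (LF : L F) (E0 : E != 0) (F0 : F != 0).
Hypothesis HE : br (br E F) E = 2 *: E.
Hypothesis HF : br (br E F) F = - 2 *: F.

Let Ls : is_subspace L. Proof. by case: L_alg. Qed.
Let H := br E F.
Let LH : L H. Proof. by case: L_alg => _; apply. Qed.

Definition sl2_comb a b c := a *: E + (b *: F + c *: H).

Lemma sl2_comb_lin t a b c a' b' c' :
  t *: sl2_comb a b c + sl2_comb a' b' c' = sl2_comb (t * a + a') (t * b + b') (t * c + c').
Proof.
rewrite /sl2_comb !scalerDr !scalerA addrACA -scalerDl; congr (_ + _).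
by rewrite addrACA -!scalerDl.
Qed.

Lemma sl2_comb0 : sl2_comb 0 0 0 = 0.
Proof. by rewrite /sl2_comb !scale0r !addr0. Qed.

Lemma sl2_combZ t a b c : t *: sl2_comb a b c = sl2_comb (t * a) (t * b) (t * c).
Proof. by rewrite -[LHS]addr0 -[in LHS]sl2_comb0 sl2_comb_lin !addr0. Qed.

Lemma sl2_comb_in a b c : L (sl2_comb a b c).
Proof. by apply: subspace_lin => //; apply: subspace_lin => //; exact: subspaceZ. Qed.

Lemma br_comb z a b c : L z ->
  br z (sl2_comb a b c) = a *: br z E + (b *: br z F + c *: br z H).
Proof.
move=> Lz; have LcH : L (c *: H) by exact: subspaceZ.
rewrite /sl2_comb L_linr //; last exact: subspace_lin.
congr (_ + _); rewrite L_linr //; congr (_ + _).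
by rewrite -[c *: H]addr0 L_linr ?(L_br0r L_alg L_linr) ?addr0 //; exact: subspace0.
Qed.

Lemma br_self x : L x -> br x x = 0.
Proof.
move=> Lx; have /eqP := L_anti Lx Lx; rewrite -subr_eq0 opprK -mulr2n -scaler_nat scaler_eq0.
by rewrite pnatr_eq0 => /eqP.
Qed.

Lemma brE_comb a b c : br E (sl2_comb a b c) = sl2_comb (- (2 * c)) 0 b.
Proof.
rewrite br_comb // br_self // (L_anti LE LH) HE /sl2_comb scaler0 add0r scale0r add0r.
by rewrite scalerN scalerA addrC -scaleNr mulrC.
Qed.

Lemma brF_comb a b c : br F (sl2_comb a b c) = sl2_comb 0 (2 * c) (- a).
Proof.
rewrite br_comb // br_self // (L_anti LF LE) (L_anti LF LH) HF /sl2_comb.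
by rewrite scaler0 add0r scale0r add0r scaleNr opprK scalerA mulrC scalerN -scaleNr addrC.
Qed.

Lemma brH_comb a b c : br H (sl2_comb a b c) = sl2_comb (2 * a) (- (2 * b)) 0.
Proof.
rewrite br_comb // br_self // HE HF /sl2_comb scaler0 scale0r !addr0 !scalerA.
by rewrite mulrN [a * 2]mulrC [b * 2]mulrC.
Qed.

Lemma br_comb2 a b c a' b' c' : br (sl2_comb a b c) (sl2_comb a' b' c') =
  sl2_comb (2 * (c * a' - a * c')) (2 * (b * c' - c * b')) (a * b' - b * a').
Proof.
have L1 := sl2_comb_in a' b' c'; have LcH : L (c *: H) by exact: subspaceZ.
have L0 := subspace0 Ls.
rewrite {1}/sl2_comb (L_linl L_alg L_linr L_anti) //; last exact: subspace_lin.
rewrite (L_linl L_alg L_linr L_anti) // -[c *: H]addr0 (L_linl L_alg L_linr L_anti) //.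
rewrite [br 0 _]L_anti // (L_br0r L_alg L_linr) // oppr0 addr0.
rewrite brE_comb brF_comb brH_comb [c *: _]sl2_combZ !sl2_comb_lin.
by congr sl2_comb; ring.
Qed.

(** [E], [F] and [H] have the distinct weights 2, -2 and 0 under [br H]. Twice the first application
    of [br H] plus the second cancels [F] and leaves [8 * a] times [E]; [H] itself is nonzero
    because it does not kill [E]. *)
Lemma sl2_comb_eq0 a b c : sl2_comb a b c = 0 -> [/\ a = 0, b = 0 & c = 0].
Proof.
move=> e; have h1 : sl2_comb (2 * a) (- (2 * b)) 0 = 0.
  by rewrite -(brH_comb a b c) e (L_br0r L_alg L_linr).
have h2 : sl2_comb (2 * (2 * a)) (- (2 * - (2 * b))) 0 = 0.
  by rewrite -(brH_comb _ _ 0) h1 (L_br0r L_alg L_linr).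
have ne8 : (8 : R) != 0 by rewrite pnatr_eq0.
have a0 : a = 0.
  have : 2 *: sl2_comb (2 * a) (- (2 * b)) 0 + sl2_comb (2 * (2 * a)) (- (2 * - (2 * b))) 0 = 0.
    by rewrite h1 h2 scaler0 addr0.
  rewrite sl2_comb_lin (_ : 2 * (2 * a) + _ = 8 * a); last by ring.
  rewrite (_ : 2 * - (2 * b) + _ = 0); last by ring.
  rewrite mulr0 addr0 /sl2_comb !scale0r !addr0 => /eqP.
  by rewrite scaler_eq0 (negbTE E0) orbF mulf_eq0 (negbTE ne8) => /eqP.
have b0 : b = 0.
  move: h1; rewrite a0 mulr0 /sl2_comb !scale0r add0r addr0 => /eqP.
  by rewrite scaler_eq0 (negbTE F0) orbF oppr_eq0 mulf_eq0 pnatr_eq0 => /eqP.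
split=> //; move: e; rewrite a0 b0 /sl2_comb !scale0r !add0r => /eqP.
rewrite scaler_eq0 => /orP[/eqP //|/eqP H0].
have L0 := subspace0 Ls.
have := HE; rewrite -/H H0 L_anti // (L_br0r L_alg L_linr) // oppr0 => /esym/eqP.
by rewrite scaler_eq0 (negbTE E0) pnatr_eq0.
Qed.

Lemma sl2_comb_inj a b c a' b' c' : sl2_comb a b c = sl2_comb a' b' c' ->
  [/\ a = a', b = b' & c = c'].
Proof.
move=> e; have : -1 *: sl2_comb a' b' c' + sl2_comb a b c = 0 by rewrite e scaleN1r addNr.
rewrite sl2_comb_lin !mulN1r ![- _ + _]addrC => /sl2_comb_eq0[].
by split; apply/eqP; rewrite -subr_eq0; apply/eqP.
Qed.

Lemma lie_gen_sl2 :
  lie_gen br [set E; F] = [set sl2_comb t.1.1 t.1.2 t.2 | t in [set: R * R * R]].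
Proof.
apply/seteqP; split.
  apply: smallest_sub.
    split; first split.
    - by exists (0, 0, 0) => //; exact: sl2_comb0.
    - move=> t _ _ [[[a b] c] _ <-] [[[a' b'] c'] _ <-].
      by exists (t * a + a', t * b + b', t * c + c') => //; rewrite sl2_comb_lin.
    - move=> _ _ [[[a b] c] _ <-] [[[a' b'] c'] _ <-]; rewrite br_comb2.
      by exists (2 * (c * a' - a * c'), 2 * (b * c' - c * b'), a * b' - b * a').
  move=> X [->|->].
    by exists (1, 0, 0) => //; rewrite /sl2_comb !scale0r scale1r !addr0.
  by exists (0, 1, 0) => //; rewrite /sl2_comb !scale0r scale1r add0r addr0.
move=> _ [[[a b] c] _ <-] A [[sA bA] SA].
have AE : A E by apply: SA; left.
have AF : A F by apply: SA; right.
by apply: subspace_lin => //; apply: subspace_lin => //; apply: subspaceZ => //; exact: bA.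
Qed.

(** [E] and [F] go to the elementary matrices at [(0, 1)] and [(1, 0)], and their bracket to the
    diagonal matrix with entries 1 and -1. *)
Definition sl2_mx (t : R * R * R) : 'M[R]_2 :=
  \matrix_(i, j) if i == 0 then (if j == 0 then t.2 else t.1.1)
                 else (if j == 0 then t.1.2 else - t.2).

Lemma ord2P (i : 'I_2) : i = 0 \/ i = 1.
Proof. by case: i => [[|[|//]]] ?; [left|right]; exact: val_inj. Qed.

Lemma sum_ord2 (f : 'I_2 -> R) : \sum_i f i = f 0 + f 1.
Proof. by rewrite big_ord_recl big_ord1; congr (_ + f _); exact: val_inj. Qed.

Lemma lie_isomorphic_sl2 :
  lie_isomorphic br (@mx_bracket R 2) (lie_gen br [set E; F]) (@sl R 2).
Proof.
rewrite lie_gen_sl2.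
pose f X := sl2_mx (xget (0, 0, 0) [set t | X = sl2_comb t.1.1 t.1.2 t.2]).
have fE a b c : f (sl2_comb a b c) = sl2_mx (a, b, c).
  rewrite /f; case: xgetP => [[[a' b'] c'] _ /= /sl2_comb_inj[-> -> ->] //|/(_ (a, b, c))].
  by move=> /(_ erefl).
exists f; split.
- move=> t _ _ [[[a b] c] _ <-] [[[a' b'] c'] _ <-]; rewrite sl2_comb_lin !fE.
  apply/matrixP => i j; rewrite !mxE /=; case: ifP => _; case: ifP => _ //.
  by rewrite opprD mulrN.
- move=> _ _ [[[a b] c] _ <-] [[[a' b'] c'] _ <-]; rewrite br_comb2 !fE.
  have entry (A B : 'M[R]_2) i j : mx_bracket A B i j =
      A i 0 * B 0 j + A i 1 * B 1 j - (B i 0 * A 0 j + B i 1 * A 1 j).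
    by rewrite /mx_bracket !mxE !sum_ord2.
  apply/matrixP => i j; rewrite entry !mxE /=.
  by case: (ord2P i) => ->; case: (ord2P j) => -> /=; ring.
split.
- move=> _ [[[a b] c] _ <-]; rewrite fE /sl /=.
  by rewrite /mxtrace sum_ord2 !mxE /= subrr.
- move=> X Y /set_mem [[[a b] c] _ <-] /set_mem [[[a' b'] c'] _ <-]; rewrite !fE /= => /matrixP h.
  have := h 0 0; have := h 0 1; have := h 1 0; rewrite !mxE /= => -> -> ->.
  by [].
move=> A /=; rewrite /sl /= /mxtrace sum_ord2 => /eqP; rewrite addrC addr_eq0 => /eqP A11.
exists (sl2_comb (A 0 1) (A 1 0) (A 0 0)); first by exists (A 0 1, A 1 0, A 0 0).
rewrite fE; apply/matrixP => i j; rewrite mxE /=.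
by case: (ord2P i) => ->; case: (ord2P j) => -> /=.
Qed.

End sl2.

(** * Straightening coordinates *)

Section push_more.
Context {R : realType} {N : nat} {U U' : set 'rV[R]_N} {phi psi : 'rV[R]_N -> 'rV[R]_N}.
Hypothesis lc : local_coordinates U U' phi psi.
Implicit Types X : vfield R N.

Local Notation push := (in_coordinates U' phi psi).

Let Uo : open U. Proof. by case: lc => [[]]. Qed.
Let U'o : open U'. Proof. by case: lc => [[]]. Qed.

Lemma chart_differentiable p : U p -> differentiable phi p.
Proof.
move=> Up; have [_ /(smooth_onP _ Uo) sphi _ _ _] := lc.
exact: (Cv_differentiable Uo (sphi 1) Up).
Qed.

Lemma param_differentiable y : U' y -> differentiable psi y.
Proof.
move=> Uy; have [_ _ /(smooth_onP _ U'o) spsi _ _] := lc.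
exact: (Cv_differentiable U'o (spsi 1) Uy).
Qed.

Lemma push0 : push 0 = 0.
Proof. by have := push_lin lc (-1) 0 0; rewrite scaler0 addr0 scaleN1r addNr. Qed.

Lemma pushZ a X : push (a *: X) = a *: push X.
Proof. by rewrite -[a *: X]addr0 (push_lin lc) push0 addr0. Qed.

Lemma push_sum m (c : 'I_m -> R) (X : 'I_m -> vfield R N) :
  push (\sum_i c i *: X i) = \sum_i c i *: push (X i).
Proof.
elim: (index_enum _) => [|i r IH]; first by rewrite !big_nil push0.
by rewrite !big_cons (push_lin lc) IH.
Qed.

Lemma push_coordinate X (j : 'I_N) :
  (forall y, U' y -> 'D_(delta_mx 0 j) psi y = X (psi y)) -> push X = coordinate_field U' j.
Proof.
move=> h; apply/funext => y; rewrite /coordinate_field.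
case: ifPn => [/set_mem|/negP] yU; last by rewrite push_out // => /mem_set.
have [_ _ _ _ inv] := lc; have [Uy _] := inv _ yU.
rewrite push_in // -h //.
rewrite -(derive_comp _ (param_differentiable yU) (chart_differentiable Uy)).
rewrite (@near_eq_derive _ _ _ _ id) ?derive_id //.
apply: filterS (open_nbhs_nbhs (conj U'o yU)) => z Uz /=.
by have [] := inv _ Uz.
Qed.

(** The derivative of [psi] inverts that of [phi], so the push-forward loses nothing on [U]; passing
    from [U] to the whole space is left to [unique_continuation]. *)
Lemma push_eq0 X p : push X = 0 -> U p -> X p = 0.
Proof.
move=> X0 Up; have [_ _ _ inv _] := lc; have [Uy pE] := inv _ Up.
have := congr1 (fun Y => Y (phi p)) X0; rewrite push_in // pE => e.
have dp := param_differentiable Uy.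
have := derive_comp (X p) (chart_differentiable Up) dp; rewrite e.
rewrite (@near_eq_derive _ _ _ _ id) ?derive_id => [->|].
  by rewrite deriveE // linear0.
by apply: filterS (open_nbhs_nbhs (conj Uo Up)) => z Uz /=; have [] := inv _ Uz.
Qed.

End push_more.

Section flow_box.
Context {R : realType} {N : nat} {n : nat} {r : R}.
Let U' := [set y : 'rV[R]_N | `|y| < r].
Implicit Types (X : vfield R N) (f : 'rV[R]_N -> R).

Lemma norm_ball_open : open U'.
Proof.
rewrite (_ : U' = ball 0 r); first exact: ball_open.
by apply/seteqP; split=> z; rewrite -ball_normE /U' /= sub0r normrN.
Qed.

(** A ball is convex, so the segment from [y] to [z] stays in it, and its direction involves only
    the first [n] coordinates. *)
Lemma pd_zero_indep f (y z : 'rV[R]_N) : Ck 1 U' f ->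
  (forall u, U' u -> forall j : 'I_N, (j < n)%N -> pd j f u = 0) ->
  U' y -> U' z -> (forall j : 'I_N, (n <= j)%N -> y 0 j = z 0 j) -> f y = f z.
Proof.
move=> Cf f0 Uy Uz yz.
have seg s : 0 <= s <= 1 -> U' (y + s *: (z - y)).
  move=> /andP[s0 s1]; rewrite /U' /=.
  have -> : y + s *: (z - y) = (1 - s) *: y + s *: z.
    by rewrite scalerBl scale1r scalerBr addrA addrAC.
  apply: (le_lt_trans (ler_normD _ _)); rewrite !normrZ ger0_norm ?subr_ge0 // ger0_norm //.
  have [->|sn0] := eqVneq s 0; first by rewrite subr0 mul1r mul0r addr0.
  have h1 : (1 - s) * `|y| <= (1 - s) * r by rewrite ler_wpM2l ?subr_ge0 // ltW.
  have h2 : s * `|z| < s * r by rewrite ltr_pM2l // lt_def sn0.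
  by apply: (lt_le_trans (ler_ltD h1 h2)); rewrite -mulrDl subrK mul1r.
have dseg s : 0 <= s <= 1 -> derivable f (y + s *: (z - y)) (z - y).
  move=> hs; apply: diff_derivable.
  exact: (Ck_differentiable norm_ball_open Cf (seg s hs)).
have [s hs] := line_mvt dseg.
rewrite (addrC y (z - y)) subrK (Ck_deriveE _ norm_ball_open Cf (seg s hs)) big1 => [/eqP|j _].
  by rewrite subr_eq0 => /eqP.
have [jn|nj] := ltnP j n; first by rewrite f0 ?mulr0 //; exact: seg.
by rewrite !mxE yz // subrr mul0r.
Qed.

Lemma coordinate_bracket X (j : 'I_N) y s : vector_field_on U' X -> U' y ->
  lie_bracket (coordinate_field U' j) X y 0 s = pd j (fun q => X q 0 s) y.
Proof.
move=> [/(smooth_onP _ norm_ball_open) sX _] Uy.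
have cE q : U' q -> coordinate_field U' j q = delta_mx 0 j.
  by rewrite /coordinate_field => /mem_set ->.
have sc k : Cv k U' (coordinate_field U' j).
  move=> i; apply: (@Ck_eq _ _ _ _ (fun=> delta_mx 0 j 0 i)) => [|q Uq|].
  - exact: norm_ball_open.
  - by rewrite cE.
  - exact: Ck_cst.
rewrite (lie_bracket_coord norm_ball_open s sc sX Uy) {1}/lieD cE //.
rewrite (@lieD_eq _ _ _ norm_ball_open X _ (fun=> (delta_mx 0 j : 'rV[R]_N) 0 s) _ Uy) => [|q Uq].
  by rewrite /lieD derive_cst subr0.
by rewrite cE.
Qed.

(** One statement for both signs: [t] is 1 for a simple root and -1 for its negative. The weight
    condition makes the derivative of [X] along [i] equal to [t] times [X], and the product rule
    cancels it against that of the exponential. *)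
Lemma exp_factor X (t : R) (i : 'I_N) : vector_field_on U' X ->
  (forall (y : 'rV[R]_N) (j : 'I_N), U' y -> (j < n)%N ->
    lie_bracket (coordinate_field U' j) X y = ((j == i)%:R * t) *: X y) ->
  let V (y : 'rV[R]_N) := expR (- (t * y 0 i)) *: X y in
  vector_field_on U' V /\ indep_of_first n U' V.
Proof.
move=> vX wX V; have [/(smooth_onP _ norm_ball_open) sX X0] := vX.
have U'o := norm_ball_open.
have Cl k : Ck k U' (fun y : 'rV[R]_N => - (t * y 0 i)).
  by apply: CkN => //; apply: CkM => //; [exact: Ck_cst|exact: Ck_coord].
have CV k s : Ck k U' (fun y => V y 0 s).
  apply: (@Ck_eq _ _ _ _ (fun y : 'rV[R]_N => expR (- (t * y 0 i)) * X y 0 s)) => // [q _|].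
    by rewrite mxE.
  by apply: CkM => //; [exact: Ck_expR|exact: sX].
split.
  split; first by apply/smooth_onP => // k s; exact: CV.
  by move=> y nUy; rewrite /V X0 // scaler0.
move=> y z Uy Uz yz; apply/rowP => s.
apply: (pd_zero_indep (CV 1 s) _ Uy Uz yz) => u Uu j jn.
have dX : differentiable (fun q => X q 0 s) u := Ck_differentiable U'o (sX 1 s) Uu.
have dl : differentiable (fun y : 'rV[R]_N => - (t * y 0 i)) u := Ck_differentiable U'o (Cl 1) Uu.
have dc : differentiable (fun y : 'rV[R]_N => y 0 i) u :=
  Ck_differentiable U'o (Ck_coord 1 U' i) Uu.
have de : differentiable (fun y : 'rV[R]_N => expR (- (t * y 0 i))) u :=
  Ck_differentiable U'o (Ck_expR U'o (Cl 1)) Uu.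
rewrite (@pd_eq _ _ U' _ (fun y : 'rV[R]_N => expR (- (t * y 0 i)) * X y 0 s)) // => [|q _]; last first.
  by rewrite mxE.
rewrite pdM // pd_expR // pdN; last first.
  by apply: differentiableM => //; exact: differentiable_cst.
rewrite pdM // pd_cst pd_coord -(coordinate_bracket j s vX Uu) wX // mxE.
have gen (a b c d e : R) : e = a -> - (0 * d + t * a) * b * c + b * (e * t * c) = 0.
  by move=> ->; ring.
exact: gen.
Qed.

End flow_box.

Lemma push_lspan1 (R : realType) (N : nat) (U U' : set 'rV[R]_N) (phi psi e : vfield R N) :
  local_coordinates U U' phi psi ->
  [set in_coordinates U' phi psi X | X in lspan [set e]] =
  lspan [set in_coordinates U' phi psi e].
Proof.
move=> lc; rewrite !lspan1; apply/seteqP; split.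
  by move=> _ [_ [t _ <-] <-]; exists t => //; rewrite (pushZ lc).
by move=> _ [t _ <-]; exists (t *: e); [exists t|rewrite (pushZ lc)].
Qed.

(** Ranks are bounded by [n], so some point has maximal rank, and [max_rank_full] applies there. A
    rank is also at most the number of columns, whence [n <= N]. *)
Lemma Cartan_geometric_rank (R : realType) (N n : nat) (L C : set (vfield R N)) :
  L `<=` vector_field_on setT -> semisimple_lie (@lie_bracket R N) L ->
  split_cartan_subalgebra (@lie_bracket R N) L C -> has_dim C n ->
  has_geometric_rank C n /\ (n <= N)%N.
Proof.
move=> L_vf L_semisimple C_split [c cC].
pose P k := `[< exists p, \rank (basis_at c p) = k >].
have exP : exists k, P k by exists (\rank (basis_at c 0)); apply/asboolP; exists 0.
have ubP k : P k -> (k <= n)%N by move=> /asboolP[p <-]; exact: rank_leq_row.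
case: (ex_maxnP exP ubP) => k /asboolP[p pk] kmax.
have pmax q : (\rank (basis_at c q) <= \rank (basis_at c p))%N.
  by rewrite pk; apply: kmax; apply/asboolP; exists q.
have rn := max_rank_full L_vf L_semisimple C_split cC pmax.
split; last by rewrite -rn; exact: rank_leq_col.
split; first by exists p; apply/(leaf_dimP C_split cC).
by move=> q s /(leaf_dimP C_split cC) ->; exact: rank_leq_row.
Qed.

Theorem theorem2p1 (R : realType) (N n : nat) (L C : set (vfield R N))
    (L_vf : L `<=` vector_field_on setT)
    (L_semisimple : semisimple_lie (@lie_bracket R N) L)
    (C_split : split_cartan_subalgebra (@lie_bracket R N) L C)
    (C_dim : has_dim C n) :
  has_geometric_rank C n /\
  exists nN : (n <= N)%N,
  forall alpha : 'I_n -> vfield R N -> R,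
    simple_roots (@lie_bracket R N) L C alpha ->
  forall p : 'rV[R]_N, has_leaf_dim C p n ->
  exists (U U' : set 'rV[R]_N) (phi psi : 'rV[R]_N -> 'rV[R]_N)
         (V W : 'I_n -> vfield R N),
    let x (i : 'I_n) : 'I_N := widen_ord nN i in
    let E (i : 'I_n) : vfield R N := fun y => expR (y 0 (x i)) *: V i y in
    let F (i : 'I_n) : vfield R N := fun y => expR (- y 0 (x i)) *: W i y in
    [/\ U p /\ local_coordinates U U' phi psi,
        forall i, [/\ vector_field_on U' (V i), vector_field_on U' (W i),
                      indep_of_first n U' (V i) & indep_of_first n U' (W i)],
        forall i,
          [set in_coordinates U' phi psi X
             | X in root_space (@lie_bracket R N) L C (alpha i)]
            = lspan [set E i] /\
          [set in_coordinates U' phi psi X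
             | X in root_space (@lie_bracket R N) L C (fun h => - alpha i h)]
            = lspan [set F i],
        lspan [set lie_bracket (E i) (F i) | i in [set: 'I_n]]
          = lspan [set coordinate_field U' (x i) | i in [set: 'I_n]] &
        forall i, lie_isomorphic (@lie_bracket R N) (@mx_bracket R 2)
                    (lie_gen (@lie_bracket R N) [set E i; F i]) (@sl R 2)].
Proof.
have [grank nN] := Cartan_geometric_rank L_vf L_semisimple C_split C_dim.
split=> //; exists nN => alpha salpha p pn.
have [L_alg L_dim L_ss] := L_semisimple.
have CL X : C X -> L X by case: C_split => -[h _ _ _] _; exact: h.
have Cs : is_subspace C by case: C_split => -[_ [h _] _ _] _.
have Lb X Y : L X -> L Y -> L (lie_bracket X Y) by case: L_alg => _; apply.
have L_smooth X : L X -> smooth_field X by move=> /L_vf /smooth_fieldP.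
have linr := field_linr L_vf.
have anti := @field_anti R N L.
have jac := field_jacobi L_vf L_semisimple.
have [d [b [lam [bL hlam]]]] := joint_eigenbasis L_alg linr anti jac C_split C_dim L_dim.
have [h [e [f [ha hspan hroot hef hCspan]]]] :=
  simple_root_sl2 L_alg linr anti jac C_split C_dim L_ss bL hlam salpha.
have Ch i : C (h i) by case: (ha i).
have hC : is_basis C h.
  have [roots _ _] := salpha.
  have alin i t X Y : C X -> C Y -> alpha i (t *: X + Y) = t * alpha i X + alpha i Y.
    by case: (roots i) => a _ _; exact: a.
  have a0 i : alpha i 0 = 0.
    have := alin i (-1) 0 0 (subspace0 Cs) (subspace0 Cs).
    by rewrite scaler0 addr0 mulN1r addNr.
  split; last first.
    apply/seteqP; split=> [X CX|].
      by rewrite lspan_range; exists (fun i => alpha i X) => //; rewrite -hspan.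
    by apply: (lspan_min Cs) => _ [i _ <-].
  move=> t t0 i.
  have : alpha i (\sum_j t j *: h j) = \sum_j t j * alpha i (h j).
    elim: (index_enum _) => [|j s IH]; first by rewrite !big_nil a0.
    rewrite !big_cons alin ?IH //; apply: (subspace_sum _ Cs) => m.
    by apply: (subspaceZ _ Cs).
  rewrite t0 a0 (bigD1 i) //= big1 => [|j /negbTE ji].
    by rewrite (ha i).2 eqxx mulr1 addr0.
  by rewrite (ha j).2 eq_sym ji mulr0.
(* A leaf of dimension [n] through [p] means that the coweight fields are independent at [p], which
   allows straightening around this very point. *)
have rk : \rank (\matrix_i h i p) = n.
  by apply/esym; apply/(leaf_dimP C_split hC).
have hsm i : smooth_on setT (h i).
  by apply/(smooth_onP _ openT); apply: L_smooth; exact: CL.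
have comm i j u : lie_bracket (h i) (h j) u = 0.
  by rewrite (Cartan_abelian L_alg linr C_split (Ch i) (Ch j)).
have [r r0 [U [phi [psi [Up lc dpsi]]]]] := straighten nN hsm comm rk.
set U' := [set y | `|y| < r] in lc dpsi.
pose push := in_coordinates U' phi psi.
have ph i : push (h i) = coordinate_field U' (widen_ord nN i).
  by apply: (push_coordinate lc) => y Uy; exact: dpsi.
have re i : root_space (@lie_bracket R N) L C (alpha i) (e i).
  by rewrite (hroot i).1; exact: sub_lspan.
have rf i : root_space (@lie_bracket R N) L C (fun X => - alpha i X) (f i).
  by rewrite (hroot i).2; exact: sub_lspan.
have Le i : L (e i) by case: (re i).
have Lf i : L (f i) by case: (rf i).
have weight X t i : L X -> (forall Y, C Y -> lie_bracket Y X = (t * alpha i Y) *: X) ->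
    forall (y : 'rV[R]_N) (j : 'I_N), U' y -> (j < n)%N ->
    lie_bracket (coordinate_field U' j) (push X) y = ((j == widen_ord nN i)%:R * t) *: push X y.
  move=> LX wX y j Uy jn; have -> : j = widen_ord nN (Ordinal jn) by exact: val_inj.
  rewrite -ph /push -(push_bracket lc); [|by apply: L_smooth; exact: CL|exact: L_smooth].
  rewrite wX // (pushZ lc) (ha _).2 mulrC -val_eqE /= eq_sym.
  by [].
(* [V i] and [W i] strip off the exponentials, so that [E i] and [F i] are exactly the pushed root
   vectors; the factors 1 and -1 match the shape of [exp_factor]. *)
pose V i (y : 'rV[R]_N) := expR (- (1 * y 0 (widen_ord nN i))) *: push (e i) y.
pose W i (y : 'rV[R]_N) := expR (- (- 1 * y 0 (widen_ord nN i))) *: push (f i) y.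
have hV i : vector_field_on U' (V i) /\ indep_of_first n U' (V i).
  apply: exp_factor; first exact: (push_vector_field lc (L_smooth _ (Le i))).
  apply: weight => // Y CY; rewrite mul1r; by case: (re i) => _; apply.
have hW i : vector_field_on U' (W i) /\ indep_of_first n U' (W i).
  apply: exp_factor; first exact: (push_vector_field lc (L_smooth _ (Lf i))).
  apply: weight => // Y CY; rewrite mulN1r; by case: (rf i) => _; apply.
exists U, U', phi, psi, V, W => x E F.
have EE i : E i = push (e i).
  by apply/funext => y; rewrite /E /V /x scalerA -expRD mul1r subrr expR0 scale1r.
have FE i : F i = push (f i).
  by apply/funext => y; rewrite /F /W /x scalerA -expRD mulN1r opprK addNr expR0 scale1r.
have EFE i : lie_bracket (E i) (F i) = push (lie_bracket (e i) (f i)).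
  by rewrite EE FE /push (push_bracket lc (L_smooth _ (Le i)) (L_smooth _ (Lf i))).
split=> //.
- by move=> i; have [[? ?] [? ?]] := (hV i, hW i); split.
- by move=> i; rewrite (hroot i).1 (hroot i).2 EE FE; split; exact: (push_lspan1 _ lc).
(* The brackets are the pushed coroots and the coordinate fields the pushed coweights; each family
   is a combination of the other. *)
- apply/seteqP; split; apply: (lspan_min (lspan_subspace _)) => _ [i _ <-].
    have [_ _ Cef _] := hef i.
    rewrite EFE (hspan _ Cef) /push (push_sum lc).
    apply: (subspace_sum _ (lspan_subspace _)) => j.
    apply: (subspaceZ _ (lspan_subspace _)); apply: sub_lspan.
    by exists j => //; rewrite -ph.
  have [c cE] := hCspan _ (Ch i).
  rewrite -ph cE /push (push_sum lc).
  apply: (subspace_sum _ (lspan_subspace _)) => j.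
  apply: (subspaceZ _ (lspan_subspace _)); apply: sub_lspan.
  by exists j => //; rewrite EFE.
move=> i; have [e0 f0 Cef a2] := hef i.
(* The image of [L] serves as the ambient Lie algebra in the chart, on which the bracket is linear
   as [lie_isomorphic_sl2] requires. *)
pose M := [set push X | X in L].
have Ls : is_subspace L by case: L_alg.
have M_alg : lie_subalgebra (@lie_bracket R N) M.
  split; first split.
  - by exists 0; [exact: subspace0|exact: (push0 lc)].
  - move=> t _ _ [X LX <-] [Y LY <-]; exists (t *: X + Y); last exact: (push_lin lc).
    exact: subspace_lin.
  move=> _ _ [X LX <-] [Y LY <-]; exists (lie_bracket X Y); first exact: Lb.
  exact: (push_bracket lc (L_smooth _ LX) (L_smooth _ LY)).
have M_linr t X Y Z : M X -> M Y -> M Z ->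
    lie_bracket Z (t *: X + Y) = t *: lie_bracket Z X + lie_bracket Z Y.
  move=> [{}X LX <-] [{}Y LY <-] [{}Z LZ <-].
  have [sX sY sZ] := And3 (L_smooth _ LX) (L_smooth _ LY) (L_smooth _ LZ).
  rewrite /push -(push_lin lc) -!(push_bracket lc) //; last exact: smooth_lin.
  by rewrite lie_bracket_linr // (push_lin lc).
have M_anti X Y : M X -> M Y -> lie_bracket X Y = - lie_bracket Y X.
  by move=> _ _; exact: lie_bracketNC.
(* An element of [L] with zero push-forward vanishes on [U], hence on a ball around [p], hence
   everywhere. *)
have push_neq0 X : L X -> X != 0 -> push X != 0.
  move=> LX; apply: contra => /eqP X0; apply/eqP.
  have [[Uo _] _ _ _ _] := lc; have [s s0 hs] := open_radius Uo Up.
  apply: (unique_continuation L_vf L_semisimple LX s0) => q /hs Uq.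
  exact: (push_eq0 lc X0 Uq).
rewrite EE FE.
apply: (lie_isomorphic_sl2 M_alg M_linr M_anti).
- by exists (e i).
- by exists (f i).
- exact: push_neq0.
- exact: push_neq0.
- have sef := L_smooth _ (Lb _ _ (Le i) (Lf i)).
  rewrite -EE -FE EFE EE /push -(push_bracket lc sef (L_smooth _ (Le i))).
  by have [_ ->//] := re i; rewrite a2 (pushZ lc).
have sef := L_smooth _ (Lb _ _ (Le i) (Lf i)).
rewrite -EE -FE EFE FE /push -(push_bracket lc sef (L_smooth _ (Lf i))).
by have [_ ->//] := rf i; rewrite a2 (pushZ lc).
Qed.
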